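(* In the Bradley–Terry model, let $r>2$ be a fixed integer and suppose $b_n^{11}/c_n^6=o\big(n^{1/2}/(\log n)^{5/2}\big)$. Under the homogeneous null $H_0:\beta_2=\cdots=\beta_r$ (true parameter satisfying it), with $\hat{\boldsymbol\beta}^0$ the maximizer of $\ell_{bt}$ over $\{\boldsymbol\gamma\in\mathbb R^{n-1}:\gamma_2=\cdots=\gamma_r\}$, the statistic $2\{\ell_{bt}(\hat{\boldsymbol\beta})-\ell_{bt}(\hat{\boldsymbol\beta}^0)\}$ converges in distribution to the chi-square distribution with $r-2$ degrees of freedom as $n\to\infty$.
   Context: All quantities may depend on $n$; asymptotics are as $n\to\infty$. Bradley–Terry model: $n$ items; for each pair $1\le i<j\le n$ a number of comparisons $k_{ij}=k_{ji}\in\{1,\dots,K\}$ with $K$ a fixed constant; $a_{ij}\sim\mathrm{Binomial}(k_{ij},p_{ij})$ with $p_{ij}=e^{\beta_i-\beta_j}/(1+e^{\beta_i-\beta_j})$, $a_{ji}=k_{ij}-a_{ij}$, and $a_{ij}$, $1\le i<j\le n$, mutually independent. $\beta_1=0$; the parameter is $\boldsymbol\beta=(\beta_2,\dots,\beta_n)^\top$. $d_i=\sum_{j\ne i}a_{ij}$. $\ell_{bt}(\boldsymbol\gamma)=\sum_{i=1}^n\gamma_id_i-\sum_{1\le i<j\le n}k_{ij}\log(e^{\gamma_i}+e^{\gamma_j})$ with $\gamma_1=0$; $\hat{\boldsymbol\beta}$ is its maximizer over $\mathbb R^{n-1}$. $b_n=\max_{i\ne j}(1+e^{\beta_i-\beta_j})^2/e^{\beta_i-\beta_j}$,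 $c_n=\min_{i\ne j}(1+e^{\beta_i-\beta_j})^2/e^{\beta_i-\beta_j}$ at the true parameter. *)

(* Defs.v *)
From HB Require Import structures.
From mathcomp Require Import all_boot all_order all_algebra.
From mathcomp Require Import all_classical all_reals all_analysis.
Set Implicit Arguments. Unset Strict Implicit. Unset Printing Implicit Defensive.
Import Order.TTheory GRing.Theory Num.Theory.
Import numFieldNormedType.Exports.
Local Open Scope classical_set_scope.
Local Open Scope ring_scope.

(* Items 1..n of the paper are indexed by 'I_n = {0,..,n-1}: paper item i+1 <-> index i.
   So beta_1 = 0 becomes  beta ord0 = 0  (i.e. value at index 0). *)

(* An outcome for n items: a(i,j) for i<j (values >= K+1 impossible, fixed by K).
   Only entries with (i < j) are meaningful; validity forces the others to be 0. *)
Definition outcome (n K : nat) := {ffun 'I_n * 'I_n -> 'I_K.+1}.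

Definition valid_outcome (n K : nat) (k : 'I_n -> 'I_n -> nat) (a : outcome n K) : bool :=
  [forall i : 'I_n, forall j : 'I_n,
     if (i < j)%N then (a (i, j) <= k i j)%N else (nat_of_ord (a (i, j)) == 0%N)].

Definition aij (n K : nat) (k : 'I_n -> 'I_n -> nat) (a : outcome n K) (i j : 'I_n) : nat :=
  if (i < j)%N then nat_of_ord (a (i, j)) else (k i j - a (j, i))%N.

Definition dscore (n K : nat) (k : 'I_n -> 'I_n -> nat) (a : outcome n K) (i : 'I_n) : nat :=
  (\sum_(j < n | j != i) aij k a i j)%N.

Definition btp {R : realType} (x y : R) : R := expR (x - y) / (1 + expR (x - y)).

Definition bt_prob {R : realType} (n K : nat) (k : 'I_n -> 'I_n -> nat)
    (beta : 'I_n -> R) (a : outcome n K) : R :=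
  if valid_outcome k a then
    \prod_(i < n) \prod_(j < n | (i < j)%N)
      ('C(k i j, a (i, j))%:R * btp (beta i) (beta j) ^+ a (i, j)
         * (1 - btp (beta i) (beta j)) ^+ (k i j - a (i, j)))
  else 0.

Definition bt_cdf {R : realType} (n K : nat) (k : 'I_n -> 'I_n -> nat)
    (beta : 'I_n -> R) (T : outcome n K -> R) (x : R) : R :=
  \sum_(a : outcome n K | T a <= x) bt_prob k beta a.

Definition ell_bt {R : realType} (n K : nat) (k : 'I_n -> 'I_n -> nat)
    (a : outcome n K) (g : 'I_n -> R) : R :=
  \sum_(i < n) g i * (dscore k a i)%:R
  - \sum_(i < n) \sum_(j < n | (i < j)%N) (k i j)%:R * ln (expR (g i) + expR (g j)).

(* parameter space: gamma_1 = 0 (paper), i.e. value 0 at index 0 *)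
Definition full_space {R : realType} (n : nat) (g : 'I_n -> R) : Prop :=
  forall i : 'I_n, nat_of_ord i = 0%N -> g i = 0.

(* null space: additionally gamma_2 = ... = gamma_r (indices 1..r-1) *)
Definition null_space {R : realType} (n r : nat) (g : 'I_n -> R) : Prop :=
  full_space g /\
  forall i j : 'I_n, (1 <= i)%N -> (i < r)%N -> (1 <= j)%N -> (j < r)%N -> g i = g j.

Definition is_maximizer {R : realType} (n K : nat) (k : 'I_n -> 'I_n -> nat)
    (a : outcome n K) (S : ('I_n -> R) -> Prop) (g : 'I_n -> R) : Prop :=
  S g /\ forall h, S h -> ell_bt k a h <= ell_bt k a g.

Definition vfun {R : realType} (x : R) : R := (1 + expR x) ^+ 2 / expR x.

Definition b_n {R : realType} (n : nat) (beta : 'I_n -> R) : R :=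
  \big[Num.max/0]_(i < n) \big[Num.max/0]_(j < n | j != i) vfun (beta i - beta j).

(* c_n = min_{i != j} vfun(beta_i - beta_j); the neutral start b_n does not affect
   the value when n >= 2 since every term is <= b_n *)
Definition c_n {R : realType} (n : nat) (beta : 'I_n -> R) : R :=
  \big[Num.min/b_n beta]_(i < n) \big[Num.min/b_n beta]_(j < n | j != i)
     vfun (beta i - beta j).

Definition chisq_kernel {R : realType} (m : nat) (t : R) : R :=
  powR t (m%:R / 2 - 1) * expR (- t / 2).

Definition chisq_cdf {R : realType} (m : nat) (x : R) : R :=
  fine (\int[@lebesgue_measure R]_(t in `]0, x]) (chisq_kernel m t)%:E)
  / fine (\int[@lebesgue_measure R]_(t in `]0, +oo[) (chisq_kernel m t)%:E).

(* Main.v *)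
Require Import Defs.
From mathcomp Require Import all_boot all_order all_algebra.
From mathcomp Require Import all_classical all_reals all_analysis measurable_realfun.
From mathcomp Require Import ring lra.
Set Implicit Arguments.
Unset Strict Implicit.
Unset Printing Implicit Defensive.
Import Order.TTheory GRing.Theory Num.Theory.
Import numFieldNormedType.Exports.
Local Open Scope classical_set_scope.
Local Open Scope ring_scope.

(* Let B be the block of items whose merits agree under the null, and let D_i (i in B) be the
   centred score of item i restricted to its comparisons with items outside B; the D_i are
   independent, with variances v_i. The log-likelihood is concave, so both maximizers are
   characterised by their score equations; on an event of probability 1 - O(1/n) they exist
   within O(b_n (log n / n)^(1/2)) of the truth. A trapezoidal expansion of the likelihood
   between the two maximizers shows that the statistic is
     Q = sum_B D_i^2 / v_i - (sum_B D_i)^2 / sum_B v_i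
   up to O(b_n^6 (log n)^(3/2) / n^(1/2)), because the two maximizers nearly coincide outside B.
   Q is the squared length of the projection of the standardised D onto a hyperplane of R^(r-1).
   Replacing the summands of D by Gaussian ones, one comparison at a time, gives
   E exp(-l Q) -> (1 + 2 l)^(-(r-2)/2) for every natural number l, and since exp(-Q) lies in
   [0, 1] these moments determine the limit law. *)

Section Calculus.
Context {R : realType}.

Lemma is_derive_continuous (f : R -> R) (x d : R) :
  is_derive x 1 f d -> {for x, continuous f}.
Proof.
by move=> fd; apply: differentiable_continuous; apply/derivable1_diffP; exact: ex_derive.
Qed.

Lemma mean_value (f df : R -> R) (x t : R) : (forall y : R, is_derive y 1 f (df y)) ->
  exists2 s, 0 <= s <= 1 & f (x + t) - f x = df (x + s * t) * t.
Proof.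
move=> fd; have cf : continuous f by move=> y; exact: is_derive_continuous (fd y).
have [t0|t0|<-] := ltgtP 0 t; last by exists 0; rewrite ?lexx ?ler01// addr0 subrr mulr0.
- have xt : x < x + t by rewrite ltrDl.
  have [y] := MVT xt (fun y _ => fd y) (continuous_subspaceT cf).
  rewrite in_itv /= => /andP[xy yt] ->; exists ((y - x) / t).
    by rewrite divr_ge0 ?ler_pdivrMr//; lra.
  by rewrite divfK ?gt_eqF// subrKC addrAC subrr add0r.
- have xt : x + t < x by rewrite gtrDl.
  have [y] := MVT xt (fun y _ => fd y) (continuous_subspaceT cf).
  rewrite in_itv /= => /andP[ty yx] e; exists ((y - x) / t).
    by rewrite -mulrNN -invrN divr_ge0 ?ler_pdivrMr; lra.
  by rewrite divfK ?lt_eqF// subrKC -opprB e; ring.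
Qed.

Lemma mean_value_bound (f df : R -> R) (x t M : R) :
  (forall y : R, is_derive y 1 f (df y)) ->
  (forall s, `|s| <= `|t| -> `|df (x + s)| <= M) ->
  `|f (x + t) - f x| <= M * `|t|.
Proof.
move=> fd dfM; have [s /andP[s0 s1] ->] := mean_value x t fd.
by rewrite normrM ler_wpM2r// dfM// normrM ger0_norm// ler_piMl.
Qed.

Lemma is_derive_expR_series n (x : R) :
  is_derive x 1 (fun y : R => \sum_(i < n.+1) y ^+ i / i`!%:R) (\sum_(i < n) x ^+ i / i`!%:R).
Proof.
elim: n => [|n IH].
  rewrite big_ord0 (_ : (fun y => _) = cst 1); first exact: is_derive_cst.
  by apply/funext => y; rewrite big_ord1 expr0 fact0 divr1.
rewrite big_ord_recr (_ : (fun y => _) = (fun y : R => \sum_(i < n.+1) y ^+ i / i`!%:R) \+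
    (fun y => y ^+ n.+1 / n.+1`!%:R)); last by apply/funext => y; rewrite big_ord_recr.
apply: is_deriveD.
have dX : is_derive x 1 (fun y : R => y ^+ n.+1) (n.+1%:R * x ^+ n).
  have -> : (fun y : R => y ^+ n.+1) = id ^+ n.+1 by rewrite exprfctE.
  by apply: is_derive_eq (is_deriveX n.+1 (is_derive_id x 1)) _; rewrite /GRing.scale /= mulr1.
have -> : (fun y : R => y ^+ n.+1 / n.+1`!%:R) = n.+1`!%:R^-1 \*: (fun y : R => y ^+ n.+1).
  by apply/funext => y /=; rewrite mulrC.
apply: is_derive_eq (is_deriveZ _ dX) _; rewrite /GRing.scale /= factS natrM.
by field; rewrite nat1r !pnatr_eq0 -lt0n fact_gt0.
Qed.

Lemma expR_taylor_le n (x : R) :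
  `|expR x - \sum_(i < n) x ^+ i / i`!%:R| <= `|x| ^+ n * expR `|x|.
Proof.
elim: n x => [|n IH] x.
  by rewrite big_ord0 subr0 expr0 mul1r ger0_norm ?expR_ge0// ler_expR ler_norm.
pose remainder m y : R := expR y - \sum_(i < m) y ^+ i / i`!%:R.
have dr (y : R) : is_derive y 1 (remainder n.+1) (remainder n y).
  by have ds := is_derive_expR_series n y; apply: is_deriveB.
have r0 : remainder n.+1 0 = 0.
  rewrite /remainder expR0 big_ord_recl expr0 fact0 divr1 big1 ?addr0 ?subrr// => i _.
  by rewrite expr0n mul0r.
have := @mean_value_bound _ _ 0 x (`|x| ^+ n * expR `|x|) dr.
rewrite add0r r0 subr0 -mulrA [expR _ * _]mulrC mulrA -exprSr; apply => y yx.
rewrite add0r (le_trans (IH _))// ler_pM ?exprn_ge0 ?expR_ge0 ?ler_expR//.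
by rewrite lerXn2r.
Qed.

Lemma expR_taylor1 (x : R) : `|expR x - 1 - x| <= x ^+ 2 * expR `|x|.
Proof.
have := expR_taylor_le 2 x; rewrite !big_ord_recr big_ord0 /= !factE add0r expr0 expr1 !divr1.
by rewrite opprD addrA -normrX (ger0_norm (sqr_ge0 x)).
Qed.

Lemma expR_taylor2 (x : R) : `|expR x - 1 - x - x ^+ 2 / 2| <= `|x| ^+ 3 * expR `|x|.
Proof.
have := expR_taylor_le 3 x; rewrite !big_ord_recr big_ord0 /= !factE add0r expr0 expr1 !divr1.
by rewrite !opprD !addrA.
Qed.

Lemma expR1_le4 : expR 1 <= 4 :> R.
Proof.
have inv := expRxMexpNx_1 (1 / 2 : R); have lower := expR_ge1Dx (- (1 / 2) : R).
have half : expR (1 / 2) <= 2 :> R by have := expR_gt0 (1 / 2 : R); nra.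
rewrite [in leLHS](splitr 1) expRD; have := expR_gt0 (1 / 2 : R); nra.
Qed.

Lemma expR_le_add_expR_sqr (x : R) : expR x <= x + expR (4 * x ^+ 2).
Proof.
have quad := expR_ge1Dx (4 * x ^+ 2); have sqr0 := sqr_ge0 x.
have [x1|] := leP `|x| 1.
  have := expR_taylor1 x; rewrite ler_norml => /andP[_].
  have : expR `|x| <= 4 by apply: le_trans expR1_le4; rewrite ler_expR.
  nra.
case: (ger0P x) => x0 x1.
  by rewrite (@le_trans _ _ (expR (4 * x ^+ 2))) ?lerDr// ler_expR expr2; nra.
have : expR x <= 1 by rewrite expR_le1 ltW.
by rewrite expr2 in quad *; nra.
Qed.

Lemma ln1D_ge (p : R) : 0 <= p -> p - p ^+ 2 <= ln (1 + p).
Proof.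
move=> p0; have p1 : 0 < 1 + p by lra.
have V0 : 0 < (1 + p)^-1 by rewrite invr_gt0.
have V1 : (1 + p) * (1 + p)^-1 = 1 by rewrite divff// gt_eqF.
have upper : - ln (1 + p) <= (1 + p)^-1 - 1.
  by have := @le_ln1Dx R ((1 + p)^-1 - 1); rewrite subrKC lnV ?posrE//; apply; lra.
by rewrite expr2; nra.
Qed.

End Calculus.

Section QuadraticExponential.
Context {R : realType}.

Lemma expR_quad_taylor (A g alpha h : R) : 1 <= A -> 0 <= alpha <= A -> `|h| <= 1 ->
  `|expR (- (g * h + alpha * h ^+ 2)) - (1 - g * h - alpha * h ^+ 2 + g ^+ 2 * h ^+ 2 / 2)|
  <= 2 * (`|g| + A) ^+ 3 * expR (`|g| + A) * `|h| ^+ 3.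
Proof.
move=> A1 /andP[a0 aA] h_le1; pose U : R := `|g| + A; rewrite -/U.
have g_ge0 : 0 <= `|g| by []. have h_ge0 : 0 <= `|h| by [].
have U1 : 1 <= U by rewrite /U; lra.
have h3_ge0 : 0 <= `|h| ^+ 3 by exact: exprn_ge0.
pose w := - (g * h + alpha * h ^+ 2).
have wU : `|w| <= U * `|h|.
  rewrite normrN (le_trans (ler_normD _ _))// normrM [ `|alpha * _|]normrM (ger0_norm a0) normrX.
  rewrite mulrDl lerD2l.
  by rewrite expr2 mulrA ler_wpM2r//; nra.
have wU1 : `|w| <= U by nra.
have cubic : `|w| ^+ 3 * expR `|w| <= U ^+ 3 * expR U * `|h| ^+ 3.
  rewrite [leRHS]mulrAC -exprMn ler_pM ?exprn_ge0 ?expR_ge0 ?ler_expR//.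
  by apply: lerXn2r; rewrite ?nnegrE //; nra.
have quartic : `|(g * alpha * h + alpha ^+ 2 * h ^+ 2 / 2) * h ^+ 2| <= U ^+ 2 * `|h| ^+ 3.
  rewrite normrM normrX (_ : U ^+ 2 * _ = U ^+ 2 * `|h| * `|h| ^+ 2); last by ring.
  rewrite ler_wpM2r ?sqr_ge0// (le_trans (ler_normD _ _))//.
  rewrite !normrM (ger0_norm a0) [ `|2^-1|]ger0_norm//.
  have cross : `|g| * alpha * `|h| <= `|g| * A * `|h| by rewrite ler_wpM2r ?ler_wpM2l.
  have square : alpha ^+ 2 * `|h| ^+ 2 <= A ^+ 2 * `|h|.
    rewrite ler_pM ?sqr_ge0 ?lerXn2r ?nnegrE ?(le_trans a0)//.
    by rewrite expr2 ler_piMr.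
  have := mulr_ge0 (sqr_ge0 `|g|) h_ge0; have := mulr_ge0 (sqr_ge0 A) h_ge0.
  have : 0 <= `|g| * A * `|h| by rewrite !mulr_ge0//; lra.
  by rewrite /U sqrrD; lra.
have absorb : U ^+ 2 * `|h| ^+ 3 <= U ^+ 3 * expR U * `|h| ^+ 3.
  have Ue : 1 <= U * expR U by rewrite mulr_ege1//; have := expR_ge1Dx U; lra.
  by rewrite ler_wpM2r// (exprSr U 2) -mulrA ler_peMr ?sqr_ge0.
rewrite -/w (_ : expR w - _ = (expR w - 1 - w - w ^+ 2 / 2)
    + (g * alpha * h + alpha ^+ 2 * h ^+ 2 / 2) * h ^+ 2); last by rewrite /w; field.
have := ler_normD (expR w - 1 - w - w ^+ 2 / 2)
  ((g * alpha * h + alpha ^+ 2 * h ^+ 2 / 2) * h ^+ 2).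
have := expR_taylor2 w; lra.
Qed.

Lemma expRN_mul_cubic_le (A q g : R) : 1 <= A -> g ^+ 2 <= 4 * A * q ->
  expR (- q) * ((`|g| + A) ^+ 3 * expR (`|g| + A)) <= expR (20 * A).
Proof.
move=> A1 gq; pose U : R := `|g| + A; rewrite -/U; have g0 : 0 <= `|g| by [].
have cube : U ^+ 3 <= expR (3 * U).
  rewrite expRM_natl lerXn2r ?nnegrE ?expR_ge0 /U //; first lra.
  by have := expR_ge1Dx (`|g| + A); lra.
apply: (@le_trans _ _ (expR (- q) * (expR (3 * U) * expR U))).
  by rewrite ler_wpM2l ?expR_ge0// ler_wpM2r ?expR_ge0.
rewrite -!expRD ler_expR -(ler_pM2l (lt_le_trans ltr01 A1)) /U.
have := sqr_ge0 (`|g| - 8 * A); rewrite sqrrB.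
by move: gq; rewrite -(ger0_norm (sqr_ge0 g)) normrX; lra.
Qed.

Lemma expR_quad_expand (A q g alpha h : R) : 1 <= A -> 0 <= alpha <= A -> 0 <= q ->
  g ^+ 2 <= 4 * alpha * q -> `|h| <= 1 ->
  `|expR (- (q + g * h + alpha * h ^+ 2))
     - expR (- q) * (1 - g * h - alpha * h ^+ 2 + g ^+ 2 * h ^+ 2 / 2)|
  <= 2 * expR (20 * A) * `|h| ^+ 3.
Proof.
move=> A1 aA q0 gq h1; have /andP[_ aA'] := aA.
have gAq : g ^+ 2 <= 4 * A * q by rewrite (le_trans gq)// ler_wpM2r//; lra.
rewrite -addrA opprD expRD -mulrBr normrM (gtr0_norm (expR_gt0 _)).
apply: le_trans (ler_wpM2l (expR_ge0 _) (expR_quad_taylor g A1 aA h1)) _.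
have := ler_wpM2r (exprn_ge0 3 (normr_ge0 h)) (expRN_mul_cubic_le A1 gAq); lra.
Qed.

Lemma gauss_exponent_linear (p G q : R) : 0 <= p <= 1 / 2 -> 0 <= q -> 0 <= G <= p * q ->
  let w := G / (1 + p) - ln (1 + p) / 2 in
  [/\ `|w| <= q / 2 + 1, `|w| <= p * (1 / 2 + q) & `|w - (G - p / 2)| <= p ^+ 2 * (1 / 2 + q)].
Proof.
move=> /andP[p0 p12] q0 /andP[G0 Gpq] w.
have lower := ln1D_ge p0; have upper : ln (1 + p) <= p by apply: le_ln1Dx; lra.
have pq : p * q <= q / 2 by nra.
have p1 : 0 < 1 + p by lra.
have ln0 : 0 <= ln (1 + p) by rewrite ln_ge0; lra.
set V := (1 + p)^-1; have V0 : 0 < V by rewrite invr_gt0.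
have VE : V = 1 - p * V by rewrite /V; field; rewrite gt_eqF.
have GV : 0 <= G * V <= G by rewrite mulr_ge0 ?ler_piMr ?(ltW V0)// invf_le1//; lra.
have GpV : 0 <= G * (p * V) <= p * q * p.
  by rewrite !mulr_ge0 ?(ltW V0)//= ler_pM ?mulr_ge0 ?(ltW V0)//; nra.
split; rewrite ler_norml /w -/V; [by apply/andP; split; lra..|].
have -> : G * V - ln (1 + p) / 2 - (G - p / 2) = (p - ln (1 + p)) / 2 - G * (p * V).
  by rewrite [in LHS]VE; ring.
by move: lower; rewrite expr2 => lower; apply/andP; split; lra.
Qed.

Lemma sqr_1D2_expR_le (q : R) : 0 <= q -> (1 + 2 * q) ^+ 2 * expR (- (q / 2)) <= 64.
Proof.
move=> q0; rewrite (_ : 64 = 8 ^+ 2 :> R); last by ring.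
rewrite (_ : - (q / 2) = 2 * - (q / 4)); last by field.
rewrite expRM_natl -exprMn lerXn2r ?nnegrE ?mulr_ge0 ?expR_ge0//; first lra.
have := expR_ge1Dx (q / 4); have := expRxMexpNx_1 (q / 4); have := expR_gt0 (- (q / 4)).
nra.
Qed.

Lemma expR_heat_expand (p G q : R) : 0 <= p <= 1 / 2 -> 0 <= q -> 0 <= G <= p * q ->
  `|expR (- q + (G / (1 + p) - ln (1 + p) / 2)) - expR (- q) * (1 + (G - p / 2))| <= 96 * p ^+ 2.
Proof.
move=> pP q0 GP; have [] := gauss_exponent_linear pP q0 GP.
set w := _ - _; move=> w_q w_p w_lin.
rewrite expRD -mulrBr normrM (gtr0_norm (expR_gt0 _)).
pose V : R := 1 + 2 * q; have V1 : 1 <= V by rewrite /V; lra.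
have exp_ge1 : 1 <= expR (q / 2) by have := expR_ge1Dx (q / 2); lra.
have p2 : 0 <= p ^+ 2 by exact: sqr_ge0.
have sqr_w : w ^+ 2 <= p ^+ 2 * V ^+ 2 / 4.
  rewrite -(ger0_norm (sqr_ge0 w)) normrX (_ : _ / 4 = (p * (1 / 2 + q)) ^+ 2); last first.
    by rewrite /V; field.
  by rewrite lerXn2r ?nnegrE// (le_trans _ w_p).
have exp_w : expR `|w| <= 4 * expR (q / 2).
  apply: (@le_trans _ _ (expR (q / 2 + 1))); first by rewrite ler_expR.
  by rewrite expRD mulrC ler_wpM2r ?expR_ge0 ?expR1_le4.
have taylor : `|expR w - 1 - w| <= p ^+ 2 * V ^+ 2 * expR (q / 2).
  apply: le_trans (expR_taylor1 w) _.
  by apply: le_trans (ler_pM (sqr_ge0 w) (expR_ge0 _) sqr_w exp_w) _; lra.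
have lin : `|w - (G - p / 2)| <= p ^+ 2 * V ^+ 2 * expR (q / 2) / 2.
  have V_le : V <= V ^+ 2 * expR (q / 2) by rewrite expr2 -mulrA ler_peMr ?mulr_ege1//; lra.
  by apply: le_trans w_lin _; have := ler_wpM2l p2 V_le; rewrite /V; lra.
have total : `|expR w - (1 + (G - p / 2))| <= 3 / 2 * (p ^+ 2 * V ^+ 2 * expR (q / 2)).
  have -> : expR w - (1 + (G - p / 2)) = (expR w - 1 - w) + (w - (G - p / 2)) by ring.
  by apply: le_trans (ler_normD _ _) _; lra.
rewrite (le_trans (ler_wpM2l (expR_ge0 _) total))//.
have -> : expR (- q) = expR (- (q / 2)) * expR (- (q / 2)) by rewrite -expRD; congr expR; field.
have -> : forall x y, y * x = 1 -> x * x * (3 / 2 * (p ^+ 2 * V ^+ 2 * y)) =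
  3 / 2 * p ^+ 2 * (V ^+ 2 * x) by move=> x y yx; rewrite -[RHS]mulr1 -yx; ring.
  rewrite (le_trans (ler_wpM2l _ (sqr_1D2_expR_le q0)))//; lra.
exact: expRxMexpNx_1.
Qed.

End QuadraticExponential.

Section Logistic.
Context {R : realType}.

Definition logistic (x : R) : R := expR x / (1 + expR x).
Definition dlogistic (x : R) : R := logistic x * (1 - logistic x).
(* This is ln (2 cosh (x / 2)); being even, it turns the likelihood into a sum over all pairs. *)
Definition log_cosh (x : R) : R := ln (1 + expR x) - x / 2.

Lemma expR1D_gt0 (x : R) : 0 < 1 + expR x.
Proof. by rewrite addr_gt0 ?expR_gt0. Qed.

Lemma logistic_gt0 x : 0 < logistic x.
Proof. by rewrite divr_gt0 ?expR_gt0 ?expR1D_gt0. Qed.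

Lemma onem_logistic x : 1 - logistic x = (1 + expR x)^-1.
Proof. by rewrite /logistic; field; rewrite gt_eqF ?expR1D_gt0. Qed.

Lemma logistic_lt1 x : logistic x < 1.
Proof. by rewrite -subr_gt0 onem_logistic invr_gt0 expR1D_gt0. Qed.

Lemma logisticN x : logistic (- x) = 1 - logistic x.
Proof.
rewrite onem_logistic /logistic expRN; field.
by rewrite addrC !gt_eqF ?expR_gt0 ?expR1D_gt0.
Qed.

Lemma dlogisticN x : dlogistic (- x) = dlogistic x.
Proof. by rewrite /dlogistic logisticN; ring. Qed.

Lemma dlogistic_gt0 x : 0 < dlogistic x.
Proof. by rewrite mulr_gt0 ?logistic_gt0// subr_gt0 logistic_lt1. Qed.

Lemma dlogistic_le x : dlogistic x <= 1 / 4.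
Proof. by rewrite /dlogistic; have := sqr_ge0 (logistic x - 1 / 2); rewrite expr2; lra. Qed.

Lemma dlogistic_vfun x : dlogistic x = (vfun x)^-1.
Proof.
rewrite /dlogistic onem_logistic /logistic /vfun; field.
by rewrite !gt_eqF ?expR_gt0 ?expR1D_gt0.
Qed.

Lemma vfun_gt0 (x : R) : 0 < vfun x.
Proof. by rewrite -invr_gt0 -dlogistic_vfun dlogistic_gt0. Qed.

Lemma vfunE (x : R) : vfun x = expR x + 2 + expR (- x).
Proof. by rewrite /vfun expRN; field; rewrite gt_eqF ?expR_gt0. Qed.

Lemma is_derive_expR1D (x : R) : is_derive x 1 (fun y : R => 1 + expR y) (expR x).
Proof. by apply: is_derive_eq; rewrite ?/GRing.scale /=; lra. Qed.

Lemma is_derive_logistic (x : R) : is_derive x 1 logistic (dlogistic x).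
Proof.
have e0 : 1 + expR x != 0 by rewrite gt_eqF ?expR1D_gt0.
have dV := is_deriveV (f := fun y => 1 + expR y) e0 (is_derive_expR1D x).
apply: is_derive_eq (is_deriveM (is_derive_expR x) dV) _.
by rewrite /GRing.scale /= /dlogistic /logistic; field.
Qed.

Lemma is_derive_dlogistic (x : R) :
  is_derive x 1 dlogistic (dlogistic x * (1 - 2 * logistic x)).
Proof.
have dl := is_derive_logistic x.
by rewrite /dlogistic; apply: is_derive_eq; rewrite /GRing.scale /= /dlogistic; ring.
Qed.

Lemma is_derive_log_cosh (x : R) : is_derive x 1 log_cosh (logistic x - 1 / 2).
Proof.
have dln := is_derive1_comp (g := fun y => 1 + expR y)
  (is_derive1_ln (expR1D_gt0 x)) (is_derive_expR1D x).
have dhalf : is_derive x 1 (fun y : R => y / 2) (1 / 2).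
  by apply: is_derive_eq; rewrite /GRing.scale /=; lra.
by rewrite /logistic [_ / (1 + _)]mulrC; exact: is_deriveB dln dhalf.
Qed.

Lemma continuous_log_cosh : continuous log_cosh.
Proof. by move=> x; exact: is_derive_continuous (is_derive_log_cosh x). Qed.

Lemma dlogistic_ge_shift x t : `|t| <= 1 -> dlogistic x / 4 <= dlogistic (x + t).
Proof.
move=> t1; have v0 := vfun_gt0 x; have vt0 := vfun_gt0 (x + t).
have v40 : 0 < vfun x * 4 by rewrite mulr_gt0.
rewrite !dlogistic_vfun -invfM lef_pV2 ?posrE//.
have exp_le (u : R) : `|u| <= 1 -> expR u <= 4.
  by move=> u1; apply: le_trans expR1_le4; rewrite ler_expR (le_trans (ler_norm _)).
have := exp_le t t1; have := exp_le (- t); rewrite normrN => /(_ t1).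
rewrite !vfunE opprD !expRD; have := expR_gt0 x; have := expR_gt0 (- x); nra.
Qed.

Lemma logistic_lipschitz x t : `|logistic (x + t) - logistic x| <= `|t|.
Proof.
rewrite -[leRHS]mul1r; apply: mean_value_bound is_derive_logistic _ => s _.
by rewrite gtr0_norm ?dlogistic_gt0//; have := dlogistic_le (x + s); lra.
Qed.

Lemma dlogistic_lipschitz x t : `|dlogistic (x + t) - dlogistic x| <= `|t|.
Proof.
rewrite -[leRHS]mul1r; apply: mean_value_bound is_derive_dlogistic _ => s _.
have := dlogistic_le (x + s); have := dlogistic_gt0 (x + s).
have := logistic_gt0 (x + s); have := logistic_lt1 (x + s).
by move=> *; rewrite ler_norml; apply/andP; split; nra.
Qed.

Lemma logistic_taylor1 x t : `|logistic (x + t) - logistic x - dlogistic x * t| <= t ^+ 2.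
Proof.
have [s /andP[s0 s1] ->] := mean_value x t is_derive_logistic.
rewrite -mulrBl normrM -real_normK ?num_real// expr2 ler_wpM2r//.
by rewrite (le_trans (dlogistic_lipschitz _ _))// normrM ger0_norm// ler_piMl.
Qed.

Lemma logistic_secant x t : `|t| <= 1 ->
  exists2 slope, dlogistic x / 4 <= slope & logistic (x + t) - logistic x = slope * t.
Proof.
move=> t1; have [s /andP[s0 s1] ->] := mean_value x t is_derive_logistic.
exists (dlogistic (x + s * t)) => //; apply: dlogistic_ge_shift.
by rewrite normrM ger0_norm// mulr_ile1.
Qed.

Lemma log_cosh_bregman x t :
  0 <= log_cosh (x + t) - log_cosh x - (logistic x - 1 / 2) * t <= t ^+ 2.
Proof.
have [s /andP[s0 s1] ->] := mean_value x t is_derive_log_cosh.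
have -> : (logistic (x + s * t) - 1 / 2) * t - (logistic x - 1 / 2) * t =
  (logistic (x + s * t) - logistic x) * t by ring.
have [s' _ ->] := mean_value x (s * t) is_derive_logistic.
have := dlogistic_gt0 (x + s' * (s * t)); have := dlogistic_le (x + s' * (s * t)).
move: (dlogistic _) => d d4 d0; rewrite (_ : _ * t = d * s * t ^+ 2); last by ring.
rewrite mulr_ge0 ?sqr_ge0 ?mulr_ge0 ?(ltW d0)//= ler_piMl ?sqr_ge0// mulr_ile1 ?(ltW d0)//.
by lra.
Qed.

Lemma log_cosh_trapezoid x t :
  `|2 * (log_cosh (x + t) - log_cosh x) - t * (logistic x + logistic (x + t) - 1)| <= `|t| ^+ 3.
Proof.
pose gap y := 2 * log_cosh y - (y - x) * (logistic x + logistic y - 1).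
pose dgap y := logistic y - logistic x - (y - x) * dlogistic y.
have dgapP (y : R) : is_derive y 1 gap (dgap y).
  have dl := is_derive_logistic y; have dc := is_derive_log_cosh y.
  by apply: is_derive_eq; rewrite /dgap /GRing.scale /=; lra.
have := @mean_value_bound _ _ _ x t (t ^+ 2) dgapP.
have -> : gap (x + t) - gap x =
    2 * (log_cosh (x + t) - log_cosh x) - t * (logistic x + logistic (x + t) - 1).
  by rewrite /gap; ring.
rewrite -[t ^+ 2]real_normK ?num_real// -exprSr; apply => s st.
have := logistic_taylor1 (x + s) (- s); rewrite addrK sqrrN => taylor.
apply: le_trans (_ : _ <= s ^+ 2) _; last by rewrite -[leLHS]real_normK ?num_real// lerXn2r.
rewrite -normrN; move: taylor; congr (`| _ | <= _).
by rewrite /dgap; ring.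
Qed.

End Logistic.

Section ProductMeasure.
Context {R : realType} {I J : finType} (q : I -> J -> R).
Hypothesis q_ge0 : forall i x, 0 <= q i x.
Hypothesis q_sum1 : forall i, \sum_x q i x = 1.
Implicit Types (a : {ffun I -> J}) (f g : {ffun I -> J} -> R) (A B : pred {ffun I -> J}).

Definition prod_pmf a : R := \prod_i q i (a i).
Definition prod_mean f : R := \sum_a prod_pmf a * f a.
Definition prod_prob A : R := \sum_(a | A a) prod_pmf a.
Definition ffun_upd a (i : I) (x : J) : {ffun I -> J} := [ffun j => if j == i then x else a j].

Lemma prod_pmf_ge0 a : 0 <= prod_pmf a.
Proof. exact: prodr_ge0. Qed.

Lemma prod_pmf_sum1 : \sum_a prod_pmf a = 1.
Proof. by rewrite -(bigA_distr_bigA (fun i x => q i x)); exact: big1. Qed.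

Lemma eq_prod_mean f g : (forall a, prod_pmf a != 0 -> f a = g a) -> prod_mean f = prod_mean g.
Proof.
move=> fg; apply: eq_bigr => a _.
by have [->|/fg ->//] := eqVneq (prod_pmf a) 0; rewrite !mul0r.
Qed.

Lemma prod_mean_prod (F : I -> J -> R) :
  prod_mean (fun a => \prod_i F i (a i)) = \prod_i \sum_x q i x * F i x.
Proof. by rewrite bigA_distr_bigA; apply: eq_bigr => a _; rewrite -big_split. Qed.

Lemma prod_mean_cst c : prod_mean (fun=> c) = c.
Proof. by rewrite /prod_mean -mulr_suml prod_pmf_sum1 mul1r. Qed.

Lemma prod_meanB f g : prod_mean (fun a => f a - g a) = prod_mean f - prod_mean g.
Proof. by rewrite /prod_mean -sumrB; apply: eq_bigr => a _; rewrite mulrBr. Qed.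

Lemma prod_meanZ c f : prod_mean (fun a => c * f a) = c * prod_mean f.
Proof. by rewrite /prod_mean mulr_sumr; apply: eq_bigr => a _; rewrite mulrCA. Qed.

Lemma norm_prod_mean_le f c : (forall a, `|f a| <= c) -> `|prod_mean f| <= c.
Proof.
move=> fc; rewrite (le_trans (ler_norm_sum _ _ _))// -[leRHS]prod_mean_cst.
apply: ler_sum => a _.
by rewrite normrM (ger0_norm (prod_pmf_ge0 a)) ler_wpM2l ?prod_pmf_ge0.
Qed.

Lemma ffun_upd_swap (i : I) :
  involutive (fun u : {ffun I -> J} * J => (ffun_upd u.1 i u.2, u.1 i)).
Proof.
move=> [a x] /=; congr (_, _); last by rewrite ffunE eqxx.
by apply/ffunP => j; rewrite !ffunE; case: eqP => [->|].
Qed.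

Lemma prod_pmf_upd a i x : prod_pmf (ffun_upd a i x) * q i (a i) = prod_pmf a * q i x.
Proof.
rewrite /prod_pmf (bigD1 i)//= [in RHS](bigD1 i)//= ffunE eqxx.
rewrite (eq_bigr (fun j => q j (a j))) => [|j /negbTE ji]; first by ring.
by rewrite ffunE ji.
Qed.

Lemma prod_mean_resample i f :
  prod_mean f = prod_mean (fun a => \sum_x q i x * f (ffun_upd a i x)).
Proof.
transitivity (\sum_(u : {ffun I -> J} * J) prod_pmf u.1 * q i u.2 * f u.1).
  rewrite -(pair_bigA _ (fun a x => prod_pmf a * q i x * f a)) /=.
  by apply: eq_bigr => a _; rewrite -!mulr_suml -mulr_sumr q_sum1 mulr1.
rewrite (reindex_inj (inv_inj (ffun_upd_swap i))) /=.
rewrite -(pair_bigA _ (fun a x =>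
  prod_pmf (ffun_upd a i x) * q i (a i) * f (ffun_upd a i x))) /=.
apply: eq_bigr => a _; rewrite mulr_sumr; apply: eq_bigr => x _.
by rewrite prod_pmf_upd mulrA.
Qed.

Lemma prod_probE A : prod_prob A = prod_mean (fun a => (A a)%:R).
Proof.
rewrite /prod_prob big_mkcond; apply: eq_bigr => a _.
by case: (A a); rewrite ?mulr1 ?mulr0.
Qed.

Lemma prod_prob_le A B :
  (forall a, prod_pmf a != 0 -> A a -> B a) -> prod_prob A <= prod_prob B.
Proof.
move=> AB; rewrite /prod_prob big_mkcond [leRHS]big_mkcond /=; apply: ler_sum => a _.
have [->|/AB] := eqVneq (prod_pmf a) 0; first by rewrite !if_same.
case: (A a) => [/(_ isT) -> //|_].
by case: (B a); rewrite ?prod_pmf_ge0.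
Qed.

Lemma prod_probU A B : prod_prob (fun a => A a || B a) <= prod_prob A + prod_prob B.
Proof.
rewrite !prod_probE /prod_mean -big_split /=; apply: ler_sum => a _.
rewrite -mulrDr; apply: ler_wpM2l; first exact: prod_pmf_ge0.
by case: (A a); case: (B a); rewrite /= ?addr0 ?add0r ?lerDl.
Qed.

Lemma prod_prob_exists (S : finType) (A : S -> pred {ffun I -> J}) (c : R) :
  (forall s, prod_prob (A s) <= c) ->
  prod_prob (fun a => [exists s, A s a]) <= #|S|%:R * c.
Proof.
move=> Ac; apply: (@le_trans _ _ (\sum_s prod_prob (A s))); last first.
  by rewrite mulr_natl -sumr_const; apply: ler_sum.
under [leRHS]eq_bigr do rewrite prod_probE.
rewrite prod_probE /prod_mean exchange_big /=; apply: ler_sum => a _.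
rewrite -mulr_sumr; apply: ler_wpM2l; first exact: prod_pmf_ge0.
have [/existsP[s As]|_] := boolP [exists s, A s a]; last exact: sumr_ge0.
by rewrite (bigD1 s)//= As lerDl sumr_ge0.
Qed.

Section Hoeffding.
Variables (xi : I -> J -> R) (c : I -> R).
Hypothesis xi_mean0 : forall i, \sum_x q i x * xi i x = 0.
Hypothesis xi_le : forall i x, q i x != 0 -> `|xi i x| <= c i.

Lemma prod_mean_expR_sum_le (lam : R) :
  prod_mean (fun a => expR (lam * \sum_i xi i (a i))) <= expR (4 * lam ^+ 2 * \sum_i c i ^+ 2).
Proof.
under eq_prod_mean do rewrite mulr_sumr expR_sum.
rewrite (prod_mean_prod (fun i x => expR (lam * xi i x))) mulr_sumr expR_sum.
apply: ler_prod => i _; apply/andP; split.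
  by apply: sumr_ge0 => x _; rewrite mulr_ge0 ?expR_ge0.
apply: (@le_trans _ _ (\sum_x (lam * (q i x * xi i x)
    + q i x * expR (4 * lam ^+ 2 * c i ^+ 2)))).
  apply: ler_sum => x _.
  have [->|qx] := eqVneq (q i x) 0; first by rewrite !mul0r mulr0 addr0.
  rewrite mulrCA -mulrDr ler_wpM2l// (le_trans (expR_le_add_expR_sqr _))// lerD2l ler_expR.
  rewrite exprMn mulrA; apply: ler_wpM2l; first by rewrite mulr_ge0 ?sqr_ge0.
  by rewrite -[leLHS]real_normK ?num_real// lerXn2r ?nnegrE ?xi_le// (le_trans _ (xi_le qx)).
by rewrite big_split /= -mulr_sumr xi_mean0 mulr0 add0r -mulr_suml q_sum1 mul1r.
Qed.

Variables V t : R.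
Hypotheses (cV : \sum_i c i ^+ 2 <= V) (V_gt0 : 0 < V) (t_gt0 : 0 < t).

Lemma prod_prob_chernoff (eps : R) : eps ^+ 2 = 1 ->
  prod_prob (fun a => t < eps * \sum_i xi i (a i)) <= expR (- (t ^+ 2 / (16 * V))).
Proof.
(* The Chernoff exponent 4 lam^2 V - lam t is minimal at lam = t / (8 V). *)
move=> eps1; pose lam := t / (8 * V).
have lam0 : 0 < lam by rewrite divr_gt0// mulr_gt0.
have -> : - (t ^+ 2 / (16 * V)) = 4 * (lam * eps) ^+ 2 * V - lam * t.
  by rewrite exprMn eps1 /lam; field; rewrite gt_eqF.
apply: (@le_trans _ _
  (expR (- (lam * t)) * prod_mean (fun a => expR (lam * eps * \sum_i xi i (a i))))).
  rewrite prod_probE -prod_meanZ; apply: ler_sum => a _.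
  rewrite ler_wpM2l ?prod_pmf_ge0// -expRD.
  case: ltP => [ta|_]; last exact: expR_ge0.
  by apply: le_trans (expR_ge1Dx _); rewrite lerDl addrC -mulrA subr_ge0 ler_wpM2l// ltW.
rewrite addrC expRD ler_wpM2l ?expR_ge0// (le_trans (prod_mean_expR_sum_le _))// ler_expR.
by rewrite ler_wpM2l// mulr_ge0 ?sqr_ge0.
Qed.

Lemma prod_prob_hoeffding :
  prod_prob (fun a => t < `|\sum_i xi i (a i)|) <= 2 * expR (- (t ^+ 2 / (16 * V))).
Proof.
apply: (@le_trans _ _ (prod_prob (fun a =>
  (t < 1 * \sum_i xi i (a i)) || (t < -1 * \sum_i xi i (a i))))).
  apply: prod_prob_le => a _; rewrite mul1r mulN1r.
  by case: (ger0P (\sum_i xi i (a i))) => _ ->; rewrite ?orbT.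
apply: (le_trans (prod_probU _ _)).
by rewrite mulr2n mulrDl mul1r lerD// prod_prob_chernoff ?expr1n ?sqrrN ?expr1n.
Qed.

End Hoeffding.

End ProductMeasure.

Section LindebergStep.
Context {R : realType}.

Definition lindeberg_cst (A : R) : R := 2 * expR (20 * A) + 384 * A ^+ 2.

Lemma lindeberg_cst_ge0 A : 0 <= lindeberg_cst A.
Proof. by apply: addr_ge0; apply: mulr_ge0; rewrite ?ler0n ?expR_ge0 ?sqr_ge0. Qed.

Context {J : finType}.
Variables (p h : J -> R) (M s : R).
Hypothesis p_ge0 : forall x, 0 <= p x.
Hypothesis p_sum1 : \sum_x p x = 1.
Hypothesis h_mean0 : \sum_x p x * h x = 0.
Hypothesis h_var : \sum_x p x * h x ^+ 2 = s.
Hypothesis h_le : forall x, p x != 0 -> `|h x| <= M.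

Lemma variance_ge0 : 0 <= s.
Proof. by rewrite -h_var; apply: sumr_ge0 => x _; rewrite mulr_ge0 ?sqr_ge0. Qed.

Lemma variance_le : s <= M ^+ 2.
Proof.
rewrite -h_var -[leRHS]mul1r -p_sum1 mulr_suml; apply: ler_sum => x _.
have [->|px] := eqVneq (p x) 0; first by rewrite !mul0r.
by rewrite ler_wpM2l// -real_normK ?num_real// lerXn2r ?nnegrE ?h_le// (le_trans _ (h_le px)).
Qed.

Variables (A q g alpha : R).
Hypotheses (A_ge1 : 1 <= A) (alphaA : 0 <= alpha <= A) (q_ge0 : 0 <= q).
Hypotheses (gq : g ^+ 2 <= 4 * alpha * q) (M_ge0 : 0 <= M) (M_le1 : M <= 1).
Hypothesis AM : 4 * A * M ^+ 2 <= 1.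

Lemma expR_quad_mean_expand :
  `|\sum_x p x * expR (- (q + g * h x + alpha * h x ^+ 2))
    - expR (- q) * (1 + (s * g ^+ 2 / 2 - 2 * alpha * s / 2))| <= 2 * expR (20 * A) * M * s.
Proof.
have -> : expR (- q) * (1 + (s * g ^+ 2 / 2 - 2 * alpha * s / 2)) =
    \sum_x p x * (expR (- q) * (1 - g * h x - alpha * h x ^+ 2 + g ^+ 2 * h x ^+ 2 / 2)).
  transitivity (expR (- q) * (\sum_x p x) - expR (- q) * g * (\sum_x p x * h x)
      + expR (- q) * (g ^+ 2 / 2 - alpha) * s).
    by rewrite p_sum1 h_mean0; field.
  by rewrite -h_var !mulr_sumr -sumrB -big_split /=; apply: eq_bigr => x _; field.
rewrite -h_var -sumrB mulr_sumr (le_trans (ler_norm_sum _ _ _))//; apply: ler_sum => x _.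
have [->|px] := eqVneq (p x) 0; first by rewrite !mul0r subrr normr0 mulr0.
rewrite -mulrBr normrM (ger0_norm (p_ge0 x)) [leRHS]mulrCA ler_wpM2l//.
apply: le_trans (expR_quad_expand A_ge1 alphaA q_ge0 gq (le_trans (h_le px) M_le1)) _.
rewrite -[leRHS]mulrA ler_wpM2l ?mulr_ge0 ?expR_ge0// exprS.
by rewrite -[h x ^+ 2]real_normK ?num_real// ler_wpM2r ?sqr_ge0 ?h_le.
Qed.

Lemma lindeberg_step :
  `|\sum_x p x * expR (- (q + g * h x + alpha * h x ^+ 2))
    - expR (- q + (s * g ^+ 2 / 2 / (1 + 2 * alpha * s) - ln (1 + 2 * alpha * s) / 2))|
  <= lindeberg_cst A * M * s.
Proof.
have /andP[a0 aA] := alphaA; have s0 := variance_ge0; have sM := variance_le.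
have sM1 : s <= M by apply: le_trans sM _; rewrite expr2 ler_piMl.
have As : A * s <= A * M ^+ 2 by rewrite ler_wpM2l//; lra.
have as_le : alpha * s <= A * s by rewrite ler_wpM2r.
have as0 : 0 <= alpha * s by rewrite mulr_ge0.
have as_half : 0 <= 2 * alpha * s <= 1 / 2 by apply/andP; have := AM; split; lra.
have Gq : 0 <= s * g ^+ 2 / 2 <= 2 * alpha * s * q.
  have g2 : 0 <= s * g ^+ 2 by rewrite mulr_ge0 ?sqr_ge0.
  by have := ler_wpM2l s0 gq; move=> gsq; apply/andP; split; lra.
have heat := expR_heat_expand as_half q_ge0 Gq.
have sqr_as : (alpha * s) ^+ 2 <= A ^+ 2 * (M * s).
  rewrite exprMn ler_pM ?sqr_ge0 ?lerXn2r ?nnegrE//; first lra.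
  by rewrite expr2 ler_wpM2r.
have mean := expR_quad_mean_expand.
apply: le_trans (ler_distD (expR (- q) * (1 + (s * g ^+ 2 / 2 - 2 * alpha * s / 2))) _ _) _.
by rewrite [X in _ + X]distrC /lindeberg_cst; lra.
Qed.

End LindebergStep.

Section GaussianHeat.
Context {R : realType}.
Implicit Types (al t y be ga v : R).

(* [heat al t y be ga] is the expectation of exp(-(al Y^2 + 2 be Y + ga)) for
   Y normal with mean y and variance t. *)
Definition heat al t y be ga : R :=
  expR (- (al * y ^+ 2 + 2 * be * y + ga)
    + (t * (2 * al * y + 2 * be) ^+ 2 / 2 / (1 + 2 * al * t) - ln (1 + 2 * al * t) / 2)).

Lemma heat0 al y be ga : heat al 0 y be ga = expR (- (al * y ^+ 2 + 2 * be * y + ga)).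
Proof. by rewrite /heat mulr0 addr0 ln1 !mul0r subr0 addr0. Qed.

Definition heat_quad al t y be ga : R := al * y ^+ 2 + 2 * be * y + ga
  - t * (2 * al * y + 2 * be) ^+ 2 / 2 / (1 + 2 * al * t).
Definition heat_slope al t y be : R := (2 * al * y + 2 * be) / (1 + 2 * al * t).

Section Bounds.
Variables al t y be ga : R.
Hypotheses (al_ge0 : 0 <= al) (t_ge0 : 0 <= t) (ga_ge0 : 0 <= ga) (be_le : be ^+ 2 <= al * ga).
Local Notation s := (1 + 2 * al * t).

Lemma heat_scale_ge1 : 1 <= s.
Proof. by rewrite lerDl !mulr_ge0. Qed.

Let s_gt0 : 0 < s. Proof. exact: lt_le_trans heat_scale_ge1. Qed.

Lemma quadratic_ge0 : 0 <= al * y ^+ 2 + 2 * be * y + ga.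
Proof.
have [al0|al0] := eqVneq al 0.
  have -> : be = 0 by apply/eqP; rewrite -sqrf_eq0 eq_le sqr_ge0 andbT -(mul0r ga) -al0.
  by rewrite al0 mulr0 !mul0r !add0r.
have al1 : 0 < al by rewrite lt_def al0.
rewrite -(pmulr_rge0 _ al1).
have -> : al * (al * y ^+ 2 + 2 * be * y + ga) = (al * y + be) ^+ 2 + (al * ga - be ^+ 2) by ring.
by rewrite addr_ge0 ?sqr_ge0// subr_ge0.
Qed.

Lemma heat_slope_le : heat_slope al t y be ^+ 2 <= 4 * (al / s) * heat_quad al t y be ga.
Proof.
have -> : 4 * (al / s) * heat_quad al t y be ga =
    heat_slope al t y be ^+ 2 + 4 * (al * ga - be ^+ 2) / s.
  by rewrite /heat_quad /heat_slope; field; rewrite gt_eqF.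
by rewrite lerDl divr_ge0 ?mulr_ge0 ?subr_ge0 ?(ltW s_gt0).
Qed.

Lemma heat_quad_ge0 : 0 <= heat_quad al t y be ga.
Proof.
have -> : heat_quad al t y be ga = (al * y ^+ 2 + 2 * be * y + ga) / s
    + 2 * t * (al * ga - be ^+ 2) / s.
  by rewrite /heat_quad; field; rewrite gt_eqF.
by rewrite addr_ge0 ?divr_ge0 ?mulr_ge0 ?subr_ge0 ?(ltW s_gt0) ?quadratic_ge0.
Qed.

Lemma heat_translate x : heat al t (x + y) be ga = expR (- ln s / 2) *
  expR (- (heat_quad al t y be ga + heat_slope al t y be * x + al / s * x ^+ 2)).
Proof.
rewrite -expRD /heat /heat_quad /heat_slope; congr expR.
by move: (ln s) => l; field; rewrite gt_eqF.
Qed.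

Lemma heat_extend v : 0 <= v -> let al' := al / s in
  heat al (t + v) y be ga = expR (- ln s / 2) * expR (- heat_quad al t y be ga +
    (v * heat_slope al t y be ^+ 2 / 2 / (1 + 2 * al' * v) - ln (1 + 2 * al' * v) / 2)).
Proof.
move=> v0 al'; have al'0 : 0 <= al' by rewrite divr_ge0// ltW.
have sv : 0 < s + 2 * al * v by rewrite ltr_pwDl// !mulr_ge0.
have sE : 1 + 2 * al * (t + v) = s * (1 + 2 * al' * v).
  by rewrite /al'; field; rewrite gt_eqF.
have al'v : 0 < 1 + 2 * al' * v by rewrite ltr_pwDl// mulr_ge0// mulr_ge0.
rewrite -expRD /heat sE lnM ?posrE//; congr expR; rewrite /heat_quad /heat_slope.
have -> : 1 + 2 * al' * v = (s + 2 * al * v) / s by rewrite /al'; field; rewrite gt_eqF.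
by move: (ln s) (ln _) => l l'; field; rewrite !gt_eqF.
Qed.

End Bounds.

(* [rank1_laplace N k c U] is the expectation of exp(- k |Z|^2 + c <u, Z>^2) for Z standard normal
   in dimension N and U = |u|^2. Integrating out one coordinate leaves an expectation of the same
   form in dimension N - 1, up to the factor (pivot k c u)^(-1/2). *)
Definition rank1_laplace (N : nat) (k c U : R) : R :=
  expR (- (N%:R * ln (1 + 2 * k) + ln (1 - 2 * c * U / (1 + 2 * k))) / 2).
Definition pivot (k c u : R) : R := 1 + 2 * k - 2 * c * u ^+ 2.
Definition pivot_coef (k c u : R) : R := c * (1 + 2 * k) / pivot k c u.

Lemma rank1_laplace0 k c : rank1_laplace 0 k c 0 = 1.
Proof. by rewrite /rank1_laplace mulr0 !mul0r subr0 ln1 addr0 oppr0 mul0r expR0. Qed.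

Lemma rank1_laplace_projection N l : 0 <= l ->
  rank1_laplace N l l 1 = expR (- ((N%:R - 1) * ln (1 + 2 * l)) / 2).
Proof.
move=> l0; have l1 : 0 < 1 + 2 * l by lra.
rewrite /rank1_laplace mulr1 (_ : 1 - 2 * l / (1 + 2 * l) = (1 + 2 * l)^-1).
  by rewrite lnV ?posrE//; congr expR; ring.
by field; rewrite gt_eqF.
Qed.

Lemma heat_pivot k c u S L : pivot k c u != 0 ->
  heat (k - c * u ^+ 2) 1 0 (- (c * u * L)) (k * S - c * L ^+ 2) =
  expR (- ln (pivot k c u) / 2) * expR (- (k * S) + pivot_coef k c u * L ^+ 2).
Proof.
move=> D0; rewrite -expRD /heat /pivot_coef; congr expR.
have -> : 1 + 2 * (k - c * u ^+ 2) * 1 = pivot k c u by rewrite /pivot; ring.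
by move: (ln _) D0 => l; rewrite /pivot => D0; field.
Qed.

Section Pivot.
Variables k c u U : R.
Hypotheses (k_ge0 : 0 <= k) (c_ge0 : 0 <= c) (U_ge0 : 0 <= U) (cU_le : c * (u ^+ 2 + U) <= k).

Let cu_ge0 : 0 <= c * u ^+ 2. Proof. by rewrite mulr_ge0 ?sqr_ge0. Qed.
Let cU_ge0 : 0 <= c * U. Proof. exact: mulr_ge0. Qed.

Lemma pivot_ge1 : 1 <= pivot k c u.
Proof. by rewrite /pivot; move: cU_le; rewrite mulrDr; have := cU_ge0; lra. Qed.

Lemma pivot_coef_ge0 : 0 <= pivot_coef k c u.
Proof. by rewrite divr_ge0 ?mulr_ge0 ?(le_trans _ pivot_ge1)//; have := k_ge0; lra. Qed.

Lemma pivot_coef_le : pivot_coef k c u * U <= k.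
Proof.
have D1 := pivot_ge1; rewrite mulrAC ler_pdivrMr; last by lra.
have : 0 <= k - c * (u ^+ 2 + U) by rewrite subr_ge0.
move=> gap; have := mulr_ge0 k_ge0 gap; have := cU_le; have := cu_ge0.
by rewrite /pivot; lra.
Qed.

Lemma rank1_laplaceS N : rank1_laplace N.+1 k c (u ^+ 2 + U) =
  expR (- ln (pivot k c u) / 2) * rank1_laplace N k (pivot_coef k c u) U.
Proof.
have D1 := pivot_ge1; have D0 : pivot k c u != 0 by rewrite gt_eqF//; lra.
have k1 : 0 < 1 + 2 * k by have := k_ge0; lra.
have rest_gt0 : 0 < 1 - 2 * pivot_coef k c u * U / (1 + 2 * k).
  by rewrite subr_gt0 ltr_pdivrMr//; have := pivot_coef_le; lra.
have all_gt0 : 0 < 1 - 2 * c * (u ^+ 2 + U) / (1 + 2 * k).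
  by rewrite subr_gt0 ltr_pdivrMr//; have := cU_le; lra.
have lnE : ln (1 + 2 * k) + ln (1 - 2 * c * (u ^+ 2 + U) / (1 + 2 * k)) =
    ln (pivot k c u) + ln (1 - 2 * pivot_coef k c u * U / (1 + 2 * k)).
  rewrite -!lnM ?posrE//; last by lra.
  by congr ln; move: D0; rewrite /pivot_coef /pivot => D0; field; rewrite D0 gt_eqF.
by rewrite -expRD /rank1_laplace -natr1; congr expR; lra.
Qed.

End Pivot.

End GaussianHeat.

Lemma cauchy_schwarz_sum (R : realFieldType) (I : Type) (r : seq I) (P : pred I) (u x : I -> R) :
  (\sum_(i <- r | P i) u i * x i) ^+ 2
  <= (\sum_(i <- r | P i) u i ^+ 2) * \sum_(i <- r | P i) x i ^+ 2.
Proof.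
set lhs := _ ^+ 2; set rhs := _ * _.
have : 0 <= \sum_(i <- r | P i) \sum_(j <- r | P j) (u i * x j - u j * x i) ^+ 2.
  by apply: sumr_ge0 => i _; apply: sumr_ge0 => j _; exact: sqr_ge0.
suff -> : \sum_(i <- r | P i) \sum_(j <- r | P j) (u i * x j - u j * x i) ^+ 2 =
  rhs + rhs - 2 * lhs by lra.
rewrite /lhs /rhs expr2 {2}[_ * \sum_(i <- r | P i) x i ^+ 2]mulrC !big_distrlr /=.
rewrite mulr_sumr -big_split -sumrB; apply: eq_bigr => i _ /=.
by rewrite mulr_sumr -big_split -sumrB; apply: eq_bigr => j _ /=; ring.
Qed.

Section Lindeberg.
Context {R : realType} {I J : finType} (q : I -> J -> R).
Hypothesis q_ge0 : forall i x, 0 <= q i x.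
Hypothesis q_sum1 : forall i, \sum_x q i x = 1.
Variables (xi : I -> J -> R) (M A : R).
Hypothesis xi_mean0 : forall i, \sum_x q i x * xi i x = 0.
Hypothesis xi_le : forall i x, q i x != 0 -> `|xi i x| <= M.
Hypotheses (M_ge0 : 0 <= M) (M_le1 : M <= 1) (A_ge1 : 1 <= A) (AM : 4 * A * M ^+ 2 <= 1).

Let replacement_cost := lindeberg_cst A * M.
Let var i := \sum_x q i x * xi i x ^+ 2.
Let block_sum (ps : seq I) (a : {ffun I -> J}) := \sum_(i <- ps) xi i (a i).

Lemma heat_step (al t y be ga : R) i : 0 <= al <= A -> 0 <= t -> 0 <= ga ->
  be ^+ 2 <= al * ga ->
  `|\sum_x q i x * heat al t (xi i x + y) be ga - heat al (t + var i) y be ga|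
  <= replacement_cost * var i.
Proof.
move=> /andP[al0 alA] t0 ga0 bega.
have s1 := heat_scale_ge1 al0 t0; set s := 1 + 2 * al * t in s1; have s0 := lt_le_trans ltr01 s1.
have v0 : 0 <= var i by exact: variance_ge0.
have al'A : 0 <= al / s <= A.
  by rewrite divr_ge0 ?(ltW s0)//= (le_trans _ alA)// ler_pdivrMr// ler_peMr.
have step := lindeberg_step (q_ge0 i) (q_sum1 i) (xi_mean0 i) erefl (xi_le (i := i)) A_ge1 al'A
  (heat_quad_ge0 y al0 t0 ga0 bega) (heat_slope_le y al0 t0 bega) M_ge0 M_le1 AM.
rewrite heat_extend//.
under eq_bigr do rewrite heat_translate// mulrCA.
rewrite -mulr_sumr -mulrBr normrM (gtr0_norm (expR_gt0 _)) -[leRHS]mul1r ler_pM ?expR_ge0//.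
by rewrite expR_le1 mulNr oppr_le0 divr_ge0// ln_ge0.
Qed.

Lemma block_sum_upd ps i x a : i \notin ps -> block_sum ps (ffun_upd a i x) = block_sum ps a.
Proof.
move=> ips; apply: eq_big_seq => j jps.
by rewrite ffunE; case: eqP => // ji; rewrite -ji jps in ips.
Qed.

(* Lindeberg replacement: each summand is traded for its variance in the heat flow. *)
Lemma heat_flow (ps : seq I) (al t : R) (be ga : {ffun I -> J} -> R) :
  uniq ps -> 0 <= al <= A -> 0 <= t -> (forall a, 0 <= ga a) ->
  (forall a, be a ^+ 2 <= al * ga a) ->
  (forall i x a, i \in ps -> be (ffun_upd a i x) = be a) ->
  (forall i x a, i \in ps -> ga (ffun_upd a i x) = ga a) ->
  `|prod_mean q (fun a => heat al t (block_sum ps a) (be a) (ga a))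
    - prod_mean q (fun a => heat al (t + \sum_(i <- ps) var i) 0 (be a) (ga a))|
  <= replacement_cost * \sum_(i <- ps) var i.
Proof.
move=> + alA + ga0 bega; elim: ps t => [|i ps IH] t.
  move=> _ _ _ _; rewrite big_nil addr0 mulr0.
  rewrite (eq_prod_mean (g := fun a => heat al t 0 (be a) (ga a))) ?subrr ?normr0// => a _.
  by rewrite /block_sum big_nil.
move=> /= /andP[ips ups] t0 be_upd ga_upd; rewrite !big_cons addrA.
have v0 : 0 <= var i by exact: variance_ge0.
have IHt := IH (t + var i) ups (addr_ge0 t0 v0)
  (fun j x a jps => be_upd j x a (mem_behead (s := i :: ps) jps))
  (fun j x a jps => ga_upd j x a (mem_behead (s := i :: ps) jps)).
have -> : prod_mean q (fun a => heat al t (block_sum (i :: ps) a) (be a) (ga a)) =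
   prod_mean q (fun a => \sum_x q i x * heat al t (xi i x + block_sum ps a) (be a) (ga a)).
  rewrite (prod_mean_resample q_sum1 i); apply: eq_prod_mean => a _; apply: eq_bigr => x _.
  rewrite be_upd ?mem_head// ga_upd ?mem_head// {1}/block_sum big_cons -/(block_sum ps _).
  by rewrite ffunE eqxx block_sum_upd.
rewrite mulrDr; apply: le_trans (ler_distD _ _ _) (lerD _ IHt).
by rewrite -prod_meanB; apply: norm_prod_mean_le => // a; exact: heat_step.
Qed.

Section Blocks.
Context {S : eqType} (P : S -> seq I) (u : S -> R).
Implicit Types (bs : seq S).

Definition disjoint_blocks bs : Prop := [/\ uniq bs, forall b, b \in bs -> uniq (P b)
  & forall b b' i, b \in bs -> b' \in bs -> i \in P b -> i \in P b' -> b = b'].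
Definition sqr_sum bs a := \sum_(b <- bs) block_sum (P b) a ^+ 2.
Definition lin_sum bs a := \sum_(b <- bs) u b * block_sum (P b) a.

Lemma disjoint_blocks_behead b bs : disjoint_blocks (b :: bs) -> disjoint_blocks bs.
Proof.
move=> [/andP[_ ubs] uP disj]; split=> // [j jbs|j j' i jbs jbs'].
  by apply: uP; rewrite in_cons jbs orbT.
by apply: disj; rewrite in_cons ?jbs ?jbs' orbT.
Qed.

Lemma block_sum_upd_disjoint b bs j i x a : disjoint_blocks (b :: bs) -> j \in bs -> i \in P b ->
  block_sum (P j) (ffun_upd a i x) = block_sum (P j) a.
Proof.
move=> [/andP[bbs _] _ disj] jbs iPb; apply: block_sum_upd; apply: contra bbs => iPj.
by rewrite (disj b j i)// ?mem_head// in_cons jbs orbT.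
Qed.

Lemma blocks_step b bs k c : 0 <= k <= A -> 0 <= c ->
  c * (u b ^+ 2 + \sum_(j <- bs) u j ^+ 2) <= k ->
  disjoint_blocks (b :: bs) -> \sum_(i <- P b) var i = 1 ->
  `|prod_mean q (fun a => expR (- (k * sqr_sum (b :: bs) a) + c * lin_sum (b :: bs) a ^+ 2))
    - expR (- ln (pivot k c (u b)) / 2) * prod_mean q (fun a =>
        expR (- (k * sqr_sum bs a) + pivot_coef k c (u b) * lin_sum bs a ^+ 2))|
  <= replacement_cost.
Proof.
move=> /andP[k0 kA] c0; set U := \sum_(j <- bs) _ => cUk disj var1.
have U0 : 0 <= U by apply: sumr_ge0 => ? _; exact: sqr_ge0.
have D0 : pivot k c (u b) != 0 by rewrite gt_eqF// (lt_le_trans ltr01 (pivot_ge1 c0 U0 cUk)).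
have cu0 : 0 <= c * u b ^+ 2 by rewrite mulr_ge0 ?sqr_ge0.
have cU0 : 0 <= c * U by rewrite mulr_ge0.
have cLS a : c * lin_sum bs a ^+ 2 <= c * U * sqr_sum bs a.
  by rewrite -mulrA ler_wpM2l// cauchy_schwarz_sum.
have S0 a : 0 <= sqr_sum bs a by apply: sumr_ge0 => ? _; exact: sqr_ge0.
rewrite mulrDr in cUk.
pose be a := - (c * u b * lin_sum bs a).
pose ga a := k * sqr_sum bs a - c * lin_sum bs a ^+ 2.
have ga0 a : 0 <= ga a by rewrite subr_ge0 (le_trans (cLS a))// ler_wpM2r//; lra.
have bega a : be a ^+ 2 <= (k - c * u b ^+ 2) * ga a.
  rewrite -subr_ge0 (_ : _ - _ = k * ((k - c * u b ^+ 2) * sqr_sum bs a - c * lin_sum bs a ^+ 2)).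
    by rewrite mulr_ge0// subr_ge0 (le_trans (cLS a))// ler_wpM2r//; lra.
  by rewrite /ga /be; ring.
have al_kA : 0 <= k - c * u b ^+ 2 <= A by apply/andP; split; lra.
have uPb : uniq (P b) by case: disj => _ uP _; apply: uP; rewrite mem_head.
have lin_upd i x a : i \in P b -> lin_sum bs (ffun_upd a i x) = lin_sum bs a.
  by move=> iPb; apply: eq_big_seq => j jbs; rewrite (block_sum_upd_disjoint _ _ disj).
have sqr_upd i x a : i \in P b -> sqr_sum bs (ffun_upd a i x) = sqr_sum bs a.
  by move=> iPb; apply: eq_big_seq => j jbs; rewrite (block_sum_upd_disjoint _ _ disj).
have := @heat_flow (P b) _ 0 be ga uPb al_kA (lexx _) ga0 bega.
rewrite var1 add0r mulr1 => flow.
have start a : expR (- (k * sqr_sum (b :: bs) a) + c * lin_sum (b :: bs) a ^+ 2) =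
    heat (k - c * u b ^+ 2) 0 (block_sum (P b) a) (be a) (ga a).
  rewrite heat0 /be /ga /sqr_sum /lin_sum !big_cons; congr expR; ring.
rewrite -prod_meanZ (eq_prod_mean (fun a _ => start a)).
rewrite -(eq_prod_mean (fun a _ => heat_pivot (sqr_sum bs a) (lin_sum bs a) D0)).
by apply: flow => i x a iPb; rewrite /be /ga ?sqr_upd ?lin_upd.
Qed.

Lemma laplace_projection bs k c : 0 <= k <= A -> 0 <= c ->
  c * \sum_(b <- bs) u b ^+ 2 <= k ->
  disjoint_blocks bs -> (forall b, b \in bs -> \sum_(i <- P b) var i = 1) ->
  `|prod_mean q (fun a => expR (- (k * sqr_sum bs a) + c * lin_sum bs a ^+ 2))
    - rank1_laplace (size bs) k c (\sum_(b <- bs) u b ^+ 2)|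
  <= (size bs)%:R * replacement_cost.
Proof.
move=> kA; have /andP[k0 _] := kA; elim: bs c => [|b bs IH] c c0.
  move=> _ _ _; rewrite big_nil rank1_laplace0 mul0r (eq_prod_mean (g := fun=> 1)) => [|a _].
    by rewrite prod_mean_cst// subrr normr0.
  by rewrite /sqr_sum /lin_sum !big_nil expr2 !mulr0 oppr0 addr0 expR0.
rewrite big_cons /=; set U := \sum_(j <- bs) _ => cUk disj var1.
have U0 : 0 <= U by apply: sumr_ge0 => ? _; exact: sqr_ge0.
have step := blocks_step kA c0 cUk disj (var1 b (mem_head _ _)).
have D1 := pivot_ge1 c0 U0 cUk.
have {}IH := IH _ (pivot_coef_ge0 k0 c0 U0 cUk) (pivot_coef_le k0 c0 U0 cUk)
  (disjoint_blocks_behead disj) (fun j jbs => var1 j (mem_behead (s := b :: bs) jbs)).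
rewrite (rank1_laplaceS k0 c0 U0 cUk) -[(size bs).+1%:R]natr1 mulrDl mul1r [leRHS]addrC.
apply: le_trans (ler_distD _ _ _) (lerD step _).
rewrite -mulrBr normrM (gtr0_norm (expR_gt0 _)) -[leRHS]mul1r.
rewrite ler_pM ?expR_ge0// expR_le1 mulNr oppr_le0 divr_ge0//.
by rewrite ln_ge0.
Qed.

End Blocks.

End Lindeberg.

Section FiniteSums.
Context {R : realType}.

Lemma norm_sum_le_card (I : finType) (P : pred I) (f : I -> R) (M c : R) :
  (forall i, P i -> `|f i| <= M) -> 0 <= M -> #|P|%:R <= c -> `|\sum_(i | P i) f i| <= c * M.
Proof.
move=> fM M0 Pc; apply: le_trans (ler_norm_sum _ _ _) _.
apply: (@le_trans _ _ (\sum_(i | P i) M)); first exact: ler_sum.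
by rewrite sumr_const -mulr_natl ler_wpM2r.
Qed.

Lemma sum_antisymmetric (I : finType) (F : I -> I -> R) (h : I -> R) :
  (forall i j, F j i = - F i j) ->
  \sum_i \sum_j F i j * h i = 1 / 2 * \sum_i \sum_j F i j * (h i - h j).
Proof.
move=> Fanti; have swap : \sum_i \sum_j F i j * h j = - \sum_i \sum_j F i j * h i.
  rewrite exchange_big /= -sumrN; apply: eq_bigr => i _; rewrite -sumrN.
  by apply: eq_bigr => j _; rewrite Fanti mulNr.
under [in RHS]eq_bigr do (under eq_bigr do rewrite mulrBr; rewrite sumrB).
by rewrite sumrB swap; lra.
Qed.

(* At an extremal point the increments D i j all have the same sign. *)
Lemma oscillation_le (I : finType) (P : pred I) (f : I -> R) (D : I -> I -> R) (X : R) :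
  (forall i j, P i -> P j -> exists2 w, 1 <= w & D i j = w * (f i - f j)) ->
  (forall (eps : R) i, `|eps| = 1 -> P i -> (forall j, P j -> eps * f j <= eps * f i) ->
     eps * (\sum_(j | P j) D i j) <= X) ->
  forall i j, P i -> P j -> #|P|%:R * (f i - f j) <= 2 * X.
Proof.
move=> Df DX i j Pi Pj.
have mean_gap (eps : R) l : `|eps| = 1 -> P l -> (forall j, P j -> eps * f j <= eps * f l) ->
    \sum_(j | P j) eps * (f l - f j) <= X.
  move=> eps1 Pl ext; apply: le_trans (DX eps l eps1 Pl ext); rewrite mulr_sumr.
  apply: ler_sum => m Pm; have [w w1 ->] := Df l m Pl Pm.
  by rewrite mulrCA ler_peMl// mulrBr subr_ge0 ext.
case: (arg_maxP f Pi) => p Pp pmax; case: (arg_minP f Pi) => m Pm mmin.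
have up := mean_gap 1 p (normr1 _) Pp (fun l Pl => ler_wpM2l ler01 (pmax l Pl)).
have lo : \sum_(j | P j) -1 * (f m - f j) <= X.
  by apply: mean_gap => [|//|l Pl]; rewrite ?normrN1// !mulN1r lerN2 mmin.
apply: (@le_trans _ _ (#|P|%:R * (f p - f m))).
  by apply: ler_wpM2l => //; apply: lerB; [exact: pmax|exact: mmin].
rewrite mulr_natl -sumr_const.
rewrite (eq_bigr (fun l => 1 * (f p - f l) + -1 * (f m - f l))) => [|l _]; last by ring.
by rewrite big_split /=; lra.
Qed.

Lemma le0_of_linear_bound (s c t0 : R) : 0 < t0 ->
  (forall t, 0 < t <= t0 -> s <= c * t) -> s <= 0.
Proof.
move=> t00 sc; rewrite leNgt; apply/negP => s0.
have c1 : 0 < 2 * (`|c| + 1) by rewrite mulr_gt0 ?ltr_wpDl.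
have := sc (Num.min t0 (s / (2 * (`|c| + 1)))).
rewrite lt_min t00 divr_gt0//= ge_min lexx => /(_ isT).
set t := Num.min _ _; have t_le : t * (2 * (`|c| + 1)) <= s.
  by rewrite -ler_pdivlMr// /t ge_min lexx orbT.
have tpos : 0 < t by rewrite lt_min t00 divr_gt0.
have := ler_norm c; nra.
Qed.

End FiniteSums.

Section Likelihood.
Context {R : realType} {n : nat}.
Variables (kappa : 'I_n -> 'I_n -> R) (e : 'I_n -> R).
Hypothesis kappa_sym : forall i j, kappa i j = kappa j i.
Hypothesis kappa_ge0 : forall i j, 0 <= kappa i j.
Implicit Types (f g h : 'I_n -> R).

Definition loglik g : R :=
  \sum_i e i * g i - 1 / 2 * \sum_i \sum_j kappa i j * log_cosh (g i - g j).

Definition score g (i : 'I_n) : R :=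
  e i - \sum_j kappa i j * (logistic (g i - g j) - 1 / 2).

Lemma scoreB g h i : score g i - score h i =
  \sum_j kappa i j * (logistic (h i - h j) - logistic (g i - g j)).
Proof.
rewrite /score [in LHS]opprB addrC addrA subrK -sumrB.
by apply: eq_bigr => j _; ring.
Qed.

Lemma sum_score_mul g f : \sum_i score g i * f i = \sum_i e i * f i
  - 1 / 2 * \sum_i \sum_j kappa i j * (logistic (g i - g j) - 1 / 2) * (f i - f j).
Proof.
rewrite -sum_antisymmetric => [|i j]; last first.
  by rewrite kappa_sym -[g j - g i]opprB logisticN; field.
by rewrite -sumrB; apply: eq_bigr => i _; rewrite mulrBl mulr_suml.
Qed.

Lemma loglikB g h : loglik h - loglik g = \sum_i e i * (h i - g i)
  - 1 / 2 * \sum_i \sum_j kappa i j * (log_cosh (h i - h j) - log_cosh (g i - g j)).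
Proof.
under [X in _ = X - _]eq_bigr do rewrite mulrBr.
under [X in _ = _ - _ * X]eq_bigr do (under eq_bigr do rewrite mulrBr; rewrite sumrB).
by rewrite !sumrB /loglik; ring.
Qed.

Lemma loglik_bregman g h : loglik h - loglik g = \sum_i score g i * (h i - g i)
  - 1 / 2 * \sum_i \sum_j kappa i j * (log_cosh (h i - h j) - log_cosh (g i - g j)
      - (logistic (g i - g j) - 1 / 2) * ((h i - h j) - (g i - g j))).
Proof.
rewrite loglikB sum_score_mul -addrA; congr (_ + _); rewrite -opprD -mulrDr; congr (- (_ * _)).
rewrite -big_split; apply: eq_bigr => i _; rewrite -big_split; apply: eq_bigr => j _ /=.
by ring.
Qed.

Lemma loglik_concave g h : loglik h <= loglik g + \sum_i score g i * (h i - g i).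
Proof.
rewrite -lerBlDl loglik_bregman gerBl mulr_ge0// sumr_ge0// => i _.
rewrite sumr_ge0// => j _; rewrite mulr_ge0//.
have /andP[] := log_cosh_bregman (g i - g j) ((h i - h j) - (g i - g j)).
by rewrite subrKC.
Qed.

Lemma loglik_ge_quadratic g h : loglik g + \sum_i score g i * (h i - g i)
  - 1 / 2 * \sum_i \sum_j kappa i j * ((h i - h j) - (g i - g j)) ^+ 2 <= loglik h.
Proof.
rewrite -addrA -lerBrDl loglik_bregman lerD2l lerN2 ler_wpM2l//.
apply: ler_sum => i _; apply: ler_sum => j _; rewrite ler_wpM2l//.
have /andP[_] := log_cosh_bregman (g i - g j) ((h i - h j) - (g i - g j)).
by rewrite subrKC.
Qed.

Lemma loglik_trapezoid g h :
  `|2 * (loglik h - loglik g) - \sum_i (score g i + score h i) * (h i - g i)|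
  <= 1 / 2 * \sum_i \sum_j kappa i j * `|(h i - g i) - (h j - g j)| ^+ 3.
Proof.
under [X in `|_ - X|]eq_bigr do rewrite mulrDl.
rewrite big_split /= !sum_score_mul loglikB.
set linear := \sum_i e i * _; set value := \sum_i _; set slope_g := \sum_i _.
set slope_h := \sum_i _.
rewrite (_ : _ - _ = - (1 / 2 * (2 * value - slope_g - slope_h))); last by field.
rewrite normrN normrM ger0_norm// ler_wpM2l//.
have -> : 2 * value - slope_g - slope_h =
    \sum_i \sum_j kappa i j * (2 * (log_cosh (h i - h j) - log_cosh (g i - g j))
      - ((h i - g i) - (h j - g j)) * (logistic (g i - g j) + logistic (h i - h j) - 1)).
  rewrite mulr_sumr -!sumrB; apply: eq_bigr => i _.
  by rewrite mulr_sumr -!sumrB; apply: eq_bigr => j _; field.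
apply: le_trans (ler_norm_sum _ _ _) _; apply: ler_sum => i _.
apply: le_trans (ler_norm_sum _ _ _) _; apply: ler_sum => j _.
rewrite normrM (ger0_norm (kappa_ge0 _ _)) ler_wpM2l//.
have -> : h i - h j = (g i - g j) + ((h i - g i) - (h j - g j)) by ring.
exact: log_cosh_trapezoid.
Qed.

Lemma continuous_loglik (bet : 'I_n -> R) (pi : 'I_n -> 'I_n) :
  continuous (fun th : 'rV[R]_n => loglik (fun i => bet i + th ord0 (pi i))).
Proof.
have coord i : continuous (fun th : 'rV[R]_n => bet i + th ord0 (pi i)).
  move=> th; apply: (@continuousD _ _ _ (cst (bet i)) (fun th : 'rV[R]_n => th ord0 (pi i))).
    exact: cst_continuous.
  exact: coord_continuous.
have scale (c : R) (F : 'rV[R]_n -> R) : continuous F -> continuous (fun th => c * F th).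
  by move=> cF th; apply: (@continuousM _ _ (cst c) F); [exact: cst_continuous|exact: cF].
have sum (F : 'I_n -> 'rV[R]_n -> R) :
    (forall i, continuous (F i)) -> continuous (fun th => \sum_i F i th).
  by move=> cF; apply: (continuous_big add_continuous) => i _; exact: cF.
have linear : continuous (fun th : 'rV[R]_n => \sum_i e i * (bet i + th ord0 (pi i))).
  by apply: sum => i; exact: scale.
have pairs : continuous (fun th : 'rV[R]_n => 1 / 2 * \sum_i \sum_j kappa i j *
    log_cosh (bet i + th ord0 (pi i) - (bet j + th ord0 (pi j)))).
  apply: (scale _); apply: (sum _) => i; apply: (sum _) => j; apply: (scale _) => th.
  apply: (@continuous_comp _ _ _
    (fun th : 'rV[R]_n => bet i + th ord0 (pi i) - (bet j + th ord0 (pi j))) log_cosh).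
    apply: (@continuousB _ _ _ (fun th : 'rV[R]_n => bet i + th ord0 (pi i))
      (fun th : 'rV[R]_n => bet j + th ord0 (pi j))); exact: coord.
  exact: continuous_log_cosh.
by move=> th; exact: (@continuousB _ _ _ _ _ th (linear th) (pairs th)).
Qed.

Hypothesis e_sum0 : \sum_i e i = 0.

Lemma loglik_translate g c : loglik (fun j => g j + c) = loglik g.
Proof.
rewrite /loglik; congr (_ - 1 / 2 * _).
  under eq_bigr do rewrite mulrDr.
  by rewrite big_split /= -mulr_suml e_sum0 mul0r addr0.
by apply: eq_bigr => i _; apply: eq_bigr => j _; congr (_ * log_cosh _); ring.
Qed.

(* The likelihood is maximized under the constraint that the deviation from [bet] is constant on
   the fibres of [pi]. A maximizer over the box |th| <= 1/2 satisfies one-sided first-order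
   conditions at its extreme coordinates; these force its oscillation below 1/2, so that
   after a translation it lies in the interior of the box. *)
Section FibreMaximizer.
Variables (bet : 'I_n -> R) (pi : 'I_n -> 'I_n) (b A : R) (o : 'I_n).
Hypothesis b_gt0 : 0 < b.
Hypothesis kappa_dlogistic : forall i j, i != j -> 1 <= b * (kappa i j * dlogistic (bet i - bet j)).
Hypothesis fibre_score_le : forall j, `|\sum_(i | pi i == j) score bet i| <= A.
Implicit Types th : 'I_n -> R.

Definition fibre_shift th (i : 'I_n) : R := bet i + th (pi i).
Definition in_box th : Prop := forall i, `|th (pi i)| <= 1 / 2.
Definition box_maximizer th : Prop := in_box th /\
  forall th', in_box th' -> loglik (fibre_shift th') <= loglik (fibre_shift th).
Definition fibre_score th (j : 'I_n) : R := \sum_(i | pi i == j) score (fibre_shift th) i.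

Lemma box_maximizer_exists : exists th, box_maximizer th.
Proof.
pose box := [set v : 'rV[R]_n | forall i, `[- (1 / 2), 1 / 2]%classic (v ord0 i)].
have box_compact : compact box.
  by apply: (@rV_compact R n (fun=> `[- (1 / 2), 1 / 2]%classic)) => i; exact: segment_compact.
have box_neq0 : box !=set0.
  by exists (0 : 'rV[R]_n) => i /=; rewrite mxE in_itv /=; apply/andP; split; lra.
have [v v_box v_max] :=
  EVT_max_rV box_neq0 box_compact
    (continuous_subspaceT (continuous_loglik (bet := bet) (pi := pi))).
exists (fun i => v ord0 i); split=> [i|th' th'_box].
  by move: v_box; rewrite inE => /(_ (pi i)); rewrite /= in_itv /= ler_norml.
pose w : 'rV[R]_n := \row_j (if j \in codom pi then th' j else 0).
have := v_max w; rewrite (_ : (fun i => bet i + w ord0 (pi i)) = fibre_shift th'); last first.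
  by apply/funext => i; rewrite mxE codom_f.
apply; rewrite inE => j /=; rewrite mxE in_itv /=; case: ifP => [/codomP[i ->]|_].
  by rewrite -ler_norml.
by apply/andP; split; lra.
Qed.

Lemma norm1_cases (eps : R) : `|eps| = 1 -> eps = 1 \/ eps = -1.
Proof. by case: (ger0P eps) => _ eps1; [left|right; rewrite -eps1 opprK]. Qed.

Lemma box_maximizer_first_order th i (eps t0 : R) : box_maximizer th -> `|eps| = 1 -> 0 < t0 ->
  `|th (pi i) + eps * t0| <= 1 / 2 -> eps * fibre_score th (pi i) <= 0.
Proof.
move=> [th_box th_max] eps1 t00 feasible.
apply: (@le0_of_linear_bound R _ (1 / 2 * \sum_l \sum_m kappa l m * 4) t0 t00) => t.
move=> /andP[t_gt0 tt0].
pose th' l := if l == pi i then th l + eps * t else th l.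
have th'_box l : `|th' (pi l)| <= 1 / 2.
  rewrite /th'; case: eqP => [->|_]; last exact: th_box.
  by have := th_box i; move: feasible; rewrite !ler_norml; case: (norm1_cases eps1) => ->; lra.
have shiftE l : fibre_shift th' l - fibre_shift th l = if pi l == pi i then eps * t else 0.
  by rewrite /fibre_shift /th'; case: eqP => _; ring.
have := th_max th' th'_box; have := loglik_ge_quadratic (fibre_shift th) (fibre_shift th').
have -> : \sum_l score (fibre_shift th) l * (fibre_shift th' l - fibre_shift th l) =
    t * (eps * fibre_score th (pi i)).
  rewrite /fibre_score [in RHS]big_mkcond !mulr_sumr; apply: eq_bigr => l _.
  by rewrite shiftE; case: ifP => _; ring.
have quad : \sum_l \sum_m kappa l m * (fibre_shift th' l - fibre_shift th' m
    - (fibre_shift th l - fibre_shift th m)) ^+ 2 <= t ^+ 2 * \sum_l \sum_m kappa l m * 4.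
  rewrite mulr_sumr; apply: ler_sum => l _; rewrite mulr_sumr; apply: ler_sum => m _.
  rewrite [leRHS]mulrCA ler_wpM2l//.
  have -> : fibre_shift th' l - fibre_shift th' m - (fibre_shift th l - fibre_shift th m) =
    fibre_shift th' l - fibre_shift th l - (fibre_shift th' m - fibre_shift th m) by ring.
  rewrite !shiftE.
  have t2 := sqr_ge0 t.
  by case: (norm1_cases eps1) => ->; case: ifP => _; case: ifP => _; nra.
move=> lower upper; rewrite -(ler_pM2l t_gt0).
have -> : t * (1 / 2 * (\sum_l \sum_m kappa l m * 4) * t) =
  1 / 2 * (t ^+ 2 * \sum_l \sum_m kappa l m * 4) by ring.
by lra.
Qed.

Definition score_drop th (i j : 'I_n) : R := kappa i j *
  (logistic (bet i - bet j + (th (pi i) - th (pi j))) - logistic (bet i - bet j)).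

Lemma score_fibre_shift th i :
  score (fibre_shift th) i = score bet i - \sum_j score_drop th i j.
Proof.
apply/eqP; rewrite eq_sym subr_eq addrC -subr_eq scoreB; apply/eqP.
by apply: eq_bigr => j _; congr (_ * (logistic _ - _)); rewrite /fibre_shift; ring.
Qed.

Lemma score_drop_secant th i j : in_box th -> i != j ->
  exists2 w, 1 <= w & 4 * b * score_drop th i j = w * (th (pi i) - th (pi j)).
Proof.
move=> th_box ij; have := th_box i; have := th_box j; rewrite !ler_norml => boxi boxj.
have t1 : `|th (pi i) - th (pi j)| <= 1 by rewrite ler_norml; apply/andP; split; lra.
have [slope slope_ge E] := logistic_secant (bet i - bet j) t1.
exists (4 * b * (kappa i j * slope)); last by rewrite /score_drop E; ring.
have kb : 0 <= b * kappa i j by rewrite mulr_ge0// ltW.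
by have := ler_wpM2l kb slope_ge; have := kappa_dlogistic ij; lra.
Qed.

Lemma extremal_score_drop_le th i (eps : R) : box_maximizer th -> `|eps| = 1 ->
  (forall j, eps * th (pi j) <= eps * th (pi i)) -> eps * \sum_j score_drop th i j <= A.
Proof.
move=> th_max eps1 ext; have th_box := th_max.1.
have eps2 : eps * eps = 1 by case: (norm1_cases eps1) => ->; rewrite ?mulrNN mulr1.
have [le|lt] := leP (eps * th (pi i)) (- (1 / 2)).
  rewrite big1 ?mulr0 => [|j _]; first exact: le_trans (fibre_score_le i).
  have gapE : th (pi i) - th (pi j) = eps * (eps * th (pi i) - eps * th (pi j)).
    by rewrite -mulrBr mulrA eps2 mul1r.
  suff eqv : eps * th (pi i) = eps * th (pi j).
    have gap0 : th (pi i) - th (pi j) = 0 by rewrite gapE eqv subrr mulr0.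
    by rewrite /score_drop gap0 addr0 subrr mulr0.
  apply/eqP; rewrite eq_le ext andbT (le_trans le)//.
  have : `|eps * th (pi j)| <= 1 / 2 by rewrite normrM eps1 [leLHS]mul1r; exact: th_box.
  by rewrite ler_norml => /andP[].
have := @box_maximizer_first_order th i (- eps) (eps * th (pi i) + 1 / 2) th_max.
have -> : th (pi i) + - eps * (eps * th (pi i) + 1 / 2) = - eps / 2.
  by rewrite mulrDr mulNr mulrA eps2; field.
rewrite normrM !normrN eps1 mul1r ger0_norm// => /(_ erefl) first_order.
have {first_order} : 0 <= eps * fibre_score th (pi i).
  by rewrite -oppr_le0 -mulNr first_order//; lra.
rewrite /fibre_score (eq_bigr _ (fun l _ => score_fibre_shift th l)) sumrB mulrBr subr_ge0 => drops.
have drop_ge0 l j : pi l = pi i -> 0 <= eps * score_drop th l j.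
  move=> pl; have [->|lj] := eqVneq l j; first by rewrite /score_drop !subrr addr0 subrr !mulr0.
  have [w w1 E] := score_drop_secant th_box lj.
  have b4 : 0 < 4 * b by rewrite mulr_gt0.
  have gap0 : 0 <= eps * (th (pi l) - th (pi j)) by rewrite pl mulrBr subr_ge0 ext.
  by rewrite -(pmulr_rge0 _ b4) mulrCA E mulrCA mulr_ge0// (le_trans ler01).
apply: (@le_trans _ _ (eps * \sum_(l | pi l == pi i) \sum_j score_drop th l j)).
  rewrite [in leRHS](bigD1 i)//= mulrDr lerDl !mulr_sumr sumr_ge0// => l /andP[/eqP pl _].
  by rewrite mulr_sumr sumr_ge0// => j _; exact: drop_ge0.
apply: le_trans drops _; apply: le_trans (ler_norm _) _.
by rewrite normrM eps1 mul1r.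
Qed.

Lemma box_maximizer_oscillation th i j : box_maximizer th ->
  th (pi i) - th (pi j) <= 8 * b * A / n%:R.
Proof.
move=> th_max; have n0 : 0 < n%:R :> R by rewrite ltr0n (leq_trans _ (ltn_ord o)).
rewrite ler_pdivlMr// mulrC (_ : 8 * b * A = 2 * (4 * b * A)); last by ring.
have := @oscillation_le R _ predT (fun i => th (pi i)) (fun i j => 4 * b * score_drop th i j)
  (4 * b * A); rewrite cardT size_enum_ord; apply=> // [l m _ _|eps l eps1 _ ext].
  have [->|lm] := eqVneq l m; last exact: score_drop_secant th_max.1 lm.
  by exists 1; rewrite // /score_drop !subrr addr0 subrr !mulr0.
rewrite -mulr_sumr mulrCA ler_wpM2l ?mulr_ge0 ?(ltW b_gt0)//.
by apply: extremal_score_drop_le => // m; exact: ext.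
Qed.

Lemma fibre_maximizer_exists : 8 * b * A / n%:R < 1 / 2 -> exists del : 'I_n -> R,
  [/\ forall i j, pi i = pi j -> del i = del j, del o = 0,
      forall i j, `|del i - del j| <= 8 * b * A / n%:R
    & forall j, \sum_(i | pi i == j) score (fun i => bet i + del i) i = 0].
Proof.
move=> small; have [th th_max] := box_maximizer_exists.
have osc i j := box_maximizer_oscillation i j th_max.
pose ctr j := th j - th (pi o).
have ctrE : fibre_shift ctr = fun i => fibre_shift th i + - th (pi o).
  by apply/funext => i; rewrite /fibre_shift /ctr; ring.
have interior i : `|ctr (pi i)| < 1 / 2.
  by rewrite ltr_norml /ctr; have := osc i o; have := osc o i; move: small; lra.
have ctr_max : box_maximizer ctr.
  split=> [i|th' th'_box]; first exact: ltW.
  by rewrite ctrE loglik_translate; exact: th_max.2.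
exists (fun i => ctr (pi i)); split=> [i j ->//||i j|j].
- by rewrite /ctr subrr.
- by rewrite ler_norml /ctr; have := osc i j; have := osc j i; set X := _ / _; lra.
have [i /eqP pij|no_fibre] := pickP (fun i => pi i == j); last exact: big_pred0.
rewrite -pij -/(fibre_score ctr (pi i)); have := interior i => lt_half.
have first_order (eps : R) : `|eps| = 1 -> eps * fibre_score ctr (pi i) <= 0.
  move=> eps1; apply: (box_maximizer_first_order (t0 := 1 / 2 - `|ctr (pi i)|) ctr_max eps1).
    by rewrite subr_gt0.
  apply: le_trans (ler_normD _ _) _.
  by rewrite normrM eps1 mul1r ger0_norm ?subr_ge0 ?(ltW lt_half)//; lra.
have := first_order 1 (normr1 _); have := first_order (-1) (normrN1 _); lra.
Qed.

End FibreMaximizer.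

End Likelihood.

Section BlockInformation.
Context {R : realType} {n : nat}.
Variables (kappa : 'I_n -> 'I_n -> R) (bet : 'I_n -> R) (B : pred 'I_n).

Definition pair_info i j : R := kappa i j * dlogistic (bet i - bet j).
Definition outer_info i : R := \sum_(j | ~~ B j) pair_info i j.
Definition block_quad (D : 'I_n -> R) : R :=
  \sum_(i | B i) D i ^+ 2 / outer_info i
  - (\sum_(i | B i) D i) ^+ 2 / \sum_(i | B i) outer_info i.

Record block_design (C b : R) : Prop := BlockDesign {
  weight_sym : forall i j, kappa i j = kappa j i;
  weight_ge0 : forall i j, 0 <= kappa i j;
  weight_le : forall i j, kappa i j <= C;
  pair_info_ge : forall i j, i != j -> 1 <= b * pair_info i j;
  scale_ge1 : 1 <= b;
  cst_ge16 : 16 <= C;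
  card_block : #|B|%:R <= C;
  card_outer : n%:R <= 2 * #|predC B|%:R :> R;
  size_ge4 : 4 <= n%:R :> R }.

Variables C b : R.
Hypothesis design : block_design C b.

Lemma scale_gt0 : 0 < b. Proof. exact: lt_le_trans ltr01 (scale_ge1 design). Qed.
Lemma cst_gt0 : 0 < C. Proof. exact: lt_le_trans (cst_ge16 design). Qed.
Lemma size_gt0 : 0 < n%:R :> R. Proof. exact: lt_le_trans (size_ge4 design). Qed.

Lemma card_le (P : pred 'I_n) : #|P|%:R <= n%:R :> R.
Proof. by rewrite ler_nat (leq_trans (max_card _))// card_ord. Qed.

Lemma pair_info_ge0 i j : 0 <= pair_info i j.
Proof. by rewrite mulr_ge0 ?(weight_ge0 design)// ltW// dlogistic_gt0. Qed.

Lemma pair_info_le i j : pair_info i j <= C.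
Proof.
rewrite -[C]mulr1 ler_pM ?(weight_ge0 design) ?(weight_le design) ?(ltW (dlogistic_gt0 _))//.
by have := dlogistic_le (bet i - bet j); lra.
Qed.

Lemma outer_info_ge i : n%:R <= 4 * b * outer_info i.
Proof.
have almost : #|predC B|%:R - 1 <= b * outer_info i.
  apply: (@le_trans _ _ (\sum_(j | ~~ B j) (1 - (j == i)%:R))).
    rewrite sumrB sumr_const -mulr_natl mulr1 lerD2l lerN2.
    apply: (@le_trans _ _ (\sum_j (j == i)%:R)).
      by rewrite [leRHS](bigID B)/= lerDr sumr_ge0.
    by rewrite (bigD1 i)//= eqxx big1 ?addr0// => j /negbTE ->.
  rewrite mulr_sumr; apply: ler_sum => j _.
  have [->|ji] := eqVneq j i; first by rewrite subrr mulr_ge0 ?pair_info_ge0 ?(ltW scale_gt0).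
  by rewrite subr0 (pair_info_ge design)// eq_sym.
have := card_outer design; have := size_ge4 design; lra.
Qed.

Lemma outer_info_gt0 i : 0 < outer_info i.
Proof.
have b4 : 0 < 4 * b by rewrite mulr_gt0 ?scale_gt0.
by rewrite -(pmulr_rgt0 _ b4); exact: lt_le_trans size_gt0 (outer_info_ge i).
Qed.

Lemma outer_info_neq0 i : outer_info i != 0.
Proof. by rewrite gt_eqF ?outer_info_gt0. Qed.

Lemma outer_infoV_ge0 i : 0 <= (outer_info i)^-1.
Proof. by rewrite invr_ge0 ltW ?outer_info_gt0. Qed.

Lemma outer_infoV_le i : (outer_info i)^-1 <= 4 * b / n%:R.
Proof. by rewrite ler_pdivlMr ?size_gt0// mulrC ler_pdivrMr ?outer_info_gt0// outer_info_ge. Qed.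

Lemma outer_info_le i : outer_info i <= C * n%:R.
Proof.
apply: (@le_trans _ _ (\sum_(j | ~~ B j) C)).
  by apply: ler_sum => j _; exact: pair_info_le.
rewrite sumr_const -[leLHS]mulr_natr ler_wpM2l ?card_le//.
by have := cst_ge16 design; lra.
Qed.

Lemma le_outer_mean (x X : R) : 0 <= X -> #|predC B|%:R * x <= 2 * X -> x <= 4 * X / n%:R.
Proof.
move=> X0 xX; rewrite ler_pdivlMr ?size_gt0// mulrC.
have [x0|x0] := leP x 0; first by rewrite (@le_trans _ _ 0) ?mulr_ge0// mulr_ge0_le0.
have := ler_wpM2r (ltW x0) (card_outer design); lra.
Qed.

End BlockInformation.

Section Fits.
Context {R : realType} {n : nat}.
Variables (kappa : 'I_n -> 'I_n -> R) (e bet : 'I_n -> R) (B : pred 'I_n) (o : 'I_n).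
Local Notation fit_score del := (score kappa e (fun i => bet i + del i)).

Record full_fit (eps : R) (del : 'I_n -> R) : Prop := FullFit {
  full_ref : del o = 0;
  full_osc : forall i j, `|del i - del j| <= eps;
  full_score : forall i, fit_score del i = 0 }.

Record null_fit (eps : R) (del : 'I_n -> R) : Prop := NullFit {
  null_block : forall i j, B i -> B j -> del i = del j;
  null_ref : del o = 0;
  null_osc : forall i j, `|del i - del j| <= eps;
  null_score : forall i, ~~ B i -> fit_score del i = 0;
  null_score_sum : \sum_(i | B i) fit_score del i = 0 }.

(* In the application [y] is of order (ln n / n)^(1/2). *)
Definition small_noise (b y : R) : bool :=
  [forall i, `|score kappa e bet i| <= n%:R * y] &&
  [forall i, `|\sum_(j | ~~ B j)
     pair_info kappa bet i j * (score kappa e bet j / outer_info kappa bet B j)|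
     <= b * n%:R * y ^+ 2].

End Fits.

Section Expansion.
Context {R : realType} {n : nat}.
Variables (kappa : 'I_n -> 'I_n -> R) (e bet : 'I_n -> R) (B : pred 'I_n) (o : 'I_n).
Variables (C b y : R) (del0 del1 : 'I_n -> R).
Local Notation N := (n%:R : R).
Local Notation info := (pair_info kappa bet).
Local Notation vdeg := (outer_info kappa bet B).
Local Notation eps := (C ^+ 2 * (b * y)).
Hypothesis design : block_design kappa bet B C b.
Hypothesis o_outer : ~~ B o.
Hypothesis fit0 : null_fit kappa e bet B o eps del0.
Hypothesis fit1 : full_fit kappa e bet o eps del1.
Hypothesis noise : small_noise kappa e bet B b y.
Hypotheses (y_gt0 : 0 < y) (ny2_ge1 : 1 <= N * y ^+ 2).
Hypotheses (b3y_le1 : b ^+ 3 * y <= 1) (eps_le_half : 2 * eps <= 1).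

Let g0 i := bet i + del0 i.
Let g1 i := bet i + del1 i.
Let score_null i := score kappa e g0 i.
Let score_true i := score kappa e bet i.
Let eta i := del1 i - del0 i.
Let u := N * y ^+ 2.

Let b_ge1 : 1 <= b. Proof. exact: scale_ge1 design. Qed.
Let b_ge0 : 0 <= b. Proof. exact: le_trans ler01 b_ge1. Qed.
Let C_ge16 : 16 <= C. Proof. exact: cst_ge16 design. Qed.
Let C_ge0 : 0 <= C. Proof. exact/ltW/(cst_gt0 design). Qed.
Let N_gt0 : 0 < N. Proof. exact: size_gt0 design. Qed.
Let N_ge1 : 1 <= N. Proof. by have := size_ge4 design; lra. Qed.
Let y_ge0 : 0 <= y. Proof. exact: ltW. Qed.
Let by_ge0 : 0 <= b * y. Proof. exact: mulr_ge0. Qed.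
Let eps_ge0 : 0 <= eps. Proof. by rewrite mulr_ge0 ?sqr_ge0. Qed.
Let kappa_ge0 i j : 0 <= kappa i j. Proof. exact: weight_ge0 design i j. Qed.
Let vdeg_gt0 i : 0 < vdeg i. Proof. exact: outer_info_gt0 design i. Qed.
Let vdeg_neq0 i : vdeg i != 0. Proof. exact: outer_info_neq0 design i. Qed.
Let b_leX m l : (m <= l)%N -> b ^+ m <= b ^+ l. Proof. exact: ler_weXn2l. Qed.

Let absorb m (X : R) : 0 <= X -> 16 * (C ^+ m * X) <= C ^+ m.+1 * X.
Proof. by move=> X0; rewrite exprS -mulrA ler_wpM2r// mulr_ge0 ?exprn_ge0. Qed.

Let C_leX m l (X : R) : 0 <= X -> (m <= l)%N -> C ^+ m * X <= C ^+ l * X.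
Proof. by move=> X0 ml; rewrite ler_wpM2r// ler_weXn2l//; have := C_ge16; lra. Qed.

Let y_le1 : y <= 1.
Proof. by apply: le_trans b3y_le1; rewrite ler_peMl ?exprn_ege1. Qed.

Let b2u_ge0 : 0 <= b ^+ 2 * u. Proof. by rewrite !mulr_ge0 ?sqr_ge0. Qed.

Let b2y_le : b ^+ 2 * y <= b ^+ 2 * u.
Proof. by rewrite ler_wpM2l ?sqr_ge0// (le_trans y_le1). Qed.

Let by_le : b * y <= b ^+ 2 * u.
Proof. by apply: le_trans b2y_le; rewrite expr2 -mulrA ler_peMl. Qed.

Let kappa_sum_le (P : pred 'I_n) (F : 'I_n -> R) (M : R) (c : R) i :
  (forall j, P j -> `|F j| <= M) -> 0 <= M -> #|P|%:R <= c ->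
  `|\sum_(j | P j) kappa i j * F j| <= c * (C * M).
Proof.
move=> FM M0 Pc; apply: norm_sum_le_card => // [j Pj|]; last exact: mulr_ge0.
by rewrite normrM (ger0_norm (kappa_ge0 _ _)) ler_pM ?(weight_le design) ?FM.
Qed.

Let eta_le i j : `|eta i - eta j| <= 2 * eps.
Proof.
have -> : eta i - eta j = (del1 i - del1 j) - (del0 i - del0 j) by rewrite /eta; ring.
apply: (le_trans (ler_normB _ _)).
by have := null_osc fit0 i j; have := full_osc fit1 i j; lra.
Qed.

Let scoreE i : score_null i = \sum_j kappa i j *
  (logistic (g0 i - g0 j + (eta i - eta j)) - logistic (g0 i - g0 j)).
Proof.
transitivity (score kappa e g0 i - score kappa e g1 i).
  by rewrite (full_score fit1) subr0.
rewrite scoreB; apply: eq_bigr => j _; congr (_ * (logistic _ - _)).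
by rewrite /g0 /g1 /eta; ring.
Qed.

Let noiseB i : score_true i - score_null i = \sum_j kappa i j *
  (logistic (bet i - bet j + (del0 i - del0 j)) - logistic (bet i - bet j)).
Proof.
rewrite scoreB; apply: eq_bigr => j _; congr (_ * (logistic _ - _)).
by rewrite /g0; ring.
Qed.

Let g0B i j : g0 i - g0 j = bet i - bet j + (del0 i - del0 j).
Proof. by rewrite /g0; ring. Qed.

Lemma full_null_secant i j : i != j -> exists2 w, 1 <= w &
  16 * b * (kappa i j * (logistic (g0 i - g0 j + (eta i - eta j)) - logistic (g0 i - g0 j)))
  = w * (eta i - eta j).
Proof.
move=> ij; have eta1 : `|eta i - eta j| <= 1 by exact: le_trans (eta_le i j) _.
have osc0 : `|del0 i - del0 j| <= 1.
  by apply: le_trans (null_osc fit0 i j) _; have := eps_le_half; have := eps_ge0; lra.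
have [slope slope_ge ->] := logistic_secant (g0 i - g0 j) eta1.
exists (16 * b * (kappa i j * slope)); last by ring.
have d_slope : dlogistic (bet i - bet j) / 16 <= slope.
  apply: le_trans slope_ge; rewrite g0B.
  by have := dlogistic_ge_shift (bet i - bet j) osc0; lra.
have kb : 0 <= b * kappa i j by rewrite mulr_ge0.
by have := ler_wpM2l kb d_slope; have := pair_info_ge design ij; rewrite /pair_info; lra.
Qed.

Lemma full_null_outer_osc i j : ~~ B i -> ~~ B j ->
  `|eta i - eta j| <= C ^+ 6 * (b ^+ 2 * y) / N.
Proof.
suff osc : forall i j, ~~ B i -> ~~ B j -> eta i - eta j <= C ^+ 6 * (b ^+ 2 * y) / N.
  by move=> oi oj; rewrite ler_norml; have := osc i j oi oj; have := osc j i oj oi; lra.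
move=> {}i {}j oi oj; pose X := 16 * b * (C * (C * (2 * eps))).
have X0 : 0 <= X by rewrite !mulr_ge0 ?sqr_ge0.
have mean : #|predC B|%:R * (eta i - eta j) <= 2 * X.
  apply: (@oscillation_le _ _ (predC B) eta (fun i j => 16 * b * (kappa i j *
      (logistic (g0 i - g0 j + (eta i - eta j)) - logistic (g0 i - g0 j))))) => // l m.
    have [->|lm] := eqVneq l m; last by move=> _ _; exact: full_null_secant.
    by exists 1; rewrite // !subrr addr0 subrr !mulr0.
  move=> l1 om _; rewrite -mulr_sumr mulrCA /X ler_wpM2l ?mulr_ge0//.
  apply: le_trans (ler_norm _) _; rewrite normrM l1 mul1r.
  have balance := scoreE m; rewrite [score_null m](null_score fit0)// (bigID B) /= in balance.
  rewrite (eq_bigl (fun j => ~~ B j))// (_ : \sum_(j | ~~ B j) _ = - \sum_(j | B j) kappa m j *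
      (logistic (g0 m - g0 j + (eta m - eta j)) - logistic (g0 m - g0 j))); last by lra.
  rewrite normrN; apply: kappa_sum_le; rewrite ?mulr_ge0 ?(card_block design)// => p _.
  exact: le_trans (logistic_lipschitz _ _) (eta_le _ _).
apply: le_trans (le_outer_mean design X0 mean) _; rewrite ler_pM2r ?invr_gt0//.
have b2y : 0 <= b ^+ 2 * y by rewrite mulr_ge0 ?sqr_ge0.
have := absorb 4 b2y; have := absorb 5 b2y; have := mulr_ge0 (exprn_ge0 4 C_ge0) b2y.
have -> : 4 * X = 128 * (C ^+ 4 * (b ^+ 2 * y)) by rewrite /X; ring.
lra.
Qed.

Let outer_gap := C ^+ 6 * (b ^+ 2 * y) / N.

Let outer_gap_ge0 : 0 <= outer_gap.
Proof. exact: le_trans (normr_ge0 _) (full_null_outer_osc o_outer o_outer). Qed.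

Let eta_outer i : ~~ B i -> `|eta i| <= outer_gap.
Proof.
move=> oi; have := full_null_outer_osc oi o_outer.
by rewrite [eta o](_ : _ = 0) ?subr0// /eta (null_ref fit0) (full_ref fit1) subrr.
Qed.

Let sum_cubes_le : \sum_i \sum_j kappa i j * `|eta i - eta j| ^+ 3
  <= C * (N ^+ 2 * outer_gap ^+ 3 + 2 * (N * C * (2 * eps) ^+ 3)).
Proof.
pose in_B i : R := (B i)%:R.
have sum_in_B : \sum_i in_B i <= C.
  apply: le_trans (card_block design); rewrite -sum1_card natr_sum [leRHS]big_mkcond.
  by apply: ler_sum => i _; rewrite /in_B unfold_in; case: (B i).
have cube : 0 <= (2 * eps) ^+ 3 by rewrite exprn_ge0 ?mulr_ge0.
have gap3 : 0 <= outer_gap ^+ 3 by exact: exprn_ge0.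
have sum_const (c : R) : \sum_(j < n) c = N * c by rewrite sumr_const card_ord mulr_natl.
apply: (@le_trans _ _
  (\sum_i \sum_j C * (outer_gap ^+ 3 + (in_B i + in_B j) * (2 * eps) ^+ 3))).
  apply: ler_sum => i _; apply: ler_sum => j _; apply: ler_pM; rewrite ?exprn_ge0//.
    exact: weight_le design i j.
  have eta3 : `|eta i - eta j| ^+ 3 <= (2 * eps) ^+ 3 by rewrite lerXn2r ?nnegrE ?mulr_ge0.
  rewrite /in_B; have [Bi|oi] := boolP (B i); have [Bj|oj] := boolP (B j); rewrite /=; [lra..|].
  by rewrite addr0 mul0r addr0 lerXn2r ?nnegrE// full_null_outer_osc.
have row i : \sum_j C * (outer_gap ^+ 3 + (in_B i + in_B j) * (2 * eps) ^+ 3) =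
    C * (N * outer_gap ^+ 3 + (N * in_B i + \sum_j in_B j) * (2 * eps) ^+ 3).
  by rewrite -mulr_sumr big_split /= sum_const -[X in _ + X]mulr_suml big_split /= sum_const.
under eq_bigr do rewrite row.
rewrite -mulr_sumr big_split /= sum_const -[X in _ + X]mulr_suml big_split /= -mulr_sumr.
rewrite sum_const ler_wpM2l//.
have := ler_wpM2l (mulr_ge0 (ltW N_gt0) cube) sum_in_B; lra.
Qed.

Let Z := b ^+ 6 * (N * y ^+ 3).

Let Z_ge0 : 0 <= Z. Proof. by rewrite !mulr_ge0 ?exprn_ge0. Qed.

Lemma lr_score_approx : `|2 * (loglik kappa e g1 - loglik kappa e g0)
  - \sum_(i | B i) score_null i * eta i| <= C ^+ 20 * Z.
Proof.
have := loglik_trapezoid e (weight_sym design) kappa_ge0 g0 g1.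
have etaE i : g1 i - g0 i = eta i by rewrite /g1 /g0 /eta; ring.
have -> : \sum_i (score kappa e g0 i + score kappa e g1 i) * (g1 i - g0 i) =
    \sum_(i | B i) score_null i * eta i.
  rewrite [RHS]big_mkcond; apply: eq_bigr => i _; rewrite (full_score fit1) addr0 etaE.
  by case: ifP => // /negbT oi; rewrite (null_score fit0)// mul0r.
under [X in _ <= _ * X -> _]eq_bigr do under eq_bigr do rewrite !etaE.
move=> /le_trans; apply; apply: le_trans (ler_wpM2l _ sum_cubes_le) _ => //.
have outer : N ^+ 2 * outer_gap ^+ 3 <= C ^+ 18 * Z.
  have -> : N ^+ 2 * outer_gap ^+ 3 = C ^+ 18 * (b ^+ 6 * (y ^+ 3 / N)).
    by rewrite /outer_gap; field; rewrite gt_eqF.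
  rewrite ler_wpM2l ?exprn_ge0// ler_wpM2l ?exprn_ge0// mulrC ler_wpM2r ?exprn_ge0//.
  by rewrite (le_trans _ N_ge1)// invf_le1.
have inner : N * C * (2 * eps) ^+ 3 <= 8 * (C ^+ 7 * Z).
  have -> : N * C * (2 * eps) ^+ 3 = 8 * (C ^+ 7 * (b ^+ 3 * (N * y ^+ 3))) by ring.
  rewrite ler_wpM2l// ler_wpM2l ?exprn_ge0// ler_wpM2r ?b_leX//.
  by rewrite mulr_ge0 ?exprn_ge0 ?ltW.
have := ler_wpM2l C_ge0 outer; have := ler_wpM2l C_ge0 inner.
rewrite [C * (8 * _)]mulrCA ![C * (C ^+ _ * _)]mulrA -!exprS.
have := C_leX Z_ge0 (isT : (8 <= 19)%N); have := absorb 19 Z_ge0.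
have := mulr_ge0 (exprn_ge0 19 C_ge0) Z_ge0; lra.
Qed.

Lemma score_null_block i : B i -> `|score_null i - vdeg i * eta i| <= C ^+ 8 * (b ^+ 2 * u).
Proof.
move=> Bi; pose incr j := logistic (g0 i - g0 j + (eta i - eta j)) - logistic (g0 i - g0 j).
have -> : score_null i - vdeg i * eta i =
  \sum_(j | ~~ B j) kappa i j * (incr j - dlogistic (bet i - bet j) * (eta i - eta j))
  + \sum_(j | ~~ B j) kappa i j * - (dlogistic (bet i - bet j) * eta j)
  + \sum_(j | B j) kappa i j * incr j.
  rewrite scoreE (bigID B) /= [X in X - _]addrC -[in RHS]big_split /= addrAC; congr (_ + _).
  by rewrite /vdeg mulr_suml -sumrB; apply: eq_bigr => j _; rewrite /pair_info /incr; ring.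
have linear : `|\sum_(j | ~~ B j) kappa i j *
    (incr j - dlogistic (bet i - bet j) * (eta i - eta j))| <= N * (C * (6 * eps ^+ 2)).
  apply: kappa_sum_le (card_le _) => [j _|]; last by rewrite mulr_ge0 ?sqr_ge0.
  have -> : incr j - dlogistic (bet i - bet j) * (eta i - eta j) =
    (incr j - dlogistic (g0 i - g0 j) * (eta i - eta j))
    + (dlogistic (g0 i - g0 j) - dlogistic (bet i - bet j)) * (eta i - eta j) by ring.
  have -> : 6 * eps ^+ 2 = (2 * eps) ^+ 2 + eps * (2 * eps) by ring.
  apply: le_trans (ler_normD _ _) (lerD _ _).
    apply: le_trans (logistic_taylor1 _ _) _.
    by rewrite -real_normK ?num_real// lerXn2r ?nnegrE ?mulr_ge0.
  rewrite normrM ler_pM// g0B.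
  exact: le_trans (dlogistic_lipschitz _ _) (null_osc fit0 i j).
have outer : `|\sum_(j | ~~ B j) kappa i j * - (dlogistic (bet i - bet j) * eta j)|
    <= N * (C * outer_gap).
  apply: kappa_sum_le (card_le _) => // j oj; rewrite normrN normrM gtr0_norm ?dlogistic_gt0//.
  rewrite -[leRHS]mul1r ler_pM ?eta_outer ?(ltW (dlogistic_gt0 _))//.
  by have := dlogistic_le (bet i - bet j); lra.
have inner : `|\sum_(j | B j) kappa i j * incr j| <= C * (C * (2 * eps)).
  apply: kappa_sum_le (card_block design) => [j _|]; last exact: mulr_ge0.
  exact: le_trans (logistic_lipschitz _ _) (eta_le _ _).
have outerE : N * (C * outer_gap) = C ^+ 7 * (b ^+ 2 * y).
  by rewrite /outer_gap; field; rewrite gt_eqF.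
apply: le_trans (ler_normD _ _) _; apply: le_trans (lerD (ler_normD _ _) inner) _.
have := ler_wpM2l (exprn_ge0 7 C_ge0) b2y_le; have := ler_wpM2l (exprn_ge0 4 C_ge0) by_le.
have := absorb 7 b2u_ge0; have := C_leX b2u_ge0 (isT : (5 <= 7)%N).
have := C_leX b2u_ge0 (isT : (4 <= 7)%N); have := mulr_ge0 (exprn_ge0 7 C_ge0) b2u_ge0.
move: linear outer; rewrite outerE.
have -> : N * (C * (6 * eps ^+ 2)) = 6 * (C ^+ 5 * (b ^+ 2 * u)) by rewrite /u; ring.
lra.
Qed.

Lemma score_null_le i : `|score_null i| <= C ^+ 4 * (b * (N * y)).
Proof.
have Ny : 0 <= N * y by rewrite mulr_ge0 ?ltW.
have -> : score_null i = score_true i - (score_true i - score_null i) by ring.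
have score_true_le : `|score_true i| <= N * y by case/andP: noise => /forallP.
have diff : `|score_true i - score_null i| <= N * (C * eps).
  rewrite noiseB; apply: kappa_sum_le (card_le _) => // j _.
  exact: le_trans (logistic_lipschitz _ _) (null_osc fit0 i j).
have bNy : 0 <= b * (N * y) by rewrite mulr_ge0.
have Ny_le : N * y <= C ^+ 3 * (b * (N * y)).
  apply: (@le_trans _ _ (b * (N * y))); first by rewrite ler_peMl.
  by rewrite ler_peMl ?exprn_ege1//; have := C_ge16; lra.
apply: le_trans (ler_normB _ _) _; have := absorb 3 bNy.
have := mulr_ge0 (exprn_ge0 3 C_ge0) bNy; lra.
Qed.

(* For [i] in the block, [score_true i - score_null i] is nearly [vdeg i * (del0 i - wavg i)], and
   [wavg] is nearly constant: that constant is what the second term of [block_quad] projects out. *)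
Let wavg i := (\sum_(j | ~~ B j) info i j * del0 j) / vdeg i.

Let vdeg_wavg i : vdeg i * wavg i = \sum_(j | ~~ B j) info i j * del0 j.
Proof. by rewrite mulrC divfK. Qed.

Lemma noise_score_linear i :
  `|score_true i - score_null i - vdeg i * (del0 i - wavg i)| <= C ^+ 6 * (b ^+ 2 * u).
Proof.
pose incr j := logistic (bet i - bet j + (del0 i - del0 j)) - logistic (bet i - bet j).
have -> : score_true i - score_null i - vdeg i * (del0 i - wavg i) =
  \sum_(j | ~~ B j) kappa i j * (incr j - dlogistic (bet i - bet j) * (del0 i - del0 j))
  + \sum_(j | B j) kappa i j * incr j.
  rewrite noiseB (bigID B) /= [X in X - _]addrC addrAC; congr (_ + _).
  rewrite mulrBr vdeg_wavg /vdeg mulr_suml -!sumrB; apply: eq_bigr => j _.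
  by rewrite /pair_info /incr; ring.
have outer : `|\sum_(j | ~~ B j) kappa i j *
    (incr j - dlogistic (bet i - bet j) * (del0 i - del0 j))| <= N * (C * eps ^+ 2).
  apply: kappa_sum_le (card_le _) => [j _|]; last exact: sqr_ge0.
  apply: le_trans (logistic_taylor1 _ _) _.
  by rewrite -real_normK ?num_real// lerXn2r ?nnegrE ?(null_osc fit0).
have inner : `|\sum_(j | B j) kappa i j * incr j| <= C * (C * eps).
  apply: kappa_sum_le (card_block design) => // j _.
  exact: le_trans (logistic_lipschitz _ _) (null_osc fit0 i j).
apply: le_trans (ler_normD _ _) _.
have := ler_wpM2l (exprn_ge0 4 C_ge0) by_le; have := absorb 5 b2u_ge0.
have := C_leX b2u_ge0 (isT : (4 <= 5)%N); have := mulr_ge0 (exprn_ge0 5 C_ge0) b2u_ge0.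
have linearE : N * (C * eps ^+ 2) = C ^+ 5 * (b ^+ 2 * u) by rewrite /u; ring.
rewrite linearE in outer; lra.
Qed.

Lemma wavg_gap i :
  `|\sum_(j | ~~ B j) info i j * (wavg i - wavg j)| <= vdeg i * (C ^+ 7 * (b ^+ 3 * y ^+ 2)).
Proof.
have -> : \sum_(j | ~~ B j) info i j * (wavg i - wavg j) =
   \sum_(j | ~~ B j) info i j * (score_true j / vdeg j)
   + \sum_(j | ~~ B j) info i j * ((del0 j - wavg j) - score_true j / vdeg j).
  rewrite -big_split /= (eq_bigr (fun j => info i j * wavg i - info i j * wavg j)).
    by rewrite sumrB -mulr_suml vdeg_wavg -sumrB; apply: eq_bigr => j _; ring.
  by move=> j _; rewrite mulrBr.
have b3y2 : 0 <= b ^+ 3 * y ^+ 2 by rewrite mulr_ge0 ?exprn_ge0.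
have avg : `|\sum_(j | ~~ B j) info i j * (score_true j / vdeg j)|
    <= vdeg i * (4 * (b ^+ 3 * y ^+ 2)).
  case/andP: noise => _ /forallP/(_ i)/le_trans; apply.
  apply: (@le_trans _ _ (4 * b * vdeg i * (b * y ^+ 2))).
    by rewrite mulrAC mulrC ler_wpM2r ?mulr_ge0 ?sqr_ge0// (outer_info_ge design).
  rewrite (_ : _ * _ = vdeg i * 4 * (b ^+ 2 * y ^+ 2)); last by ring.
  by rewrite [leRHS]mulrA ler_wpM2l ?mulr_ge0 ?(ltW (vdeg_gt0 _))// ler_wpM2r ?sqr_ge0 ?b_leX.
have rest : `|\sum_(j | ~~ B j) info i j * ((del0 j - wavg j) - score_true j / vdeg j)|
    <= vdeg i * (4 * (C ^+ 6 * (b ^+ 3 * y ^+ 2))).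
  apply: le_trans (ler_norm_sum _ _ _) _; rewrite /vdeg mulr_suml; apply: ler_sum => j oj.
  rewrite normrM (ger0_norm (pair_info_ge0 design _ _)) ler_wpM2l ?(pair_info_ge0 design)//.
  have -> : del0 j - wavg j - score_true j / vdeg j =
      - (score_true j - score_null j - vdeg j * (del0 j - wavg j)) / vdeg j.
    by rewrite [score_null j](null_score fit0 oj); field.
  have -> : 4 * (C ^+ 6 * (b ^+ 3 * y ^+ 2)) = C ^+ 6 * (b ^+ 2 * u) * (4 * b / N).
    by rewrite /u; field; rewrite gt_eqF.
  rewrite normrM normrN (ger0_norm (outer_infoV_ge0 design _)).
  by rewrite ler_pM ?(outer_infoV_ge0 design) ?(outer_infoV_le design) ?noise_score_linear.
apply: le_trans (ler_normD _ _) _; apply: le_trans (lerD avg rest) _.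
rewrite -mulrDr ler_wpM2l ?(ltW (vdeg_gt0 _))//.
have := absorb 6 b3y2; have := C_leX b3y2 (isT : (0 <= 6)%N); rewrite expr0 mul1r.
have := mulr_ge0 (exprn_ge0 6 C_ge0) b3y2; lra.
Qed.

Let b4y2_ge0 : 0 <= b ^+ 4 * y ^+ 2. Proof. by rewrite mulr_ge0 ?exprn_ge0. Qed.

Lemma wavg_outer_osc i j : ~~ B i -> ~~ B j ->
  `|wavg i - wavg j| <= 4 * (C ^+ 8 * (b ^+ 4 * y ^+ 2)).
Proof.
suff osc : forall i j, ~~ B i -> ~~ B j ->
    wavg i - wavg j <= 4 * (C ^+ 8 * (b ^+ 4 * y ^+ 2)).
  by move=> oi oj; rewrite ler_norml; have := osc i j oi oj; have := osc j i oj oi; lra.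
move=> {}i {}j oi oj; pose X := b * (C * N * (C ^+ 7 * (b ^+ 3 * y ^+ 2))).
have gap0 : 0 <= C ^+ 7 * (b ^+ 3 * y ^+ 2) by rewrite !mulr_ge0 ?exprn_ge0.
have X0 : 0 <= X by rewrite !mulr_ge0 ?exprn_ge0.
have mean : #|predC B|%:R * (wavg i - wavg j) <= 2 * X.
  apply: (@oscillation_le _ _ (predC B) wavg
      (fun i j => b * (info i j * (wavg i - wavg j)))) => // l m.
    move=> _ _; have [->|lm] := eqVneq l m; first by exists 1; rewrite // !subrr !mulr0.
    by exists (b * info l m); [exact: pair_info_ge design l m lm|rewrite mulrA].
  move=> l1 om _; rewrite -mulr_sumr mulrCA ler_wpM2l//.
  apply: le_trans (ler_norm _) _; rewrite normrM l1 mul1r.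
  by apply: le_trans (wavg_gap m) _; rewrite ler_wpM2r// (outer_info_le design).
apply: le_trans (le_outer_mean design X0 mean) _.
by rewrite /X le_eqVlt; apply/orP; left; apply/eqP; field; rewrite gt_eqF.
Qed.

Lemma wavg_near_ref i : `|wavg i - wavg o| <= C ^+ 9 * (b ^+ 4 * y ^+ 2).
Proof.
rewrite -(ler_pM2l (vdeg_gt0 i)) -{1}(gtr0_norm (vdeg_gt0 i)) -normrM.
have -> : vdeg i * (wavg i - wavg o) = \sum_(j | ~~ B j) info i j * (wavg i - wavg j)
   + \sum_(j | ~~ B j) info i j * (wavg j - wavg o).
  by rewrite -big_split /= /vdeg mulr_suml; apply: eq_bigr => j _; ring.
have outer : `|\sum_(j | ~~ B j) info i j * (wavg j - wavg o)|
    <= vdeg i * (4 * (C ^+ 8 * (b ^+ 4 * y ^+ 2))).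
  apply: le_trans (ler_norm_sum _ _ _) _; rewrite /vdeg mulr_suml; apply: ler_sum => j oj.
  rewrite normrM (ger0_norm (pair_info_ge0 design _ _)) ler_wpM2l ?(pair_info_ge0 design)//.
  exact: wavg_outer_osc.
apply: le_trans (ler_normD _ _) _; apply: le_trans (lerD (wavg_gap i) outer) _.
rewrite -mulrDr ler_wpM2l ?(ltW (vdeg_gt0 _))//.
have b34 : C ^+ 7 * (b ^+ 3 * y ^+ 2) <= C ^+ 7 * (b ^+ 4 * y ^+ 2).
  by rewrite ler_wpM2l ?exprn_ge0// ler_wpM2r ?sqr_ge0 ?b_leX.
have := C_leX b4y2_ge0 (isT : (7 <= 8)%N); have := absorb 8 b4y2_ge0.
have := mulr_ge0 (exprn_ge0 8 C_ge0) b4y2_ge0; lra.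
Qed.

Variables (D : 'I_n -> R) (ib : 'I_n).
Hypothesis D_noise : forall i, B i -> `|D i - score_true i| <= C ^+ 2.
Hypothesis B_ib : B ib.

Let shift := del0 ib - wavg o.
Let F i := D i - score_null i - vdeg i * shift.

Let b4u_ge0 : 0 <= b ^+ 4 * u. Proof. by rewrite !mulr_ge0 ?exprn_ge0// ltW. Qed.

Lemma block_noise_repr i : B i -> `|F i| <= C ^+ 11 * (b ^+ 4 * u).
Proof.
move=> Bi; have -> : F i = (D i - score_true i)
    + (score_true i - score_null i - vdeg i * (del0 i - wavg i)) - vdeg i * (wavg i - wavg o).
  by rewrite /F /shift (null_block fit0 B_ib Bi); ring.
have near : `|vdeg i * (wavg i - wavg o)| <= C ^+ 10 * (b ^+ 4 * u).
  rewrite normrM (gtr0_norm (vdeg_gt0 _)).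
  have -> : C ^+ 10 * (b ^+ 4 * u) = C * N * (C ^+ 9 * (b ^+ 4 * y ^+ 2)) by rewrite /u; ring.
  by rewrite ler_pM ?(ltW (vdeg_gt0 _)) ?(outer_info_le design) ?wavg_near_ref.
have lin : C ^+ 6 * (b ^+ 2 * u) <= C ^+ 6 * (b ^+ 4 * u).
  by rewrite ler_wpM2l ?exprn_ge0// ler_wpM2r ?b_leX ?mulr_ge0 ?sqr_ge0 ?ltW.
have cst : C ^+ 2 <= C ^+ 2 * (b ^+ 4 * u).
  by rewrite ler_peMr ?sqr_ge0// mulr_ege1 ?exprn_ege1.
apply: le_trans (ler_normB _ _) _.
have := le_trans (ler_normD _ _) (lerD (D_noise Bi) (noise_score_linear i)).
have := C_leX b4u_ge0 (isT : (2 <= 10)%N); have := C_leX b4u_ge0 (isT : (6 <= 10)%N).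
have := absorb 10 b4u_ge0; have := mulr_ge0 (exprn_ge0 10 C_ge0) b4u_ge0; lra.
Qed.

Let V := \sum_(i | B i) vdeg i.

Let V_ge : vdeg ib <= V.
Proof. by rewrite /V (bigD1 ib)//= lerDl sumr_ge0// => i _; exact: ltW. Qed.

Let V_gt0 : 0 < V. Proof. exact: lt_le_trans (vdeg_gt0 ib) V_ge. Qed.

Let invV_le : V^-1 <= 4 * b / N.
Proof. by apply: le_trans (outer_infoV_le design ib); rewrite lef_pV2 ?posrE. Qed.

Lemma block_quad_score : block_quad kappa bet B D = \sum_(i | B i) score_null i ^+ 2 / vdeg i
  + \sum_(i | B i) (2 * (score_null i * F i) + F i ^+ 2) / vdeg i - (\sum_(i | B i) F i) ^+ 2 / V.
Proof.
have DE i : D i = score_null i + F i + vdeg i * shift by rewrite /F; ring.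
have sum0 : \sum_(i | B i) score_null i = 0 := null_score_sum fit0.
rewrite /block_quad -/V.
have -> : \sum_(i | B i) D i = \sum_(i | B i) F i + V * shift.
  by rewrite (eq_bigr _ (fun i _ => DE i)) big_split big_split /= sum0 add0r /V mulr_suml.
have -> : \sum_(i | B i) D i ^+ 2 / vdeg i = \sum_(i | B i) score_null i ^+ 2 / vdeg i
    + \sum_(i | B i) (2 * (score_null i * F i) + F i ^+ 2) / vdeg i
    + 2 * shift * (\sum_(i | B i) F i) + V * shift ^+ 2 + 2 * shift * (\sum_(i | B i) score_null i).
  rewrite /V !mulr_sumr mulr_suml -!big_split /=; apply: eq_bigr => i _.
  by rewrite (DE i); field.
by rewrite sum0 mulr0 addr0; field; rewrite gt_eqF.
Qed.

Let bN_ge0 : 0 <= 4 * b / N. Proof. by rewrite divr_ge0 ?mulr_ge0// ltW. Qed.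

Let sum_vdegV_le (G : 'I_n -> R) M : (forall i, B i -> `|G i| <= M) -> 0 <= M ->
  `|\sum_(i | B i) G i / vdeg i| <= C * (M * (4 * b / N)).
Proof.
move=> GM M0; apply: norm_sum_le_card => [i Bi||]; last exact: card_block design.
  rewrite normrM (ger0_norm (outer_infoV_ge0 design _)).
  by rewrite ler_pM ?(outer_infoV_ge0 design) ?GM ?(outer_infoV_le design).
exact: mulr_ge0.
Qed.

Let score_null_bound_ge0 : 0 <= C ^+ 4 * (b * (N * y)).
Proof. by rewrite !mulr_ge0 ?exprn_ge0// ltW. Qed.

Let F_bound_ge0 : 0 <= C ^+ 11 * (b ^+ 4 * u).
Proof. by rewrite mulr_ge0 ?exprn_ge0. Qed.

Lemma score_null_quad_approx :
  `|\sum_(i | B i) score_null i * eta i - \sum_(i | B i) score_null i ^+ 2 / vdeg i| <= C ^+ 14 * Z.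
Proof.
have -> : \sum_(i | B i) score_null i * eta i - \sum_(i | B i) score_null i ^+ 2 / vdeg i =
    \sum_(i | B i) - (score_null i * (score_null i - vdeg i * eta i)) / vdeg i.
  by rewrite -sumrB; apply: eq_bigr => i _; field.
apply: le_trans (sum_vdegV_le (M := C ^+ 4 * (b * (N * y)) * (C ^+ 8 * (b ^+ 2 * u))) _ _) _.
- by move=> i Bi; rewrite normrN normrM ler_pM ?score_null_le ?score_null_block.
- by rewrite mulr_ge0// mulr_ge0 ?exprn_ge0.
have -> : C * (C ^+ 4 * (b * (N * y)) * (C ^+ 8 * (b ^+ 2 * u)) * (4 * b / N)) =
    4 * (C ^+ 13 * (b ^+ 4 * (N * y ^+ 3))) by rewrite /u; field; rewrite gt_eqF.
have : b ^+ 4 * (N * y ^+ 3) <= Z.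
  by rewrite ler_wpM2r ?b_leX// mulr_ge0 ?exprn_ge0// ltW.
move=> /(ler_wpM2l (exprn_ge0 13 C_ge0)); have := absorb 13 Z_ge0.
have := mulr_ge0 (exprn_ge0 13 C_ge0) Z_ge0; lra.
Qed.

Let b9u2_le : b ^+ 9 * u ^+ 2 / N <= Z.
Proof.
have -> : b ^+ 9 * u ^+ 2 / N = b ^+ 3 * y * Z by rewrite /u /Z; field; rewrite gt_eqF.
by rewrite ler_piMl.
Qed.

Lemma block_quad_cross_le :
  `|\sum_(i | B i) (2 * (score_null i * F i) + F i ^+ 2) / vdeg i| <= C ^+ 24 * Z.
Proof.
pose M := 2 * (C ^+ 4 * (b * (N * y)) * (C ^+ 11 * (b ^+ 4 * u))) + (C ^+ 11 * (b ^+ 4 * u)) ^+ 2.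
apply: le_trans (sum_vdegV_le (M := M) _ _) _.
- move=> i Bi; have Fi := block_noise_repr Bi.
  apply: le_trans (ler_normD _ _) (lerD _ _).
    by rewrite normrM ger0_norm// ler_wpM2l// normrM ler_pM ?score_null_le.
  by rewrite normrX lerXn2r ?nnegrE.
- by rewrite addr_ge0 ?sqr_ge0 ?mulr_ge0.
have -> : C * (M * (4 * b / N)) = 8 * (C ^+ 16 * Z) + 4 * (C ^+ 23 * (b ^+ 9 * u ^+ 2 / N)).
  by rewrite /M /u /Z; field; rewrite gt_eqF.
have := ler_wpM2l (exprn_ge0 23 C_ge0) b9u2_le; have := C_leX Z_ge0 (isT : (16 <= 23)%N).
have := absorb 23 Z_ge0; have := mulr_ge0 (exprn_ge0 23 C_ge0) Z_ge0; lra.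
Qed.

Lemma block_quad_mean_le : `|(\sum_(i | B i) F i) ^+ 2 / V| <= C ^+ 25 * Z.
Proof.
have sumF : `|\sum_(i | B i) F i| <= C * (C ^+ 11 * (b ^+ 4 * u)).
  by apply: norm_sum_le_card (card_block design) => //; exact: block_noise_repr.
apply: (@le_trans _ _ ((C * (C ^+ 11 * (b ^+ 4 * u))) ^+ 2 * (4 * b / N))).
  rewrite normrM normrX [ `|V^-1|]ger0_norm ?invr_ge0 ?(ltW V_gt0)//.
  by rewrite ler_pM ?invr_ge0 ?(ltW V_gt0) ?lerXn2r ?nnegrE ?mulr_ge0.
have -> : (C * (C ^+ 11 * (b ^+ 4 * u))) ^+ 2 * (4 * b / N) =
  4 * (C ^+ 24 * (b ^+ 9 * u ^+ 2 / N)) by field; rewrite gt_eqF.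
have := ler_wpM2l (exprn_ge0 24 C_ge0) b9u2_le; have := absorb 24 Z_ge0.
have := mulr_ge0 (exprn_ge0 24 C_ge0) Z_ge0; lra.
Qed.

Lemma lr_block_quad_rate :
  `|2 * (loglik kappa e g1 - loglik kappa e g0) - block_quad kappa bet B D| <= C ^+ 26 * Z.
Proof.
rewrite block_quad_score; have := lr_score_approx; have := score_null_quad_approx.
have := block_quad_cross_le; have := block_quad_mean_le.
have := C_leX Z_ge0 (isT : (20 <= 25)%N); have := C_leX Z_ge0 (isT : (14 <= 25)%N).
have := C_leX Z_ge0 (isT : (24 <= 25)%N); have := absorb 25 Z_ge0.
have := mulr_ge0 (exprn_ge0 25 C_ge0) Z_ge0.
rewrite !ler_norml => ? ? ? ? ? /andP[? ?] /andP[? ?] /andP[? ?] /andP[? ?].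
by apply/andP; split; lra.
Qed.

End Expansion.

Section BinomialMean.
Context {R : realType}.
Implicit Types (N : nat) (p : R) (f g : nat -> R).

Definition binomial_mean N p f : R :=
  \sum_(0 <= j < N.+1) ('C(N, j)%:R * p ^+ j * (1 - p) ^+ (N - j)) * f j.

Lemma binomial_mean0 p f : binomial_mean 0 p f = f 0%N.
Proof. by rewrite /binomial_mean big_nat1 bin0 !expr0 !mul1r. Qed.

Lemma binomial_meanS N p f : binomial_mean N.+1 p f =
  p * binomial_mean N p (fun j => f j.+1) + (1 - p) * binomial_mean N p f.
Proof.
rewrite /binomial_mean big_nat_recl//= bin0 expr0 subn0 mul1r mul1r.
have pascal : \sum_(0 <= j < N.+1)
    ('C(N.+1, j.+1)%:R * p ^+ j.+1 * (1 - p) ^+ (N.+1 - j.+1)) * f j.+1 =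
  p * (\sum_(0 <= j < N.+1) ('C(N, j)%:R * p ^+ j * (1 - p) ^+ (N - j)) * f j.+1) +
  \sum_(0 <= j < N.+1) ('C(N, j.+1)%:R * p ^+ j.+1 * (1 - p) ^+ (N - j)) * f j.+1.
  rewrite mulr_sumr -big_split /=; apply: eq_bigr => j _.
  by rewrite binS natrD subSS exprS; ring.
rewrite pascal [LHS]addrCA; congr (_ + _).
rewrite [in RHS]big_nat_recl//= bin0 expr0 subn0 !mul1r mulrDr mulrA -exprS; congr (_ + _).
rewrite big_nat_recr//= bin_small// !mul0r addr0 mulr_sumr.
apply: eq_big_nat => j /andP[_ jN].
have -> : (1 - p) ^+ (N - j) = (1 - p) * (1 - p) ^+ (N - j.+1) by rewrite -exprS subnSK.
by ring.
Qed.

Lemma eq_binomial_mean N p f g : f =1 g -> binomial_mean N p f = binomial_mean N p g.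
Proof. by move=> fg; apply: eq_bigr => j _; rewrite fg. Qed.

Lemma binomial_mean_quad N p (a b c : R) :
  binomial_mean N p (fun j => a + b * j%:R + c * j%:R ^+ 2) =
  a + b * (N%:R * p) + c * (N%:R * p * (1 - p) + (N%:R * p) ^+ 2).
Proof.
elim: N a b c => [|N IH] a b c; first by rewrite binomial_mean0; ring.
rewrite binomial_meanS IH -natr1.
rewrite (@eq_binomial_mean _ _ _ (fun j => (a + b + c) + (b + 2 * c) * j%:R + c * j%:R ^+ 2)).
  by rewrite IH; ring.
by move=> j; rewrite -natr1; ring.
Qed.

Lemma binomial_mean_cst N p c : binomial_mean N p (fun=> c) = c.
Proof.
rewrite (@eq_binomial_mean _ _ _ (fun j => c + 0 * j%:R + 0 * j%:R ^+ 2)) => [|j]; last by ring.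
by rewrite binomial_mean_quad; ring.
Qed.

Lemma binomial_mean_center N p : binomial_mean N p (fun j => j%:R - N%:R * p) = 0.
Proof.
rewrite (@eq_binomial_mean _ _ _ (fun j => - (N%:R * p) + 1 * j%:R + 0 * j%:R ^+ 2)).
  by rewrite binomial_mean_quad; ring.
by move=> j; ring.
Qed.

Lemma binomial_mean_variance N p :
  binomial_mean N p (fun j => (j%:R - N%:R * p) ^+ 2) = N%:R * p * (1 - p).
Proof.
rewrite (@eq_binomial_mean _ _ _
  (fun j => (N%:R * p) ^+ 2 + - (2 * N%:R * p) * j%:R + 1 * j%:R ^+ 2)).
  by rewrite binomial_mean_quad; ring.
by move=> j; ring.
Qed.

Lemma binomial_mean_dist_le N p (M : R) f g : 0 <= p <= 1 ->
  (forall j, (j <= N)%N -> `|f j - M| <= g j) ->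
  `|binomial_mean N p f - M| <= binomial_mean N p g.
Proof.
move=> /andP[p0 p1] fg; rewrite -{1}(binomial_mean_cst N p M) /binomial_mean -sumrB.
apply: le_trans (ler_norm_sum _ _ _) _; apply: ler_sum_nat => j /andP[_ jN].
have w0 : 0 <= 'C(N, j)%:R * p ^+ j * (1 - p) ^+ (N - j).
  by rewrite !mulr_ge0 ?exprn_ge0// subr_ge0.
by rewrite -mulrBr normrM (ger0_norm w0) ler_wpM2l// fg.
Qed.

Lemma binomial_mean_widen K N p f : (N <= K)%N ->
  \sum_(x < K.+1) ('C(N, x)%:R * p ^+ x * (1 - p) ^+ (N - x)) * f x = binomial_mean N p f.
Proof.
move=> NK; rewrite /binomial_mean.
rewrite -(big_mkord xpredT (fun x => ('C(N, x)%:R * p ^+ x * (1 - p) ^+ (N - x)) * f x)).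
rewrite (@big_cat_nat _ _ _ N.+1)//= [X in _ + X]big_nat_cond [X in _ + X]big1 ?addr0// => j.
by rewrite andbT => /andP[Nj _]; rewrite bin_small// !mul0r.
Qed.

End BinomialMean.

Section Bernstein.
Context {R : realType}.
Implicit Types (f : R -> R) (N : nat).

Definition bernstein f N : {poly R} :=
  \sum_(0 <= j < N.+1) ('C(N, j)%:R * f (j%:R / N%:R)) *: ('X ^+ j * (1 - 'X) ^+ (N - j)).

Lemma horner_bernstein f N (u : R) :
  (bernstein f N).[u] = binomial_mean N u (fun j => f (j%:R / N%:R)).
Proof.
rewrite /bernstein horner_sum; apply: eq_bigr => j _.
rewrite hornerZ hornerM !horner_exp hornerX.
have -> : (1 - 'X : {poly R}).[u] = 1 - u by rewrite !hornerE.
by ring.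
Qed.

Section Lipschitz.
Variables (f : R -> R) (c : R).
Hypothesis c_ge0 : 0 <= c.
Hypothesis f_lip : forall u v : R, 0 <= u <= 1 -> 0 <= v <= 1 -> `|f u - f v| <= c * `|u - v|.

Lemma bernstein_dist_le N (u eta : R) : 0 <= u <= 1 -> 0 < eta -> N.+1%:R^-1 <= eta ^+ 2 ->
  `|(bernstein f N.+1).[u] - f u| <= c * eta.
Proof.
move=> u01 eta0 Neta; have /andP[u0 u1] := u01.
have N0 : 0 < N.+1%:R :> R by [].
pose var_weight : R := (2 * eta * N.+1%:R ^+ 2)^-1.
(* |d| <= eta / 2 + d^2 / (2 eta) turns the distance into a variance. *)
have dist j : (j <= N.+1)%N -> `|f (j%:R / N.+1%:R) - f u|
    <= c * (eta / 2 + var_weight * (N.+1%:R * u) ^+ 2)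
       + - (c * var_weight * (2 * (N.+1%:R * u))) * j%:R + c * var_weight * j%:R ^+ 2.
  move=> jN; have j01 : 0 <= (j%:R / N.+1%:R : R) <= 1.
    by rewrite divr_ge0//= ler_pdivrMr// mul1r ler_nat.
  apply: le_trans (f_lip j01 u01) _; set d := _ - u.
  have -> : c * (eta / 2 + var_weight * (N.+1%:R * u) ^+ 2)
      + - (c * var_weight * (2 * (N.+1%:R * u))) * j%:R + c * var_weight * j%:R ^+ 2 =
      c * ((eta ^+ 2 + `|d| ^+ 2) / (2 * eta)).
    by rewrite real_normK ?num_real// /d /var_weight; field; rewrite nat1r !gt_eqF.
  rewrite ler_wpM2l// ler_pdivlMr ?mulr_gt0//.
  by have := sqr_ge0 (`|d| - eta); rewrite sqrrB; lra.
rewrite horner_bernstein (le_trans (binomial_mean_dist_le u01 dist))// binomial_mean_quad.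
have -> : c * (eta / 2 + var_weight * (N.+1%:R * u) ^+ 2)
    + - (c * var_weight * (2 * (N.+1%:R * u))) * (N.+1%:R * u)
    + c * var_weight * (N.+1%:R * u * (1 - u) + (N.+1%:R * u) ^+ 2) =
    c * (eta / 2 + N.+1%:R^-1 * (u * (1 - u)) / (2 * eta)).
  by rewrite /var_weight; field; rewrite nat1r !gt_eqF.
rewrite ler_wpM2l// [leRHS](splitr eta) lerD2l ler_pdivrMr ?mulr_gt0//.
have -> : eta / 2 * (2 * eta) = eta ^+ 2 by field.
by apply: le_trans Neta; rewrite ler_piMr ?invr_ge0 ?ltW//; nra.
Qed.

Lemma lipschitz_poly_approx (kappa : R) : 0 < kappa ->
  exists p : {poly R}, forall u : R, 0 <= u <= 1 -> `|p.[u] - f u| <= kappa.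
Proof.
move=> k0; have c1 : 0 < c + 1 by rewrite ltr_wpDl.
have eta0 : 0 < kappa / (c + 1) by rewrite divr_gt0.
have [N] := ltr_add_invr (exprn_gt0 2 eta0); rewrite add0r => /ltW Neta.
exists (bernstein f N.+1) => u u01; apply: le_trans (bernstein_dist_le u01 eta0 Neta) _.
by rewrite mulrCA ler_piMr ?(ltW k0)// ler_pdivrMr// mul1r lerDl.
Qed.

End Lipschitz.

Lemma norm_min_dist_le (a x y : R) : `|Num.min a x - Num.min a y| <= `|x - y|.
Proof.
have := ler_norm (x - y); have := ler_norm (y - x); rewrite distrC ler_norml => ? ?.
by case: (leP a x) => ?; case: (leP a y) => ?; apply/andP; split; lra.
Qed.

Lemma norm_max_dist_le (a x y : R) : `|Num.max a x - Num.max a y| <= `|x - y|.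
Proof.
have maxE z : Num.max a z = - Num.min (- a) (- z) by rewrite oppr_min !opprK.
rewrite !maxE -opprD normrN (le_trans (norm_min_dist_le _ _ _))//.
by rewrite -opprD normrN.
Qed.

Lemma poly_step_approx (x x' kappa : R) : x < x' -> 0 < kappa ->
  exists p : {poly R}, forall t, 0 <= t ->
    (t <= x)%R%:R <= p.[expR (- t)] <= (t <= x')%R%:R + kappa.
Proof.
move=> xx' k0; pose a := expR (- x'); pose slope := (expR (- x) - a)^-1.
have d0 : 0 < expR (- x) - a by rewrite subr_gt0 ltr_expR ltrN2.
have slope0 : 0 < slope by rewrite invr_gt0.
pose ramp (u : R) := Num.min 1 (Num.max 0 (slope * (u - a))).
have lip (u v : R) : 0 <= u <= 1 -> 0 <= v <= 1 -> `|ramp u - ramp v| <= slope * `|u - v|.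
  move=> _ _; apply: le_trans (norm_min_dist_le _ _ _) _.
  apply: le_trans (norm_max_dist_le _ _ _) _.
  by rewrite -mulrBr opprB addrA subrK normrM gtr0_norm.
have [p p_ramp] := lipschitz_poly_approx (ltW slope0) lip (divr_gt0 k0 (ltr0n R 2)).
exists (p + (kappa / 2)%:P) => t t0.
have u01 : 0 <= expR (- t) <= 1 by rewrite expR_ge0 expR_le1 oppr_le0.
have lower : (t <= x)%R%:R <= ramp (expR (- t)).
  rewrite /ramp; have [tx|tx] := leP t x; last by rewrite le_min ler01 le_max lexx.
  rewrite le_min lexx /= le_max; apply/orP; right.
  by rewrite mulrC ler_pdivlMr// mul1r lerD2r ler_expR lerN2.
have upper : ramp (expR (- t)) <= (t <= x')%R%:R.
  rewrite /ramp; have [tx|tx] := leP t x'; first by rewrite ge_min lexx.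
  rewrite ge_min ge_max lexx /=; apply/orP; right.
  by rewrite pmulr_rle0// subr_le0 ler_expR lerN2 ltW.
have := p_ramp _ u01; rewrite hornerD hornerC ler_norml => /andP[? ?].
by apply/andP; split; lra.
Qed.

End Bernstein.

Section PositiveRay.
Context {R : realType}.
Notation mu := (@lebesgue_measure R).

Definition posray : set R := `]0, +oo[%classic.

Lemma measurable_posray : measurable posray.
Proof. exact: measurable_itv. Qed.

Lemma posrayE (t : R) : posray t = (0 < t).
Proof. by rewrite /posray /= in_itv /= andbT. Qed.

Lemma bigcup_rays (c : R) : 0 < c ->
  \bigcup_(i : nat) `[c / i.+1%:R, +oo[%classic = posray.
Proof.
move=> c0; apply/seteqP; split=> [t [i _] /=|t].
  rewrite posrayE in_itv /= andbT; apply: lt_le_trans.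
  by rewrite divr_gt0.
rewrite posrayE => t0; have /ltr_add_invr[k] : 0 < t / c by rewrite divr_gt0.
rewrite add0r => kt; exists k => //=; rewrite in_itv /= andbT.
by rewrite -ler_pdivlMl// mulrC ltW.
Qed.

Lemma rays_nondecreasing (c : R) : 0 < c ->
  {homo (fun i : nat => `[c / i.+1%:R, +oo[%classic) : i j / (i <= j)%N >-> (i <= j)%O}.
Proof.
move=> c0 i j ij; rewrite subsetEset => t /=; rewrite !in_itv /= !andbT; apply: le_trans.
by rewrite ler_pM2l// lef_pV2 ?posrE// ler_nat.
Qed.

Lemma integral_posray_lim (c : R) (f : R -> R) : 0 < c -> (forall t, 0 <= f t) ->
  measurable_fun setT f ->
  (\int[mu]_(t in `[(c / i.+1%:R)%R, +oo[) (f t)%:E)%E @[i --> \oo] -->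
  (\int[mu]_(t in posray) (f t)%:E)%E.
Proof.
move=> c0 f0 mf; rewrite -(bigcup_rays c0).
apply: ge0_nondecreasing_set_cvg_integral.
- exact: rays_nondecreasing.
- by move=> i; exact: measurable_itv.
- by move=> i; apply/measurable_EFinP; exact: measurable_funTS.
- by move=> i x _; rewrite lee_fin.
Qed.

Lemma itv0_posray (x : R) : `]0, x]%classic = posray `&` `]-oo, x].
Proof.
by apply/seteqP; split=> t /=; rewrite posrayE !in_itv /=; [case/andP|case=> -> ->].
Qed.

End PositiveRay.

Section DensityLaplace.
Context {R : realType}.
Notation mu := (@lebesgue_measure R).
Variable h : R -> R.

Definition density_mass : R := \int[mu]_(t in posray) h t.
Definition density_cdf (x : R) : R := (\int[mu]_(t in `]0, x]) h t) / density_mass.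
Definition density_laplace (k : nat) : R :=
  (\int[mu]_(t in posray) (h t * expR (- (k%:R * t)))) / density_mass.
Definition density_moment (p : {poly R}) : R :=
  (\int[mu]_(t in posray) (h t * p.[expR (- t)])) / density_mass.

Hypothesis h_ge0 : forall t, 0 <= h t.
Hypothesis h_integrable : mu.-integrable posray (EFin \o h).
Hypothesis mass_gt0 : 0 < density_mass.

Let mass_neq0 : density_mass != 0. Proof. by rewrite gt_eqF. Qed.

Lemma integrable_density_exp (k : nat) :
  mu.-integrable posray (EFin \o (fun t : R => h t * expR (- (k%:R * t)))).
Proof.
apply: le_integrable h_integrable; first exact: measurable_posray.
  apply/measurable_EFinP; apply: measurable_funM.
    by apply/measurable_EFinP; exact: measurable_int h_integrable.
  apply: measurable_funTS; apply: measurableT_comp => //.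
  exact: measurableT_comp.
move=> t; rewrite posrayE => t0 /=; rewrite lee_fin normrM ler_piMr// ger0_norm ?expR_ge0//.
by rewrite expR_le1 oppr_le0 mulr_ge0// ltW.
Qed.

Lemma density_exp_sum (N : nat) (c : nat -> R) :
  mu.-integrable posray (EFin \o (fun t : R => \sum_(0 <= i < N) c i * (h t * expR (- (i%:R * t)))))
  /\ \int[mu]_(t in posray) (\sum_(0 <= i < N) c i * (h t * expR (- (i%:R * t)))) =
    density_mass * \sum_(0 <= i < N) c i * density_laplace i.
Proof.
elim: N => [|N [IHint IHval]].
  split; last first.
    under eq_Rintegral do rewrite big_nil.
    rewrite Rintegral_cst ?mul0r ?big_nil ?mulr0//; exact: measurable_posray.
  rewrite (_ : EFin \o _ = cst 0%E); first exact: integrable0.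
  by apply/funext => t /=; rewrite big_nil.
have termN : mu.-integrable posray (EFin \o (fun t : R => c N * (h t * expR (- (N%:R * t))))).
  by apply: (integrableZl _ (c N) (integrable_density_exp N)); exact: measurable_posray.
rewrite (_ : (fun t : R => \sum_(0 <= i < N.+1) _) =
  (fun t : R => \sum_(0 <= i < N) c i * (h t * expR (- (i%:R * t))) +
    c N * (h t * expR (- (N%:R * t))))); last by apply/funext => t; rewrite big_nat_recr.
split; first by apply: (integrableD _ IHint termN); exact: measurable_posray.
rewrite (RintegralD _ IHint termN); last exact: measurable_posray.
rewrite IHval big_nat_recr//= mulrDr; congr (_ + _).
rewrite (RintegralZl _ _ (integrable_density_exp N)); last exact: measurable_posray.
rewrite /density_laplace.
by field.
Qed.

Lemma density_poly_expand (p : {poly R}) (t : R) :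
  h t * p.[expR (- t)] = \sum_(0 <= i < size p) p`_i * (h t * expR (- (i%:R * t))).
Proof.
rewrite horner_coef big_mkord mulr_sumr; apply: eq_bigr => i _.
by rewrite -expRM_natl mulrN mulrCA.
Qed.

Lemma integrable_density_poly (p : {poly R}) :
  mu.-integrable posray (EFin \o (fun t : R => h t * p.[expR (- t)])).
Proof.
have [int _] := density_exp_sum (size p) (fun i => p`_i).
move: int; congr (mu.-integrable _ _).
by apply/funext => t /=; rewrite density_poly_expand.
Qed.

Lemma density_momentE (p : {poly R}) :
  density_moment p = \sum_(i < size p) p`_i * density_laplace i.
Proof.
rewrite -(big_mkord xpredT (fun i => p`_i * density_laplace i)).
have [_ val] := density_exp_sum (size p) (fun i => p`_i).
rewrite /density_moment; under eq_Rintegral do rewrite density_poly_expand.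
by rewrite val mulrC mulKf.
Qed.

Lemma integrable_density_cut (x : R) : mu.-integrable posray (EFin \o (h \_ `]-oo, x])).
Proof.
rewrite -restrict_EFin; apply/integrable_restrict => //; first exact: measurable_posray.
apply: integrableS h_integrable => //; first exact: measurable_posray.
exact: measurableI measurable_posray _.
Qed.

Lemma density_cutE (x t : R) : (h \_ `]-oo, x]) t = h t * (t <= x)%R%:R.
Proof.
rewrite patchE (_ : (t \in _) = (t <= x)); last by rewrite mem_setE in_itv.
by case: ifP => _; rewrite ?mulr1 ?mulr0.
Qed.

Lemma density_cdfE (x : R) :
  density_cdf x = (\int[mu]_(t in posray) (h \_ `]-oo, x]) t) / density_mass.
Proof. by rewrite /density_cdf itv0_posray Rintegral_mkcondr. Qed.

Lemma density_cdf_le_moment (p : {poly R}) (x : R) :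
  (forall t, 0 < t -> (t <= x)%R%:R <= p.[expR (- t)]) -> density_cdf x <= density_moment p.
Proof.
move=> px; rewrite density_cdfE ler_pM2r ?invr_gt0//; apply: le_Rintegral.
- exact: measurable_posray.
- exact: integrable_density_cut.
- exact: integrable_density_poly.
- by move=> t; rewrite posrayE => t0; rewrite density_cutE ler_wpM2l// px.
Qed.

Lemma density_moment_le_cdf (p : {poly R}) (x kappa : R) :
  (forall t, 0 < t -> p.[expR (- t)] <= (t <= x)%R%:R + kappa) ->
  density_moment p <= density_cdf x + kappa.
Proof.
move=> px; have kint : mu.-integrable posray (EFin \o (fun t => kappa * h t)).
  by apply: (integrableZl _ kappa h_integrable); exact: measurable_posray.
have -> : kappa = (\int[mu]_(t in posray) (kappa * h t)) / density_mass.
  by rewrite (RintegralZl _ _ h_integrable) ?mulfK//; exact: measurable_posray.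
rewrite density_cdfE -mulrDl ler_pM2r ?invr_gt0//.
rewrite -(RintegralD _ (integrable_density_cut x) kint); last exact: measurable_posray.
apply: le_Rintegral.
- exact: measurable_posray.
- exact: integrable_density_poly.
- by apply: (integrableD _ (integrable_density_cut x) kint); exact: measurable_posray.
- move=> t; rewrite posrayE => t0; rewrite density_cutE [kappa * _]mulrC -mulrDr.
  by rewrite ler_wpM2l// px.
Qed.

Lemma density_cdf_continuous : continuous density_cdf.
Proof.
move=> x; pose a := Num.min x 0 - 1.
have ax : a < x by rewrite ltrBlDr gt_min ltrDl ltr01.
have a0 : a <= 0 by rewrite lerBlDr ge_min [X in _ || X]ler_wpDr ?orbT.
have cut_int : mu.-integrable `[a, x + 1] (EFin \o (h \_ posray)).
  rewrite -restrict_EFin; apply/integrable_restrict => //; first exact: measurable_posray.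
  apply: integrableS h_integrable => //; first exact: measurable_posray.
  exact: measurableI _ measurable_posray.
have ax1 : a < x + 1 by rewrite (lt_trans ax)// ltrDl.
have /(continuous_within_itvP _ ax1)[interior _ _] :=
  parameterized_integral_continuous (ltW ax1) cut_int.
have -> : density_cdf = fun y => parameterized_integral mu a y (h \_ posray) / density_mass.
  apply/funext => y; rewrite /parameterized_integral -Rintegral_mkcondr; congr (_ / _).
  congr (Rintegral _ _ _); apply/seteqP; split=> t /=; rewrite posrayE !in_itv /=.
    by move=> /andP[t0 ->]; rewrite t0 (le_trans a0 (ltW t0)).
  by move=> [/andP[_ ->] ->].
apply: cvgM; last exact: cvg_cst.
by apply: interior; rewrite in_itv /= ax ltrDl ltr01.
Qed.

Lemma density_cdf_approx (x e : R) : 0 < e ->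
  exists2 d, 0 < d & forall y, `|y - x| <= d -> `|density_cdf x - density_cdf y| <= e.
Proof.
move=> e0; have /cvgrPdist_le/(_ _ e0) := @density_cdf_continuous x.
move=> [d /= d0 near_d]; exists (d / 2); first by rewrite divr_gt0.
move=> y yx; apply: near_d => /=; rewrite distrC (le_lt_trans yx)//.
by rewrite ltr_pdivrMr// ltr_pMr// ltr1n.
Qed.

End DensityLaplace.

Section LaplaceToCdf.
Context {R : realType}.

Lemma sum_le_shift (Om : finType) (P T Q : Om -> R) (y z : R) : (forall a, 0 <= P a) ->
  \sum_(a | T a <= y) P a <=
  \sum_(a | Q a <= z) P a + \sum_(a | z - y < `|T a - Q a|) P a.
Proof.
move=> P0; rewrite big_mkcond [X in X + _]big_mkcond [X in _ + X]big_mkcond -big_split /=.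
apply: ler_sum => a _; have Pa := P0 a.
case: (leP (T a) y) => Ty; case: (leP (Q a) z) => Qz; case: ltP => close;
  rewrite ?addr0 ?add0r ?lerDl//; try exact: addr_ge0.
have : Q a - T a <= z - y by apply: le_trans close; rewrite distrC ler_norm.
by lra.
Qed.

(* The indicator of [T <= x] is squeezed between polynomials in [expR (- T)], so the values of the
   Laplace transform at the natural numbers determine the limit law. *)
Section Convergence.
Variables (h : R -> R) (Om : nat -> finType) (P Q T : forall n, Om n -> R).
Hypothesis h_ge0 : forall t, 0 <= h t.
Hypothesis h_integrable : (@lebesgue_measure R).-integrable posray (EFin \o h).
Hypothesis mass_gt0 : 0 < density_mass h.
Hypothesis P_ge0 : forall n (a : Om n), 0 <= P a.
Hypothesis P_sum1 : forall n, \sum_(a : Om n) P a = 1.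
Hypothesis Q_ge0 : \forall n \near \oo, forall a : Om n, 0 <= Q a.
Hypothesis laplace_cvg : forall k : nat,
  (fun n => \sum_(a : Om n) P a * expR (- (k%:R * Q a))) @ \oo --> density_laplace h k.
Hypothesis close_cvg : forall eta : R, 0 < eta ->
  (fun n => \sum_(a : Om n | eta < `|T a - Q a|) P a) @ \oo --> (0 : R).

Lemma poly_moment_cvg (p : {poly R}) :
  (fun n => \sum_(a : Om n) P a * p.[expR (- Q a)]) @ \oo --> density_moment h p.
Proof.
rewrite density_momentE//.
have -> : (fun n => \sum_(a : Om n) P a * p.[expR (- Q a)]) =
    (fun n => \sum_(i < size p) p`_i * \sum_(a : Om n) P a * expR (- (i%:R * Q a))).
  apply/funext => n; under [RHS]eq_bigr do rewrite mulr_sumr.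
  rewrite exchange_big; apply: eq_bigr => a _.
  rewrite horner_coef mulr_sumr; apply: eq_bigr => i _.
  by rewrite -expRM_natl mulrN mulrCA.
apply: (cvg_big add_continuous) => i _.
by apply: cvgM; [exact: cvg_cst|exact: laplace_cvg].
Qed.

Lemma cdf_cvg_upper (x e : R) : 0 < e ->
  \forall n \near \oo, \sum_(a : Om n | T a <= x) P a <= density_cdf h x + e.
Proof.
move=> e0; have e4 : 0 < e / 4 by rewrite divr_gt0.
have [d d0 cdf_d] := density_cdf_approx h_integrable x e4.
have zd : x + d / 2 < x + d by rewrite ltrD2l ltr_pdivrMr// ltr_pMr// ltr1n.
have [p step_p] := poly_step_approx zd e4.
have d2 : 0 < x + d / 2 - x by rewrite addrAC subrr add0r divr_gt0.
have /cvgrPdist_le/(_ _ e4) := @poly_moment_cvg p.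
have /cvgrPdist_le/(_ _ e4) := close_cvg d2.
have moment_le : density_moment h p <= density_cdf h (x + d) + e / 4.
  by apply: density_moment_le_cdf => // t t0; have /andP[_] := step_p t (ltW t0).
have cdf_le : density_cdf h (x + d) <= density_cdf h x + e / 4.
  have := cdf_d (x + d); rewrite addrAC subrr add0r gtr0_norm// => /(_ (lexx _)).
  by rewrite ler_norml => /andP[]; lra.
apply: filterS3 Q_ge0 => n Qn; rewrite sub0r normrN !ler_norml => /andP[_ close] /andP[moment _].
have := sum_le_shift (@T n) (@Q n) x (x + d / 2) (@P_ge0 n).
have : \sum_(a : Om n | Q a <= x + d / 2) P a <= \sum_(a : Om n) P a * p.[expR (- Q a)].
  rewrite [leLHS]big_mkcond; apply: ler_sum => a _; have /andP[step _] := step_p _ (Qn a).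
  by have := ler_wpM2l (P_ge0 a) step; case: ifP => _; rewrite ?mulr1 ?mulr0.
lra.
Qed.

Lemma cdf_cvg_lower (x e : R) : 0 < e ->
  \forall n \near \oo, density_cdf h x - e <= \sum_(a : Om n | T a <= x) P a.
Proof.
move=> e0; have e4 : 0 < e / 4 by rewrite divr_gt0.
have [d d0 cdf_d] := density_cdf_approx h_integrable x e4.
have zd : x - d < x - d / 2 by rewrite ltrD2l ltrN2 ltr_pdivrMr// ltr_pMr// ltr1n.
have [p step_p] := poly_step_approx zd e4.
have d2 : 0 < x - (x - d / 2) by rewrite opprB addrC subrK divr_gt0.
have /cvgrPdist_le/(_ _ e4) := @poly_moment_cvg p.
have /cvgrPdist_le/(_ _ e4) := close_cvg d2.
have moment_ge : density_cdf h (x - d) <= density_moment h p.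
  by apply: density_cdf_le_moment => // t t0; have /andP[] := step_p t (ltW t0).
have cdf_ge : density_cdf h x - e / 4 <= density_cdf h (x - d).
  have := cdf_d (x - d); rewrite addrAC subrr add0r normrN gtr0_norm// => /(_ (lexx _)).
  by rewrite ler_norml => /andP[]; lra.
apply: filterS3 Q_ge0 => n Qn; rewrite sub0r normrN !ler_norml => /andP[_ close] /andP[_ moment].
have := sum_le_shift (@Q n) (@T n) (x - d / 2) x (@P_ge0 n).
under [X in _ <= _ + X -> _]eq_bigl do rewrite distrC.
have : \sum_(a : Om n) P a * p.[expR (- Q a)] <= \sum_(a : Om n | Q a <= x - d / 2) P a + e / 4.
  have -> : e / 4 = \sum_(a : Om n) P a * (e / 4) by rewrite -mulr_suml P_sum1 mul1r.
  rewrite [X in _ <= X + _]big_mkcond -big_split /=.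
  apply: ler_sum => a _; have /andP[_ step] := step_p _ (Qn a).
  by have := ler_wpM2l (P_ge0 a) step; rewrite mulrDr; case: ifP => _; rewrite ?mulr1 ?mulr0.
lra.
Qed.

Lemma cdf_cvg_of_laplace (x : R) :
  (fun n => \sum_(a : Om n | T a <= x) P a) @ \oo --> density_cdf h x.
Proof.
apply/cvgrPdist_le => e e0.
apply: filterS2 (cdf_cvg_upper x e0) (cdf_cvg_lower x e0) => n upper lower.
by rewrite ler_norml; lra.
Qed.

End Convergence.

End LaplaceToCdf.

Section ChiSquare.
Context {R : realType}.
Notation mu := (@lebesgue_measure R).
Implicit Types (m : nat) (t c : R).

Lemma chisq_kernel_ge0 m t : 0 <= chisq_kernel m t.
Proof. by rewrite mulr_ge0 ?powR_ge0 ?expR_ge0. Qed.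

Lemma measurable_chisq_kernel m : measurable_fun setT (chisq_kernel m : R -> R).
Proof.
apply: measurable_funM; first exact: measurable_powR.
by apply: measurableT_comp => //; apply: measurable_funM.
Qed.

Lemma chisq_kernel_continuous m t : 0 < t -> {for t, continuous (chisq_kernel m : R -> R)}.
Proof.
move=> t0; apply: (@continuousM _ _ (fun x : R => x `^ (m%:R / 2 - 1)) (fun x => expR (- x / 2))).
  exact: is_derive_continuous (is_derive1_powR (m%:R / 2 - 1) t0).
apply: (@continuous_comp _ _ _ (fun x : R => - x / 2) expR); last exact: continuous_expR.
apply: (@continuousM _ _ (fun x : R => - x) (cst 2^-1)); first exact: continuousN.
exact: cst_continuous.
Qed.

Lemma chisq_kernel_sqrt m t : 0 < t ->
  chisq_kernel m.+1 t = Num.sqrt t ^+ m / Num.sqrt t * expR (- t / 2).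
Proof.
move=> t0; rewrite /chisq_kernel; congr (_ * _).
have -> : m.+1%:R / 2 - 1 = 2^-1 * m%:R + - 2^-1 :> R by rewrite -natr1; field.
rewrite powRD; last by apply/implyP => _; rewrite gt_eqF.
by rewrite powRrM powRN powR12_sqrt ?(ltW t0)// powR_mulrn ?sqrtr_ge0.
Qed.

Lemma exprn_le_fact_expR m (u : R) : 0 <= u -> u ^+ m <= m`!%:R * expR u.
Proof.
move=> u0; case: m => [|m]; first by rewrite expr0 mul1r; have := expR_ge1Dx u; lra.
rewrite mulrC -ler_pdivrMr ?ltr0n ?fact_gt0//; have := expR_ge1Dxn m u0; lra.
Qed.

(* The derivative of - exp(- sqrt t): an integrable majorant coping with the singularity at 0. *)
Definition sqrt_exp t : R := expR (- Num.sqrt t) / (2 * Num.sqrt t).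

Lemma sqrt_exp_ge0 t : 0 <= sqrt_exp t.
Proof. by rewrite divr_ge0 ?expR_ge0// mulr_ge0// sqrtr_ge0. Qed.

Lemma chisq_kernel_le m t : 0 < t ->
  chisq_kernel m.+1 t <= 2 * m`!%:R * expR 2 * sqrt_exp t.
Proof.
move=> t0; rewrite chisq_kernel_sqrt// /sqrt_exp.
have s0 : 0 < Num.sqrt t by rewrite sqrtr_gt0.
have tE : t = Num.sqrt t ^+ 2 by rewrite sqr_sqrtr// ltW.
rewrite {3}tE; move: (Num.sqrt t) s0 => u u0.
have -> : 2 * m`!%:R * expR 2 * (expR (- u) / (2 * u)) = m`!%:R * (expR 2 * expR (- u)) / u.
  by field; rewrite gt_eqF.
rewrite mulrAC ler_pM2r ?invr_gt0//.
apply: (@le_trans _ _ (m`!%:R * expR u * expR (- u ^+ 2 / 2))).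
  by rewrite ler_wpM2r ?expR_ge0// exprn_le_fact_expR// ltW.
rewrite -mulrA ler_wpM2l// -!expRD ler_expR.
by have := sqr_ge0 (u - 2); rewrite sqrrB; lra.
Qed.

Lemma is_derive_sqrt_exp t : 0 < t ->
  is_derive t 1 (fun x : R => - expR (- Num.sqrt x)) (sqrt_exp t).
Proof.
move=> t0; have dsqrt := is_deriveN (is_derive1_sqrt t0).
have dexp := is_derive1_comp (g := fun x : R => - Num.sqrt x) (is_derive_expR (- Num.sqrt t)) dsqrt.
have -> : sqrt_exp t = - (expR (- Num.sqrt t) * - (2 * Num.sqrt t)^-1).
  by rewrite /sqrt_exp mulrN opprK.
exact: is_deriveN.
Qed.

Lemma sqrt_exp_continuous t : 0 < t -> {for t, continuous sqrt_exp}.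
Proof.
move=> t0; have s0 : 0 < Num.sqrt t by rewrite sqrtr_gt0.
have cs : {for t, continuous (fun x : R => Num.sqrt x)} by exact: sqrt_continuous.
apply: (@continuousM _ _ (fun x : R => expR (- Num.sqrt x)) (fun x => (2 * Num.sqrt x)^-1)).
  apply: (@continuous_comp _ _ _ (fun x : R => - Num.sqrt x) expR); first exact: continuousN.
  exact: continuous_expR.
apply: (@continuousV _ _ (fun x : R => 2 * Num.sqrt x)); first by rewrite gt_eqF// mulr_gt0.
by apply: (@continuousM _ _ (cst 2) (fun x : R => Num.sqrt x)) => //; exact: cst_continuous.
Qed.

Lemma sqrt_exp_antiderivative_cvg :
  (fun x : R => - expR (- Num.sqrt x)) x @[x --> +oo] --> (0 : R).
Proof.
apply/cvgrPdist_le => eps eps0; near=> x.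
rewrite sub0r opprK ger0_norm ?expR_ge0// expRN.
have x0 : 0 <= x by near: x; exact: nbhs_pinfty_ge.
have xe : eps ^- 2 <= x by near: x; apply: nbhs_pinfty_ge; rewrite num_real.
have se : eps^-1 <= Num.sqrt x.
  rewrite -(@ler_pXn2r _ 2) ?nnegrE ?sqrtr_ge0 ?invr_ge0 ?(ltW eps0)//.
  by rewrite sqr_sqrtr// exprVn.
rewrite -[eps]invrK lef_pV2 ?posrE ?expR_gt0 ?invr_gt0//.
have := expR_ge1Dx (Num.sqrt x); lra.
Unshelve. all: by end_near. Qed.

Lemma integral_sqrt_exp_ray (a : R) : 0 < a ->
  (\int[mu]_(t in `[a, +oo[) (sqrt_exp t)%:E)%E = (expR (- Num.sqrt a))%:E.
Proof.
move=> a0; rewrite (@ge0_continuous_FTC2y R sqrt_exp (fun x : R => - expR (- Num.sqrt x)) a 0).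
- by rewrite sub0e -EFinN opprK.
- by move=> x ax; exact: sqrt_exp_ge0.
- apply: continuous_in_subspaceT => x; rewrite inE /= in_itv /= andbT => ax.
  exact: sqrt_exp_continuous (lt_le_trans a0 ax).
- exact: sqrt_exp_antiderivative_cvg.
- by move=> x ax; have dx := is_derive_sqrt_exp (lt_trans a0 ax); exact: ex_derive.
- exact: cvg_at_right_filter (is_derive_continuous (is_derive_sqrt_exp a0)).
- move=> x; rewrite in_itv /= andbT => ax; have dx := is_derive_sqrt_exp (lt_trans a0 ax).
  by rewrite derive1E; exact: derive_val.
Qed.

Lemma integral_chisq_kernel_ray_le m (a : R) : 0 < a ->
  (\int[mu]_(t in `[a, +oo[) (chisq_kernel m.+1 t)%:E <= (2 * m`!%:R * expR 2)%:E)%E.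
Proof.
move=> a0; set bound := 2 * _ * _; have bound0 : 0 <= bound by rewrite !mulr_ge0 ?expR_ge0.
have ms : measurable_fun `[a, +oo[ sqrt_exp.
  apply: subspace_continuous_measurable_fun; first exact: measurable_itv.
  apply: continuous_in_subspaceT => x; rewrite inE /= in_itv /= andbT => ax.
  exact: sqrt_exp_continuous (lt_le_trans a0 ax).
apply: (@le_trans _ _ (\int[mu]_(t in `[a, +oo[) (bound%:E * (sqrt_exp t)%:E))%E).
  apply: ge0_le_integral.
  - exact: measurable_itv.
  - by move=> x _; rewrite lee_fin chisq_kernel_ge0.
  - by apply/measurable_EFinP/measurable_funTS; exact: measurable_chisq_kernel.
  - by apply: emeasurable_funM; apply/measurable_EFinP => //; exact: measurable_cst.
  - move=> x; rewrite /= in_itv /= andbT => ax; rewrite -EFinM lee_fin.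
    exact: chisq_kernel_le (lt_le_trans a0 ax).
rewrite ge0_integralZl.
- rewrite integral_sqrt_exp_ray// -EFinM lee_fin.
  by rewrite ler_piMr// expR_le1 oppr_le0 sqrtr_ge0.
- exact: measurable_itv.
- exact/measurable_EFinP.
- by move=> x _; rewrite lee_fin sqrt_exp_ge0.
- by rewrite lee_fin.
Qed.

Lemma integrable_chisq_kernel m : mu.-integrable posray (EFin \o (chisq_kernel m.+1 : R -> R)).
Proof.
apply/integrableP; split.
  by apply/measurable_EFinP/measurable_funTS; exact: measurable_chisq_kernel.
suff : (\int[mu]_(t in posray) (chisq_kernel m.+1 t)%:E < +oo)%E.
  congr (_ < _)%E; apply: eq_integral => t _ /=.
  by rewrite ger0_norm// chisq_kernel_ge0.
apply: (@le_lt_trans _ _ (2 * m`!%:R * expR 2)%:E); last exact: ltry.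
apply: cvge_le (integral_posray_lim ltr01 (chisq_kernel_ge0 _) (@measurable_chisq_kernel _)).
by apply: nearW => i; apply: integral_chisq_kernel_ray_le; rewrite divr_gt0.
Qed.

Lemma chisq_kernel_ge m t : 1 <= t <= 2 -> expR (- 1) / 2 <= chisq_kernel m.+1 t.
Proof.
move=> /andP[t1 t2]; have t0 : 0 < t by lra.
rewrite /chisq_kernel mulrC; apply: ler_pM; rewrite ?expR_ge0//; last by rewrite ler_expR; lra.
apply: (@le_trans _ _ (t `^ (-1))); first by rewrite powR_inv1 ?(ltW t0)// lef_pV2 ?posrE.
by apply: ler_powR => //; rewrite lerDr divr_ge0.
Qed.

Lemma chisq_mass_gt0 m : 0 < density_mass (chisq_kernel m.+1 : R -> R).
Proof.
have sub : (`[1, 2]%classic : set R) `<=` posray.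
  by move=> t /=; rewrite posrayE in_itv /= => /andP[t1 _]; lra.
have int12 : mu.-integrable `[1, 2] (EFin \o (chisq_kernel m.+1 : R -> R)).
  by apply: integrableS (integrable_chisq_kernel m) => //; exact: measurable_posray.
apply: (@lt_le_trans _ _ (expR (- 1) / 2)); first by rewrite divr_gt0 ?expR_gt0.
apply: (@le_trans _ _ (\int[mu]_(t in `[1, 2]) chisq_kernel m.+1 t)).
  have -> : expR (-1) / 2 = \int[mu]_(t in `[1, 2]) (expR (- 1) / 2) :> R.
    by rewrite Rintegral_cst//= lebesgue_measure_itv /= lte_fin ltr1n /=; ring.
  apply: le_Rintegral => // [|t]; last by rewrite /= in_itv; exact: chisq_kernel_ge.
  apply: continuous_compact_integrable; first exact: segment_compact.
  by apply: continuous_subspaceT => x; exact: cvg_cst.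
rewrite /density_mass /Rintegral; apply: fine_le.
- exact: integrable_fin_num int12.
- by apply: integrable_fin_num (integrable_chisq_kernel m); exact: measurable_posray.
- apply: ge0_subset_integral => //; first exact: measurable_posray.
  + by apply/measurable_EFinP/measurable_funTS; exact: measurable_chisq_kernel.
  + by move=> t _; rewrite lee_fin chisq_kernel_ge0.
Qed.

Lemma chisq_kernel_scale m c t : 0 < c -> 0 < t ->
  chisq_kernel m (c * t) * c = c `^ (m%:R / 2) * (chisq_kernel m t * expR (- ((c - 1) / 2 * t))).
Proof.
move=> c0 t0; rewrite /chisq_kernel powRM ?(ltW c0) ?(ltW t0)//.
have -> : - (c * t) / 2 = - t / 2 + - ((c - 1) / 2 * t) by field.
rewrite expRD; have -> : c `^ (m%:R / 2) = c `^ (m%:R / 2 - 1) * c.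
  rewrite -{3}[c]powRr1 ?(ltW c0)// -powRD; last by apply/implyP => _; rewrite gt_eqF.
  by congr (_ `^ _); ring.
by ring.
Qed.

Lemma integral_chisq_ray_scale m c (a : R) : 0 < c -> 0 < a ->
  (\int[mu]_(t in `[(c * a)%R, +oo[) (chisq_kernel m t)%:E =
   \int[mu]_(t in `[a, +oo[)
     (c `^ (m%:R / 2) * (chisq_kernel m t * expR (- ((c - 1) / 2 * t))))%:E)%E.
Proof.
move=> c0 a0; have dF (x : R) : is_derive x 1 (fun x : R => c * x) c.
  by apply: is_derive_eq; rewrite /GRing.scale /= mulr1 ?mulr0 ?addr0.
have F' : (fun x : R => c * x)^`()%classic = cst c.
  by apply/funext => x; rewrite derive1E; have := dF x => dx; exact: derive_val.
rewrite (@increasing_ge0_integration_by_substitutiony R (fun x => c * x) (chisq_kernel m) a).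
- apply: eq_integral => x; rewrite inE /= in_itv /= andbT => ax.
  by rewrite F' -chisq_kernel_scale// (lt_le_trans a0 ax).
- by move=> x y _ _ xy; rewrite ltr_pM2l.
- by move=> x _; rewrite F'; exact: cst_continuous.
- by rewrite F'; apply/cvg_ex; exists c; exact: cvg_cst.
- by rewrite F'; apply/cvg_ex; exists c; exact: cvg_cst.
- split=> [x _|]; first by have dx := dF x; exact: ex_derive.
  exact: cvg_at_right_filter (is_derive_continuous (dF a)).
- by apply: gt0_cvgMry => //; exact: cvg_id.
- apply: continuous_in_subspaceT => x; rewrite inE /= in_itv /= andbT => ax.
  by apply: chisq_kernel_continuous; apply: lt_le_trans ax; rewrite mulr_gt0.
- by move=> x _; exact: chisq_kernel_ge0.
Qed.

Lemma integral_chisq_scale m c : 0 < c ->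
  (\int[mu]_(t in posray) (chisq_kernel m t)%:E = (c `^ (m%:R / 2))%:E *
     \int[mu]_(t in posray) (chisq_kernel m t * expR (- ((c - 1) / 2 * t)))%:E)%E.
Proof.
move=> c0; have exp_ge0 t : 0 <= chisq_kernel m t * expR (- ((c - 1) / 2 * t)) :> R.
  by rewrite mulr_ge0 ?chisq_kernel_ge0 ?expR_ge0.
have measurable_exp : measurable_fun setT
    (fun t : R => chisq_kernel m t * expR (- ((c - 1) / 2 * t))).
  apply: measurable_funM; first exact: measurable_chisq_kernel.
  by apply: measurableT_comp => //; apply: measurableT_comp.
rewrite -ge0_integralZl//; last 4 first.
- exact: measurable_posray.
- by apply/measurable_EFinP/measurable_funTS.
- by move=> t _; rewrite lee_fin.
- by rewrite lee_fin powR_ge0.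
have lim_lhs := integral_posray_lim c0 (chisq_kernel_ge0 m) (@measurable_chisq_kernel m).
have lim_rhs := integral_posray_lim (f := fun t =>
  c `^ (m%:R / 2) * (chisq_kernel m t * expR (- ((c - 1) / 2 * t)))) ltr01
  (fun t => mulr_ge0 (powR_ge0 _ _) (exp_ge0 t))
  (measurable_funM (measurable_cst _) measurable_exp).
rewrite -(cvg_lim _ lim_lhs)// -(cvg_lim _ lim_rhs)//.
apply: (congr1 (fun u : nat -> \bar R => limn u)); apply/funext => i.
have -> : c / i.+1%:R = c * (1 / i.+1%:R) by rewrite mul1r.
by rewrite integral_chisq_ray_scale ?divr_gt0.
Qed.

Lemma density_laplace_chisq m (k : nat) :
  density_laplace (chisq_kernel m.+1) k = (1 + 2 * k%:R) `^ (- (m.+1%:R / 2)) :> R.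
Proof.
have c0 : 0 < 1 + 2 * k%:R :> R by rewrite ltr_pwDl// mulr_ge0.
have mass0 := chisq_mass_gt0 m.
have cE : (1 + 2 * k%:R - 1) / 2 = k%:R :> R by field.
have massE : density_mass (chisq_kernel m.+1 : R -> R) = (1 + 2 * k%:R) `^ (m.+1%:R / 2) *
    \int[mu]_(t in posray) (chisq_kernel m.+1 t * expR (- (k%:R * t))).
  rewrite /density_mass /Rintegral (integral_chisq_scale m.+1 c0) cE fineM//.
  apply: integrable_fin_num (integrable_density_exp (integrable_chisq_kernel m) k).
  exact: measurable_posray.
rewrite /density_laplace powRN; apply: (mulIf (lt0r_neq0 mass0)).
by rewrite divfK ?gt_eqF// massE mulKf// gt_eqF// powR_gt0.
Qed.

End ChiSquare.

Section PairSums.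
Context {R : realType} {n : nat}.

Lemma sum_neq_ordered_pairs (F : 'I_n -> 'I_n -> R) :
  \sum_i \sum_(j | j != i) F i j = \sum_(i < n) \sum_(j < n | (i < j)%N) (F i j + F j i).
Proof.
have -> : \sum_(i < n) \sum_(j < n | (i < j)%N) (F i j + F j i) =
    \sum_(i < n) \sum_(j < n | (i < j)%N) F i j + \sum_(i < n) \sum_(j < n | (j < i)%N) F i j.
  rewrite [X in _ + X](exchange_big_dep xpredT)//= -big_split /=; apply: eq_bigr => i _.
  by rewrite -big_split.
rewrite -big_split /=; apply: eq_bigr => i _.
rewrite (bigID (fun j : 'I_n => (i < j)%N)) /=; congr (_ + _); apply: eq_bigl => j.
  by rewrite neq_ltn; case: ltngtP.
by rewrite neq_ltn; case: ltngtP.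
Qed.

Lemma sum_sqr_diff_le (c : 'I_n -> R) :
  \sum_(p : 'I_n * 'I_n) (c p.1 - c p.2) ^+ 2 <= 4 * n%:R * \sum_i c i ^+ 2.
Proof.
rewrite -(pair_bigA _ (fun i j => (c i - c j) ^+ 2)) /=.
apply: (@le_trans _ _ (\sum_i \sum_j (2 * c i ^+ 2 + 2 * c j ^+ 2))).
  apply: ler_sum => i _; apply: ler_sum => j _.
  by have := sqr_ge0 (c i + c j); rewrite sqrrD sqrrB; lra.
have row_sum i : \sum_j (2 * c i ^+ 2 + 2 * c j ^+ 2) =
    2 * n%:R * c i ^+ 2 + 2 * \sum_j c j ^+ 2.
  by rewrite big_split /= sumr_const card_ord -[_ *+ n]mulr_natl -mulr_sumr; ring.
rewrite (eq_bigr _ (fun i _ => row_sum i)) big_split /= sumr_const card_ord -[_ *+ n]mulr_natl.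
by rewrite -mulr_sumr; lra.
Qed.

End PairSums.

Section Model.
Context {R : realType} {n K : nat}.
Variables (k : 'I_n -> 'I_n -> nat) (beta : 'I_n -> R).
Hypothesis k_sym : forall i j, k i j = k j i.
Hypothesis k_bnd : forall i j, i != j -> (1 <= k i j <= K)%N.
Implicit Types (a : outcome n K) (p : 'I_n * 'I_n).

Definition bt_pmf p (x : 'I_K.+1) : R :=
  if (p.1 < p.2)%N then
    'C(k p.1 p.2, x)%:R * btp (beta p.1) (beta p.2) ^+ x
      * (1 - btp (beta p.1) (beta p.2)) ^+ (k p.1 p.2 - x)
  else (nat_of_ord x == 0%N)%:R.

Lemma comparisons_le (i j : 'I_n) : (i < j)%N -> (k i j <= K)%N.
Proof. by move=> ij; have /k_bnd/andP[] : i != j by rewrite neq_ltn ij. Qed.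

Lemma bt_pmf_ge0 p x : 0 <= bt_pmf p x.
Proof.
rewrite /bt_pmf; case: ifP => // _.
have p0 : 0 < btp (beta p.1) (beta p.2) := logistic_gt0 _.
have p1 : btp (beta p.1) (beta p.2) < 1 := logistic_lt1 _.
by rewrite !mulr_ge0 ?exprn_ge0 ?subr_ge0 ?(ltW p0) ?(ltW p1).
Qed.

Lemma bt_pmf_mean p (f : nat -> R) : (p.1 < p.2)%N ->
  \sum_x bt_pmf p x * f x = binomial_mean (k p.1 p.2) (logistic (beta p.1 - beta p.2)) f.
Proof.
move=> lt12; rewrite -(binomial_mean_widen _ _ (comparisons_le lt12)).
by apply: eq_bigr => x _; rewrite /bt_pmf lt12.
Qed.

Lemma bt_pmf_sum1 p : \sum_x bt_pmf p x = 1.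
Proof.
have [lt12|ge12] := boolP (p.1 < p.2)%N.
  have := bt_pmf_mean (fun=> 1) lt12; rewrite binomial_mean_cst => <-.
  by apply: eq_bigr => x _; rewrite mulr1.
rewrite (bigD1 ord0)//= /bt_pmf (negbTE ge12) eqxx big1 ?addr0// => x.
by rewrite -val_eqE /= => /negbTE ->.
Qed.

Lemma bt_probE a : bt_prob k beta a = prod_pmf bt_pmf a.
Proof.
have prodE : prod_pmf bt_pmf a = \prod_(i < n) \prod_(j < n) bt_pmf (i, j) (a (i, j)).
  by rewrite /prod_pmf pair_big; apply: eq_bigr => -[i j] _.
rewrite /bt_prob prodE; case: ifPn => [valid|].
  apply: eq_bigr => i _; rewrite [RHS](bigID (fun j : 'I_n => (i < j)%N)) /=.
  rewrite [X in _ * X]big1 ?mulr1 => [|j /negbTE nij].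
    by apply: eq_bigr => j ij; rewrite /bt_pmf /= ij.
  by move: valid; rewrite /bt_pmf /= nij => /forallP/(_ i)/forallP/(_ j); rewrite nij => ->.
move=> /forallPn[i /forallPn[j invalid]].
rewrite (bigD1 i)//= (bigD1 j)//=; suff -> : bt_pmf (i, j) (a (i, j)) = 0 by rewrite !mul0r.
move: invalid; rewrite /bt_pmf /=; case: ifP => _; last by move/negbTE => ->.
by rewrite -ltnNge => ka; rewrite bin_small// !mul0r.
Qed.

Lemma prod_pmf_valid a : prod_pmf bt_pmf a != 0 -> valid_outcome k a.
Proof. by rewrite -bt_probE /bt_prob; case: ifP => //; rewrite eqxx. Qed.

Definition weight (i j : 'I_n) : R := if i == j then 0 else (k i j)%:R.

Lemma weightC i j : weight i j = weight j i.
Proof. by rewrite /weight eq_sym k_sym. Qed.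

Lemma weight_nneg i j : 0 <= weight i j.
Proof. by rewrite /weight; case: ifP. Qed.

Lemma weight_ge1 i j : i != j -> 1 <= weight i j.
Proof. by move=> ij; rewrite /weight (negbTE ij) ler1n; case/andP: (k_bnd ij). Qed.

Lemma weight_leK i j : weight i j <= K%:R.
Proof.
by rewrite /weight; case: eqVneq => // ij; rewrite ler_nat; case/andP: (k_bnd ij).
Qed.

Lemma sum_weight (i : 'I_n) (F : 'I_n -> R) :
  \sum_j weight i j * F j = \sum_(j | j != i) (k i j)%:R * F j.
Proof.
rewrite [RHS]big_mkcond; apply: eq_bigr => j _; rewrite /weight eq_sym.
by case: ifP => _ //=; rewrite mul0r.
Qed.

(* The score [dscore] minus half the number of comparisons, to match the even [log_cosh]. *)
Definition excess a (i : 'I_n) : R := (dscore k a i)%:R - 1 / 2 * \sum_j weight i j * 1.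

Lemma ln_expD (x y : R) : ln (expR x + expR y) = (x + y) / 2 + log_cosh (x - y).
Proof.
have -> : expR x + expR y = expR y * (1 + expR (x - y)).
  by rewrite mulrDr mulr1 -expRD subrKC addrC.
by rewrite lnM ?posrE ?expR_gt0 ?expR1D_gt0// expRK /log_cosh; field.
Qed.

Lemma sum_ln_expD (g : 'I_n -> R) :
  \sum_i \sum_j weight i j * ln (expR (g i) + expR (g j)) =
  \sum_i \sum_j weight i j * g i + \sum_i \sum_j weight i j * log_cosh (g i - g j).
Proof.
have swap : \sum_i \sum_j weight i j * (g j / 2) = \sum_i \sum_j weight i j * (g i / 2).
  by rewrite exchange_big; apply: eq_bigr => i _; apply: eq_bigr => j _; rewrite weightC.
transitivity (\sum_i \sum_j weight i j * (g i / 2) + \sum_i \sum_j weight i j * (g j / 2)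
    + \sum_i \sum_j weight i j * log_cosh (g i - g j)).
  rewrite -!big_split /=; apply: eq_bigr => i _; rewrite -!big_split /=; apply: eq_bigr => j _.
  by rewrite ln_expD; field.
congr (_ + _); rewrite swap -big_split /=; apply: eq_bigr => i _.
by rewrite -big_split /=; apply: eq_bigr => j _; field.
Qed.

Lemma ell_btE a (g : 'I_n -> R) : ell_bt k a g = loglik weight (excess a) g.
Proof.
have -> : ell_bt k a g = \sum_i g i * (dscore k a i)%:R
    - 1 / 2 * \sum_i \sum_j weight i j * ln (expR (g i) + expR (g j)).
  rewrite /ell_bt; congr (_ - _); under [in RHS]eq_bigr do rewrite sum_weight.
  rewrite sum_neq_ordered_pairs mulr_sumr; apply: eq_bigr => i _; rewrite mulr_sumr.
  by apply: eq_bigr => j _; rewrite (k_sym j i) [expR (g j) + _]addrC; field.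
rewrite sum_ln_expD /loglik mulrDr opprD addrA; congr (_ - _).
rewrite mulr_sumr -sumrB; apply: eq_bigr => i _; rewrite /excess mulrBl mulrC; congr (_ - _).
by rewrite -[RHS]mulrA mulr_suml; congr (_ * _); apply: eq_bigr => j _; rewrite mulr1.
Qed.

Definition win_noise a (i j : 'I_n) : R :=
  (aij k a i j)%:R - (k i j)%:R * logistic (beta i - beta j).

Definition pair_noise p (x : 'I_K.+1) : R :=
  if (p.1 < p.2)%N then (nat_of_ord x)%:R - (k p.1 p.2)%:R * logistic (beta p.1 - beta p.2) else 0.

Lemma win_noise_lt a (i j : 'I_n) : (i < j)%N -> win_noise a i j = pair_noise (i, j) (a (i, j)).
Proof. by move=> ij; rewrite /win_noise /pair_noise /aij /= ij. Qed.

Lemma valid_outcome_lt a (i j : 'I_n) : valid_outcome k a -> (i < j)%N -> (a (i, j) <= k i j)%N.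
Proof. by move=> /forallP/(_ i)/forallP/(_ j) + ij; rewrite ij. Qed.

Lemma win_noise_gt a (i j : 'I_n) : valid_outcome k a -> (j < i)%N ->
  win_noise a i j = - pair_noise (j, i) (a (j, i)).
Proof.
move=> valid ji; rewrite /win_noise /pair_noise /aij /= ji ltnNge (ltnW ji) /=.
rewrite (k_sym i j) natrB ?valid_outcome_lt//.
by rewrite -[beta i - beta j]opprB logisticN; ring.
Qed.

Lemma score_excess a i : score weight (excess a) beta i = \sum_(j | j != i) win_noise a i j.
Proof.
have -> : score weight (excess a) beta i =
    (dscore k a i)%:R - \sum_j weight i j * logistic (beta i - beta j).
  rewrite /score /excess -addrA -opprD mulr_sumr -big_split /=; congr (_ - _).
  by apply: eq_bigr => j _; field.
by rewrite sum_weight /dscore natr_sum -sumrB.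
Qed.

Lemma excess_sum0 a : valid_outcome k a -> \sum_i excess a i = 0.
Proof.
move=> valid; rewrite /excess sumrB -mulr_sumr.
under [X in X - _]eq_bigr do rewrite /dscore natr_sum.
under [X in _ - _ * X]eq_bigr do rewrite sum_weight.
rewrite !sum_neq_ordered_pairs mulr_sumr -sumrB big1// => i _.
rewrite mulr_sumr -sumrB big1// => j ij.
rewrite /aij ij ltnNge (ltnW ij) /= (k_sym j i) -natrD subnKC ?valid_outcome_lt//.
by field.
Qed.

Lemma linear_score a (c : 'I_n -> R) : valid_outcome k a ->
  \sum_i c i * score weight (excess a) beta i = \sum_p (c p.1 - c p.2) * pair_noise p (a p).
Proof.
move=> valid; under eq_bigr do rewrite score_excess mulr_sumr.
have -> : \sum_p (c p.1 - c p.2) * pair_noise p (a p) =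
    \sum_i \sum_j (c i - c j) * pair_noise (i, j) (a (i, j)).
  by rewrite pair_bigA; apply: eq_bigr => -[i j] _.
rewrite sum_neq_ordered_pairs; apply: eq_bigr => i _; rewrite big_mkcond; apply: eq_bigr => j _.
case: ifPn => [ij|nij]; first by rewrite win_noise_lt// win_noise_gt//; ring.
by rewrite /pair_noise /= (negbTE nij) mulr0.
Qed.

Lemma pair_noise_mean0 p : \sum_x bt_pmf p x * pair_noise p x = 0.
Proof.
have [lt12|ge12] := boolP (p.1 < p.2)%N; last first.
  by rewrite big1// => x _; rewrite /pair_noise (negbTE ge12) mulr0.
have := bt_pmf_mean
  (fun x => x%:R - (k p.1 p.2)%:R * logistic (beta p.1 - beta p.2)) lt12.
rewrite binomial_mean_center => {2}<-.
by apply: eq_bigr => x _; rewrite /pair_noise lt12.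
Qed.

Lemma pair_noise_variance p : (p.1 < p.2)%N ->
  \sum_x bt_pmf p x * pair_noise p x ^+ 2 = pair_info weight beta p.1 p.2.
Proof.
move=> lt12; rewrite /pair_info /weight -val_eqE /= ltn_eqF// mulrA.
rewrite -binomial_mean_variance -bt_pmf_mean//.
by apply: eq_bigr => x _; rewrite /pair_noise lt12.
Qed.

Lemma pair_noise_le p x : `|pair_noise p x| <= K%:R.
Proof.
rewrite /pair_noise; case: ifP => [lt12|_]; last by rewrite normr0.
have xK : (nat_of_ord x)%:R <= K%:R :> R by rewrite ler_nat -ltnS.
have kK : (k p.1 p.2)%:R <= K%:R :> R by rewrite ler_nat comparisons_le.
have s0 := logistic_gt0 (beta p.1 - beta p.2); have s1 := logistic_lt1 (beta p.1 - beta p.2).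
have mean_le : (k p.1 p.2)%:R * logistic (beta p.1 - beta p.2) <= K%:R :> R.
  by apply: le_trans kK; rewrite ler_piMr// ltW.
have mean_ge0 : 0 <= (k p.1 p.2)%:R * logistic (beta p.1 - beta p.2) :> R.
  by rewrite mulr_ge0// ltW.
have x0 : 0 <= (nat_of_ord x)%:R :> R by [].
by rewrite ler_norml; apply/andP; split; lra.
Qed.

Lemma win_noise_le a i j : valid_outcome k a -> i != j -> `|win_noise a i j| <= K%:R.
Proof.
move=> valid; rewrite neq_ltn => /orP[ij|ji]; first by rewrite win_noise_lt// pair_noise_le.
by rewrite win_noise_gt// normrN pair_noise_le.
Qed.

Lemma linear_score_tail (c : 'I_n -> R) (V t : R) :
  4 * n%:R * K%:R ^+ 2 * \sum_i c i ^+ 2 <= V -> 0 < V -> 0 < t ->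
  prod_prob bt_pmf (fun a => t < `|\sum_i c i * score weight (excess a) beta i|)
  <= 2 * expR (- (t ^+ 2 / (16 * V))).
Proof.
move=> cV V0 t0.
apply: (@le_trans _ _ (prod_prob bt_pmf
  (fun a => t < `|\sum_p (c p.1 - c p.2) * pair_noise p (a p)|))).
  apply: prod_prob_le => [p x|a /prod_pmf_valid valid]; first exact: bt_pmf_ge0.
  by rewrite linear_score.
apply: (prod_prob_hoeffding bt_pmf_ge0 bt_pmf_sum1
  (xi := fun p x => (c p.1 - c p.2) * pair_noise p x)
  (c := fun p => `|c p.1 - c p.2| * K%:R)) => // [p|p x _|].
- by under eq_bigr do rewrite mulrCA; rewrite -mulr_sumr pair_noise_mean0 mulr0.
- by rewrite normrM ler_wpM2l// pair_noise_le.
- under eq_bigr do rewrite exprMn real_normK ?num_real//.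
  apply: le_trans cV; rewrite -mulr_suml mulrAC ler_wpM2r ?sqr_ge0//.
  exact: sum_sqr_diff_le.
Qed.

Section BlockCLT.
Variables (B : pred 'I_n) (M A : R).
Local Notation vdeg := (outer_info weight beta B).
Local Notation quad := (block_quad weight beta B).
Hypothesis vdeg_gt0 : forall i, 0 < vdeg i.
Hypothesis M_ge : forall i, K%:R <= M * Num.sqrt (vdeg i).
Hypotheses (M_ge0 : 0 <= M) (M_le1 : M <= 1) (A_ge1 : 1 <= A) (AM : 4 * A * M ^+ 2 <= 1).
Variable ib : 'I_n.
Hypothesis B_ib : B ib.

Let sd i : R := Num.sqrt (vdeg i).
Let sd_gt0 i : 0 < sd i. Proof. by rewrite sqrtr_gt0. Qed.
Let sd_sqr i : sd i ^+ 2 = vdeg i. Proof. by rewrite sqr_sqrtr// ltW. Qed.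
Let V := \sum_(i | B i) vdeg i.
Let V_gt0 : 0 < V.
Proof. by rewrite /V (bigD1 ib)//= ltr_pwDl// sumr_ge0// => i _; rewrite ltW. Qed.
Let V_sqrt : Num.sqrt V ^+ 2 = V. Proof. by rewrite sqr_sqrtr// ltW. Qed.

Definition ordered_pair (i j : 'I_n) : 'I_n * 'I_n := if (i < j)%N then (i, j) else (j, i).
Definition outer_pairs (i : 'I_n) : seq ('I_n * 'I_n) :=
  [seq ordered_pair i j | j <- enum 'I_n & ~~ B j].
Definition outer_score a (i : 'I_n) : R := \sum_(j | ~~ B j) win_noise a i j.

Let std_noise p (x : 'I_K.+1) : R :=
  if B p.1 && ~~ B p.2 then pair_noise p x / sd p.1
  else if ~~ B p.1 && B p.2 then - pair_noise p x / sd p.2 else 0.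

Let ltn_outer i j : B i -> ~~ B j -> ~~ (i < j)%N -> (j < i)%N.
Proof.
move=> Bi oj ij; rewrite ltn_neqAle leqNgt ij andbT.
by apply: contra oj => /eqP/val_inj ->.
Qed.

Let sum_outer_pairs i (F : 'I_n * 'I_n -> R) :
  \sum_(p <- outer_pairs i) F p = \sum_(j | ~~ B j) F (ordered_pair i j).
Proof. by rewrite /outer_pairs big_map big_filter big_enum_cond; apply: eq_bigl => j. Qed.

Let std_noise_sum a i : valid_outcome k a -> B i ->
  \sum_(p <- outer_pairs i) std_noise p (a p) = outer_score a i / sd i.
Proof.
move=> valid Bi; rewrite sum_outer_pairs /outer_score mulr_suml; apply: eq_bigr => j oj.
rewrite /ordered_pair; case: ifPn => ij; rewrite /std_noise /= Bi oj /=; last first.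
  by rewrite (negbTE oj) /= win_noise_gt// ltn_outer.
by rewrite win_noise_lt.
Qed.

Let std_noise_mean0 p : \sum_x bt_pmf p x * std_noise p x = 0.
Proof.
rewrite /std_noise; case: (B p.1 && ~~ B p.2).
  under eq_bigr do rewrite mulrA.
  by rewrite -mulr_suml pair_noise_mean0 mul0r.
case: (~~ B p.1 && B p.2); last by rewrite big1// => x _; rewrite mulr0.
under eq_bigr do rewrite mulNr -mulrN mulrA.
by rewrite -mulr_suml pair_noise_mean0 mul0r.
Qed.

Let std_noise_le p x : `|std_noise p x| <= M.
Proof.
have scaled i : `|pair_noise p x| / sd i <= M.
  by rewrite ler_pdivrMr//; apply: le_trans (M_ge i); exact: pair_noise_le.
rewrite /std_noise; case: ifP => _; [|case: ifP => _]; last by rewrite normr0.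
  by rewrite normrM [ `|_^-1|]gtr0_norm ?invr_gt0.
by rewrite mulNr normrN normrM [ `|_^-1|]gtr0_norm ?invr_gt0.
Qed.

Let pair_info_sym i j : pair_info weight beta i j = pair_info weight beta j i.
Proof. by rewrite /pair_info weightC -[beta i - beta j]opprB dlogisticN. Qed.

Let std_noise_variance i j : B i -> ~~ B j ->
  \sum_x bt_pmf (ordered_pair i j) x * std_noise (ordered_pair i j) x ^+ 2 =
  pair_info weight beta i j / vdeg i.
Proof.
move=> Bi oj; rewrite /ordered_pair; case: ifPn => ij; rewrite /std_noise /= Bi oj /=.
  rewrite -(pair_noise_variance (p := (i, j)) ij) mulr_suml; apply: eq_bigr => x _.
  by rewrite exprMn exprVn sd_sqr mulrA.
rewrite (negbTE oj) /= pair_info_sym -(pair_noise_variance (p := (j, i)) (ltn_outer Bi oj ij)).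
rewrite mulr_suml; apply: eq_bigr => x _.
by rewrite exprMn exprVn sd_sqr sqrrN mulrA.
Qed.

Let outer_pairs_variance i : B i ->
  \sum_(p <- outer_pairs i) \sum_x bt_pmf p x * std_noise p x ^+ 2 = 1.
Proof.
move=> Bi; rewrite sum_outer_pairs (eq_bigr (fun j => pair_info weight beta i j / vdeg i)).
  by rewrite -mulr_suml -/(vdeg i) divff// gt_eqF// vdeg_gt0.
by move=> j oj; exact: std_noise_variance.
Qed.

Let ordered_pair_inj i i' j j' : B i -> B i' -> ~~ B j -> ~~ B j' ->
  ordered_pair i j = ordered_pair i' j' -> i = i' /\ j = j'.
Proof.
move=> Bi Bi' oj oj'; rewrite /ordered_pair; case: ifP => _; case: ifP => _ [fst_eq snd_eq] //.
- by rewrite -fst_eq Bi in oj'.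
- by rewrite -snd_eq Bi in oj'.
Qed.

Let outer_pairs_disjoint : disjoint_blocks outer_pairs (enum B).
Proof.
split=> [|i|i i' p]; rewrite ?enum_uniq// ?mem_enum => Bi.
  rewrite map_inj_in_uniq => [|j j']; first by apply: filter_uniq; exact: enum_uniq.
  rewrite !mem_filter => /andP[oj _] /andP[oj' _].
  by case/(ordered_pair_inj Bi Bi oj oj').
move=> Bi' /mapP[j]; rewrite mem_filter => /andP[oj _] -> /mapP[j'].
by rewrite mem_filter => /andP[oj' _] /(ordered_pair_inj Bi Bi' oj oj')[].
Qed.

Lemma block_quad_std (D : 'I_n -> R) : quad D = \sum_(i <- enum B) (D i / sd i) ^+ 2
  - (\sum_(i <- enum B) sd i / Num.sqrt V * (D i / sd i)) ^+ 2.
Proof.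
rewrite /block_quad -!big_enum /=; congr (_ - _).
  by apply: eq_bigr => i _; rewrite exprMn exprVn sd_sqr.
have VE : \sum_(i <- enum B) vdeg i = V by rewrite big_enum.
have -> : \sum_(i <- enum B) sd i / Num.sqrt V * (D i / sd i) =
    (\sum_(i <- enum B) D i) / Num.sqrt V.
  rewrite mulr_suml; apply: eq_bigr => i _.
  by field; rewrite !gt_eqF// sqrtr_gt0.
by rewrite VE exprMn exprVn V_sqrt.
Qed.

Let unit_direction : \sum_(i <- enum B) (sd i / Num.sqrt V) ^+ 2 = 1.
Proof.
under eq_bigr do rewrite exprMn exprVn sd_sqr V_sqrt.
by rewrite -mulr_suml big_enum /= -/V divff// gt_eqF.
Qed.

Lemma block_quad_ge0 (D : 'I_n -> R) : 0 <= quad D.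
Proof.
rewrite block_quad_std subr_ge0 (le_trans (cauchy_schwarz_sum _ _ _ _))//.
by rewrite unit_direction mul1r.
Qed.

Lemma block_quad_sums a (l : R) : valid_outcome k a -> - (l * quad (outer_score a)) =
  - (l * sqr_sum std_noise outer_pairs (enum B) a)
  + l * lin_sum std_noise outer_pairs (fun i => sd i / Num.sqrt V) (enum B) a ^+ 2.
Proof.
move=> valid; rewrite block_quad_std mulrBr opprB addrC; congr (- (l * _) + l * _ ^+ 2).
  by apply: eq_big_seq => i; rewrite mem_enum => Bi; rewrite std_noise_sum.
by apply: eq_big_seq => i; rewrite mem_enum => Bi; rewrite std_noise_sum.
Qed.

Lemma block_quad_laplace (l : R) : 0 <= l <= A ->
  `|prod_mean bt_pmf (fun a => expR (- (l * quad (outer_score a))))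
    - expR (- ((#|B|%:R - 1) * ln (1 + 2 * l)) / 2)| <= #|B|%:R * (lindeberg_cst A * M).
Proof.
move=> l0A; have /andP[l0 _] := l0A.
rewrite (eq_prod_mean (g := fun a => expR (- (l * sqr_sum std_noise outer_pairs (enum B) a)
  + l * lin_sum std_noise outer_pairs (fun i => sd i / Num.sqrt V) (enum B) a ^+ 2))); last first.
  by move=> a /prod_pmf_valid valid; rewrite block_quad_sums.
have := laplace_projection bt_pmf_ge0 bt_pmf_sum1 std_noise_mean0 (fun p x _ => std_noise_le p x)
  M_ge0 M_le1 A_ge1 AM (u := fun i => sd i / Num.sqrt V) (c := l) l0A l0 _ outer_pairs_disjoint.
rewrite unit_direction mulr1 rank1_laplace_projection// -cardE; apply => // i.
by rewrite mem_enum; exact: outer_pairs_variance.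
Qed.

Lemma outer_score_dist_le a i : valid_outcome k a -> B i ->
  `|outer_score a i - score weight (excess a) beta i| <= #|B|%:R * K%:R.
Proof.
move=> valid Bi; rewrite score_excess (bigID B) /=.
have -> : outer_score a i = \sum_(j | (j != i) && ~~ B j) win_noise a i j.
  by apply: eq_bigl => j; case: eqVneq => // ->; rewrite Bi.
rewrite opprD addrCA subrr addr0 normrN.
apply: norm_sum_le_card => [j /andP[ji _]||] //; first by rewrite win_noise_le// eq_sym.
by rewrite ler_nat; apply/subset_leq_card/fintype.subsetP => j; rewrite !unfold_in => /andP[].
Qed.

End BlockCLT.

End Model.

Section FitExistence.
Context {R : realType} {n : nat}.
Variables (kappa : 'I_n -> 'I_n -> R) (e bet : 'I_n -> R) (B : pred 'I_n) (o : 'I_n).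
Variables (C b y : R).
Local Notation eps := (C ^+ 2 * (b * y)).
Hypothesis design : block_design kappa bet B C b.
Hypothesis e_sum0 : \sum_i e i = 0.
Hypothesis noise : small_noise kappa e bet B b y.
Hypotheses (y_gt0 : 0 < y) (eps_le_half : 2 * eps <= 1).

Let n_gt0 : 0 < n%:R :> R. Proof. exact: size_gt0 design. Qed.
Let b_gt0 : 0 < b. Proof. exact: scale_gt0 design. Qed.

Let fibre_osc_le : 8 * b * (C * (n%:R * y)) / n%:R <= eps / 2.
Proof.
have -> : 8 * b * (C * (n%:R * y)) / n%:R = C * (8 * (b * y)) by field; rewrite gt_eqF.
have C16 := cst_ge16 design; have by0 : 0 < b * y by rewrite mulr_gt0.
have -> : eps / 2 = C * (C / 2 * (b * y)) by field.
by rewrite ler_wpM2l ?ler_wpM2r ?(ltW by0)//; lra.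
Qed.

Lemma fibre_fit_exists (pi : 'I_n -> 'I_n) :
  (forall j, #|[pred i | pi i == j]|%:R <= C) -> exists del : 'I_n -> R,
  [/\ forall i j, pi i = pi j -> del i = del j, del o = 0,
      forall i j, `|del i - del j| <= eps
    & forall j, \sum_(i | pi i == j) score kappa e (fun i => bet i + del i) i = 0].
Proof.
move=> card_fibre; have /andP[/forallP score_le _] := noise.
have [j||del [del_fibre del_o osc fibre0]] := fibre_maximizer_exists (weight_sym design)
  (weight_ge0 design) e_sum0 (bet := bet) (pi := pi) (A := C * (n%:R * y)) o b_gt0
  (pair_info_ge design) _ (le_lt_trans fibre_osc_le _).
- by apply: norm_sum_le_card => //; [rewrite mulr_ge0 ?(ltW y_gt0)|exact: card_fibre].
- by have := eps_le_half; lra.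
exists del; split=> // i j; apply: le_trans (osc i j) (le_trans fibre_osc_le _).
have : 0 <= eps by rewrite mulr_ge0 ?sqr_ge0// mulr_ge0 ?(ltW b_gt0) ?(ltW y_gt0).
lra.
Qed.

Lemma full_fit_exists : exists del, full_fit kappa e bet o eps del.
Proof.
have [|del [_ del_o osc fibre0]] := @fibre_fit_exists id.
  by move=> j; rewrite card1; have := cst_ge16 design; lra.
by exists del; split=> // i; have := fibre0 i; rewrite big_pred1_eq.
Qed.

Variable ib : 'I_n.
Hypothesis B_ib : B ib.

Let collapse (i : 'I_n) : 'I_n := if B i then ib else i.

Let collapse_block i : (collapse i == ib) = B i.
Proof.
rewrite /collapse; case: ifPn => [|oi]; first by rewrite eqxx.
by apply: contraNF oi => /eqP ->.
Qed.

Let collapse_outer i j : ~~ B j -> (collapse i == j) = (i == j).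
Proof.
move=> oj; rewrite /collapse; case: ifP => // Bi.
by transitivity false; [|symmetry]; apply: contraNF oj => /eqP <-.
Qed.

Lemma null_fit_exists : exists del, null_fit kappa e bet B o eps del.
Proof.
have [j|del [del_block del_o osc fibre0]] := @fibre_fit_exists collapse.
  have [Bj|oj] := boolP (B j).
    apply: le_trans (card_block design).
    rewrite ler_nat; apply/subset_leq_card/fintype.subsetP => i.
    by rewrite !unfold_in /= /collapse; case: ifPn => // oi /eqP ij; rewrite -ij (negbTE oi) in Bj.
  rewrite (eq_card (B := pred1 j)) ?card1 => [|i]; last by rewrite !unfold_in /= collapse_outer.
  by have := cst_ge16 design; lra.
exists del; split=> // [i j Bi Bj|i oi|].
- by apply: del_block; rewrite /collapse Bi Bj.
- by have := fibre0 i; rewrite (big_pred1 i) => // j; rewrite /= collapse_outer.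
- by have := fibre0 ib; rewrite (eq_bigl _ _ collapse_block).
Qed.

End FitExistence.

Section NoiseTail.
Context {R : realType} {n K : nat}.
Variables (k : 'I_n -> 'I_n -> nat) (beta : 'I_n -> R) (B : pred 'I_n) (C b y L : R).
Hypothesis k_sym : forall i j, k i j = k j i.
Hypothesis k_bnd : forall i j, i != j -> (1 <= k i j <= K)%N.
Hypothesis design : block_design (weight k) beta B C b.
Hypothesis K_le : K%:R <= C.
Hypotheses (L_ge1 : 1 <= L) (ny2 : n%:R * y ^+ 2 = C ^+ 4 * L) (y_gt0 : 0 < y).
Local Notation sc a := (score (weight k) (excess k a) beta).
Local Notation info := (pair_info (weight k) beta).
Local Notation vdeg := (outer_info (weight k) beta B).
Local Notation prob := (prod_prob (bt_pmf k beta)).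
Implicit Types a : outcome n K.

Let n_gt0 : 0 < n%:R :> R. Proof. exact: size_gt0 design. Qed.
Let b_gt0 : 0 < b. Proof. exact: scale_gt0 design. Qed.
Let C_gt0 : 0 < C. Proof. exact: cst_gt0 design. Qed.
Let C2_ge : 256 <= C ^+ 2. Proof. by have := cst_ge16 design; nra. Qed.

Lemma linear_score_subgaussian_tail (c : 'I_n -> R) (V t : R) :
  4 * n%:R * C ^+ 2 * \sum_i c i ^+ 2 <= V -> 0 < V -> 0 < t -> 32 * V * L <= t ^+ 2 ->
  prob (fun a => t < `|\sum_i c i * sc a i|) <= 2 * expR (- (2 * L)).
Proof.
move=> cV V0 t0 Vt; apply: le_trans (linear_score_tail beta k_sym k_bnd _ V0 t0) _.
  apply: le_trans cV; rewrite ler_wpM2r//; first by rewrite sumr_ge0// => i _; exact: sqr_ge0.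
  by rewrite ler_wpM2l ?mulr_ge0// lerXn2r ?nnegrE ?(ltW C_gt0).
by rewrite ler_wpM2l// ler_expR lerN2 ler_pdivlMr ?mulr_gt0//; lra.
Qed.

Lemma score_tail i : prob (fun a => n%:R * y < `|sc a i|) <= 2 * expR (- (2 * L)).
Proof.
pose c (j : 'I_n) : R := (j == i)%:R.
have scE a : \sum_j c j * sc a j = sc a i.
  by rewrite (bigD1 i)//= /c eqxx mul1r big1 ?addr0// => j /negbTE ->; rewrite mul0r.
have c2 : \sum_j c j ^+ 2 = 1.
  by rewrite (bigD1 i)//= /c eqxx expr1n big1 ?addr0// => j /negbTE ->; rewrite expr0n.
have ny2L : (n%:R * y) ^+ 2 = C ^+ 2 * (n%:R * C ^+ 2 * L).
  by rewrite (_ : (n%:R * y) ^+ 2 = n%:R * (n%:R * y ^+ 2)); [rewrite ny2|]; ring.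
have scale0 : 0 <= n%:R * C ^+ 2 * L.
  by rewrite mulr_ge0 ?(le_trans ler01 L_ge1)// mulr_ge0 ?sqr_ge0.
have := @linear_score_subgaussian_tail c (4 * n%:R * C ^+ 2) (n%:R * y).
rewrite c2 mulr1 ny2L; under [X in prob X]eq_fun do rewrite scE.
apply; rewrite ?mulr_gt0 ?exprn_gt0//.
have := ler_wpM2r scale0 C2_ge; lra.
Qed.

Lemma averaged_score_tail i :
  prob (fun a => b * n%:R * y ^+ 2 < `|\sum_(j | ~~ B j) info i j * (sc a j / vdeg j)|)
  <= 2 * expR (- (2 * L)).
Proof.
pose c (j : 'I_n) : R := if B j then 0 else info i j / vdeg j.
have avgE a : \sum_j c j * sc a j = \sum_(j | ~~ B j) info i j * (sc a j / vdeg j).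
  rewrite [RHS]big_mkcond; apply: eq_bigr => j _; rewrite /c; case: (B j); rewrite ?mul0r//=.
  by rewrite mulrA mulrAC.
have c_le j : 0 <= c j <= C * (4 * b / n%:R).
  have info0 := pair_info_ge0 design i j; have vdeg0 := outer_infoV_ge0 design j.
  rewrite /c; case: (B j); first by rewrite lexx !mulr_ge0 ?invr_ge0 ?(ltW C_gt0) ?(ltW b_gt0).
  by rewrite mulr_ge0//= ler_pM// ?(pair_info_le design) ?(outer_infoV_le design).
have c2_le : \sum_j c j ^+ 2 <= n%:R * (C * (4 * b / n%:R)) ^+ 2.
  rewrite mulr_natl -[n in _ *+ n]card_ord -sumr_const; apply: ler_sum => j _.
  by have /andP[c0 cC] := c_le j; rewrite lerXn2r ?nnegrE ?(le_trans c0 cC).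
have tE : (b * n%:R * y ^+ 2) ^+ 2 = C ^+ 4 * L * (b ^+ 2 * C ^+ 4 * L).
  by rewrite -mulrA ny2; ring.
have L0 : 0 <= L by have := L_ge1; lra.
have := @linear_score_subgaussian_tail c (64 * C ^+ 4 * b ^+ 2) (b * n%:R * y ^+ 2).
rewrite tE; under [X in prob X]eq_fun do rewrite avgE.
apply; rewrite ?mulr_gt0 ?exprn_gt0//.
  have := ler_wpM2l (_ : 0 <= 4 * n%:R * C ^+ 2) c2_le; rewrite mulr_ge0 ?sqr_ge0// => /(_ isT).
  move/le_trans; apply; rewrite le_eqVlt; apply/orP; left; apply/eqP.
  by field; rewrite gt_eqF.
have C4L : 2048 <= C ^+ 4 * L.
  by rewrite (exprM C 2 2); have := C2_ge; have := L_ge1; move: (C ^+ 2) => z; nra.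
have scale0 : 0 <= b ^+ 2 * C ^+ 4 * L by rewrite !mulr_ge0 ?exprn_ge0 ?(ltW C_gt0) ?(ltW b_gt0).
have := ler_wpM2r scale0 C4L; lra.
Qed.

Lemma small_noise_tail :
  prob (fun a => ~~ small_noise (weight k) (excess k a) beta B b y) <=
  n%:R * (4 * expR (- (2 * L))).
Proof.
have -> : (fun a => ~~ small_noise (weight k) (excess k a) beta B b y) =
    (fun a => [exists i, n%:R * y < `|sc a i|] || [exists i,
       b * n%:R * y ^+ 2 < `|\sum_(j | ~~ B j) info i j * (sc a j / vdeg j)|]).
  apply/funext => a; rewrite /small_noise negb_and !negb_forall.
  by congr (_ || _); apply: eq_existsb => i; rewrite -ltNge.
apply: le_trans (prod_probU (bt_pmf_ge0 k beta) _ _) _.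
have -> : n%:R * (4 * expR (- (2 * L))) =
  n%:R * (2 * expR (- (2 * L))) + n%:R * (2 * expR (- (2 * L))) by ring.
apply: lerD; rewrite -[n in leRHS]card_ord; apply: prod_prob_exists;
  [exact: bt_pmf_ge0|exact: score_tail|exact: bt_pmf_ge0|exact: averaged_score_tail].
Qed.

End NoiseTail.

(* In the indexing from [0], the items 2, ..., r of the null hypothesis. *)
Definition eqblock (r n : nat) : pred 'I_n := fun i => (0 < i < r)%N.
Arguments eqblock : clear implicits.

Lemma card_eqblock r n : (r <= n)%N -> #|eqblock r n| = r.-1.
Proof.
move=> rn; rewrite -sum1_card -(big_mkord (fun i => (0 < i < r)%N) (fun=> 1%N)).
rewrite -subn1 -[RHS]muln1 -sum_nat_const_nat (big_nat_widen 1 r n)// (big_nat_widenl 1 0)//.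
by apply: eq_bigl => i; rewrite andbC.
Qed.

Lemma card_eqblockC r n : (2 * r <= n)%N -> (n <= 2 * #|predC (eqblock r n)|)%N.
Proof.
rewrite !mul2n -!addnn => rn; have rn' : (r <= n)%N := leq_trans (leq_addl _ _) rn.
have := cardC (eqblock r n); rewrite card_ord card_eqblock// => nE.
rewrite -[leqLHS]nE leq_add2r -(leq_add2l r.-1) nE; apply: leq_trans rn.
by rewrite leq_add ?leq_pred.
Qed.

Section LikelihoodRatio.
Context {R : realType} {n K : nat}.
Variables (r : nat) (k : 'I_n -> 'I_n -> nat) (beta : 'I_n -> R).
Hypothesis r_gt2 : (2 < r)%N.
Hypothesis k_sym : forall i j, k i j = k j i.
Hypothesis k_bnd : forall i j, i != j -> (1 <= k i j <= K)%N.
Hypothesis beta_null : @null_space R n r beta.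
Hypothesis n_ge : (2 * r <= n)%N.
Local Notation B := (eqblock r n).
Variables C b : R.
Hypotheses (C_ge16 : 16 <= C) (K_le : K%:R <= C) (r_le : r%:R <= C) (b_ge1 : 1 <= b).
Hypothesis info_ge : forall i j, i != j -> 1 <= b * pair_info (weight k) beta i j.

Lemma eqblock_design : block_design (weight k) beta B C b.
Proof.
have rn : (r <= n)%N by rewrite (leq_trans _ n_ge)// leq_pmull.
split=> // [i j|i j|i j|||].
- exact: weightC.
- exact: weight_nneg.
- exact: le_trans (weight_leK k_bnd _ _) K_le.
- by apply: le_trans r_le; rewrite ler_nat card_eqblock ?leq_pred.
- by rewrite -natrM ler_nat card_eqblockC.
- by rewrite ler_nat (leq_trans _ n_ge)// (leq_mul2l 2 2) ltnW.
Qed.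

Let n_gt1 : (1 < n)%N.
Proof. by rewrite (leq_trans _ n_ge)// (leq_trans (ltnW r_gt2))// leq_pmull. Qed.
Let o : 'I_n := Ordinal (ltnW n_gt1).
Let ib : 'I_n := Ordinal n_gt1.
Let B_ib : B ib. Proof. by rewrite /eqblock /= (ltnW r_gt2). Qed.

Lemma full_fit_maximizer (a : outcome n K) eps del :
  full_fit (weight k) (excess k a) beta o eps del ->
  is_maximizer k a (@full_space R n) (fun i => beta i + del i).
Proof.
case=> del_o _ score0; split=> [i i0|h _].
  by rewrite (beta_null.1 i i0) add0r (_ : i = o)//; exact: val_inj.
rewrite !ell_btE//; apply: le_trans (loglik_concave _ (weightC k_sym) (weight_nneg k)
  (fun i => beta i + del i) _) _.
by rewrite big1 ?addr0// => i _; rewrite score0 mul0r.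
Qed.

Lemma null_fit_maximizer (a : outcome n K) eps del :
  null_fit (weight k) (excess k a) beta B o eps del ->
  is_maximizer k a (@null_space R n r) (fun i => beta i + del i).
Proof.
case=> del_B del_o _ score0 score_sum0; have [beta_ref beta_B] := beta_null.
split=> [|h [_ h_B]].
  split=> [i i0|i j i1 ir j1 jr].
    by rewrite (beta_ref i i0) add0r (_ : i = o)//; exact: val_inj.
  by rewrite (beta_B i j)// (del_B i j)// /eqblock ?i1 ?j1.
rewrite !ell_btE//; apply: le_trans (loglik_concave _ (weightC k_sym) (weight_nneg k)
  (fun i => beta i + del i) _) _.
rewrite (bigID B) /= [X in _ + (_ + X)]big1 => [|i oi]; last by rewrite score0// mul0r.
rewrite addr0 (eq_bigr (fun i => score (weight k) (excess k a) (fun l => beta l + del l) i *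
  (h ib - (beta ib + del ib)))); first by rewrite -mulr_suml score_sum0 mul0r addr0.
move=> i Bi; have /andP[i1 ir] := Bi; have /andP[ib1 ibr] := B_ib.
by rewrite (h_B i ib)// (beta_B i ib)// (del_B i ib).
Qed.

Variables y L : R.
Hypotheses (L_ge1 : 1 <= L) (ny2 : n%:R * y ^+ 2 = C ^+ 4 * L) (y_gt0 : 0 < y).
Hypotheses (b3y_le1 : b ^+ 3 * y <= 1) (eps_le_half : 2 * (C ^+ 2 * (b * y)) <= 1).
Local Notation quad a := (block_quad (weight k) beta B (outer_score k beta B a)).

Lemma lr_block_quad_le (a : outcome n K) (T : R) :
  valid_outcome k a -> small_noise (weight k) (excess k a) beta B b y ->
  (forall g g0, is_maximizer k a (@full_space R n) g -> is_maximizer k a (@null_space R n r) g0 ->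
     T = 2 * (ell_bt k a g - ell_bt k a g0)) ->
  `|T - quad a| <= C ^+ 26 * (b ^+ 6 * (n%:R * y ^+ 3)).
Proof.
move=> valid noise T_lr; have design := eqblock_design.
have e_sum0 := excess_sum0 (R := R) k_sym valid.
have [del1 fit1] := full_fit_exists o design e_sum0 noise y_gt0 eps_le_half.
have [del0 fit0] := null_fit_exists o design e_sum0 noise y_gt0 eps_le_half B_ib.
rewrite (T_lr _ _ (full_fit_maximizer fit1) (null_fit_maximizer fit0)) !ell_btE//.
apply: (lr_block_quad_rate design _ fit0 fit1 noise y_gt0 _ b3y_le1 eps_le_half _ B_ib) => //.
  by rewrite ny2 -[leLHS]mulr1 ler_pM ?exprn_ege1//; have := C_ge16; lra.
move=> i Bi; apply: le_trans (outer_score_dist_le beta k_sym k_bnd valid Bi) _.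
by rewrite expr2 ler_pM ?(card_block design).
Qed.

Lemma lr_block_quad_tail (T : outcome n K -> R) :
  (forall a g g0, is_maximizer k a (@full_space R n) g -> is_maximizer k a (@null_space R n r) g0 ->
     T a = 2 * (ell_bt k a g - ell_bt k a g0)) ->
  prod_prob (bt_pmf k beta) (fun a => C ^+ 26 * (b ^+ 6 * (n%:R * y ^+ 3)) < `|T a - quad a|)
  <= n%:R * (4 * expR (- (2 * L))).
Proof.
move=> T_lr.
apply: le_trans (small_noise_tail k_sym k_bnd eqblock_design K_le L_ge1 ny2 y_gt0).
apply: prod_prob_le => [|a /prod_pmf_valid valid]; first exact: bt_pmf_ge0.
by apply: contraTN => noise; rewrite -leNgt; apply: lr_block_quad_le => // g g0; exact: T_lr.
Qed.

End LikelihoodRatio.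

Section MeritVariance.
Context {R : realType}.

Lemma vfun_ge4 (x : R) : 4 <= vfun x.
Proof.
rewrite -[vfun x]invrK -dlogistic_vfun -[leLHS]invrK lef_pV2 ?posrE ?dlogistic_gt0//.
by have := dlogistic_le x; lra.
Qed.

Lemma vfun0 : vfun (0 : R) = 4.
Proof. by rewrite /vfun expR0; field. Qed.

Context {n : nat} (beta : 'I_n -> R).

Lemma vfun_le_b_n i j : i != j -> vfun (beta i - beta j) <= b_n beta.
Proof.
move=> ij; rewrite /b_n; apply: le_trans (le_bigmax _ _ i).
by apply: (le_bigmax_cond _ (fun j => vfun (beta i - beta j))); rewrite eq_sym.
Qed.

Lemma b_n_ge4 (i j : 'I_n) : i != j -> 4 <= b_n beta.
Proof. by move=> ij; apply: le_trans (vfun_le_b_n ij); exact: vfun_ge4. Qed.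

Lemma c_n_le_vfun i j : i != j -> c_n beta <= vfun (beta i - beta j).
Proof.
move=> ij; rewrite /c_n; apply: le_trans (bigmin_le _ i _) _.
by apply: (bigmin_le_cond _ (fun j => vfun (beta i - beta j))); rewrite eq_sym.
Qed.

Lemma c_n_gt0 : 0 < b_n beta -> 0 < c_n beta.
Proof.
by move=> b0; apply: lt_bigmin => // i _; apply: lt_bigmin => // j _; exact: vfun_gt0.
Qed.

Lemma pair_info_ge_b_n (K : nat) (k : 'I_n -> 'I_n -> nat) i j :
  (forall i j, i != j -> (1 <= k i j <= K)%N) -> i != j ->
  1 <= b_n beta * pair_info (weight k) beta i j.
Proof.
move=> k_bnd ij; rewrite /pair_info dlogistic_vfun mulrCA -[leLHS]mulr1.
apply: ler_pM => //; first exact: weight_ge1 k_bnd _ _ ij.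
by rewrite ler_pdivlMr ?vfun_gt0// mul1r vfun_le_b_n.
Qed.

End MeritVariance.

Section LaplaceRate.
Context {R : realType} {n K : nat}.
Variables (k : 'I_n -> 'I_n -> nat) (beta : 'I_n -> R) (B : pred 'I_n) (C b A : R) (ib : 'I_n).
Hypothesis k_sym : forall i j, k i j = k j i.
Hypothesis k_bnd : forall i j, i != j -> (1 <= k i j <= K)%N.
Hypothesis design : block_design (weight k) beta B C b.
Hypotheses (K_le : K%:R <= C) (B_ib : B ib) (A_ge1 : 1 <= A).
Local Notation M := (2 * C * b / Num.sqrt n%:R).
Local Notation vdeg := (outer_info (weight k) beta B).
Hypothesis M_le : M <= (4 * A)^-1.

Let n_gt0 : 0 < n%:R :> R. Proof. exact: size_gt0 design. Qed.
Let b_ge1 : 1 <= b. Proof. exact: scale_ge1 design. Qed.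
Let C_gt0 : 0 < C. Proof. exact: cst_gt0 design. Qed.
Let M_ge0 : 0 <= M.
Proof.
by rewrite divr_ge0 ?sqrtr_ge0// mulr_ge0 ?(le_trans ler01 b_ge1)// mulr_ge0 ?(ltW C_gt0).
Qed.

Lemma noise_bound_le_sqrt_info i : K%:R <= M * Num.sqrt (vdeg i).
Proof.
have vdeg0 : 0 <= vdeg i by rewrite ltW ?(outer_info_gt0 design).
apply: le_trans K_le _.
rewrite -(ler_pXn2r (isT : (0 < 2)%N)) ?nnegrE ?(ltW C_gt0) ?(mulr_ge0 M_ge0 (sqrtr_ge0 _))//.
rewrite !exprMn exprVn !sqr_sqrtr// ?(ltW n_gt0)//.
have -> : 2 ^+ 2 * C ^+ 2 * b ^+ 2 / n%:R * vdeg i = C ^+ 2 * (b * (4 * b * vdeg i) / n%:R).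
  by field; rewrite gt_eqF.
rewrite ler_peMr ?sqr_ge0// ler_pdivlMr// mul1r.
apply: le_trans (outer_info_ge design i) _.
by rewrite ler_peMl// mulr_ge0// mulr_ge0// (le_trans ler01).
Qed.

Lemma block_quad_laplace_rate (l : R) : 0 <= l <= A ->
  `|prod_mean (bt_pmf k beta)
      (fun a : outcome n K => expR (- (l * block_quad (weight k) beta B (outer_score k beta B a))))
    - expR (- ((#|B|%:R - 1) * ln (1 + 2 * l)) / 2)| <= C * (lindeberg_cst A * M).
Proof.
move=> l0A; have A0 : 0 < 4 * A by have := A_ge1; lra.
have AM : 4 * A * M <= 1 by rewrite mulrC -ler_pdivlMr ?div1r.
have M1 : M <= 1.
  by apply: le_trans AM; rewrite ler_peMl//; have := A_ge1; lra.
have AM2 : 4 * A * M ^+ 2 <= 1.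
  by rewrite expr2 mulrA mulr_ile1// mulr_ge0// ltW.
apply: le_trans (block_quad_laplace k_sym k_bnd (outer_info_gt0 design)
  noise_bound_le_sqrt_info M_ge0 M1 A_ge1 AM2 B_ib l0A) _.
by rewrite ler_wpM2r ?(card_block design)// mulr_ge0 ?lindeberg_cst_ge0.
Qed.

End LaplaceRate.

Lemma powR_half {R : realType} (x : R) (m : nat) : 0 <= x ->
  x `^ (m%:R / 2) = Num.sqrt x ^+ m.
Proof. by move=> x0; rewrite mulrC powRrM powR12_sqrt// powR_mulrn ?sqrtr_ge0. Qed.

Section Asymptotics.
Context {R : realType}.
Variables (K r : nat) (k : forall n : nat, 'I_n -> 'I_n -> nat) (beta : forall n : nat, 'I_n -> R).
Hypothesis r_gt2 : (2 < r)%N.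
Hypothesis k_sym : forall n (i j : 'I_n), k i j = k j i.
Hypothesis k_bnd : forall n (i j : 'I_n), i != j -> (1 <= k i j <= K)%N.
Hypothesis beta_null : forall n, null_space r (@beta n).
Hypothesis rate : (fun n : nat => (b_n (@beta n) ^+ 11 / c_n (@beta n) ^+ 6)
  / (Num.sqrt (n%:R : R) / powR (ln (n%:R : R)) (5 / 2))) @ \oo --> (0 : R).

Local Notation b n := (b_n (@beta n)).
Local Notation c n := (c_n (@beta n)).
Local Notation L n := (ln (n%:R : R)).
Local Notation s n := (Num.sqrt (L n)).
Local Notation N n := (Num.sqrt (n%:R : R)).
Local Notation B n := (eqblock r n).
Local Notation pmf n := (bt_pmf (@k n) (@beta n)).
Let C : R := (16 + K + r)%:R.

Let C_ge16 : 16 <= C. Proof. by rewrite ler_nat -addnA leq_addr. Qed.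
Let K_le : K%:R <= C. Proof. by rewrite ler_nat addnAC leq_addl. Qed.
Let r_le : r%:R <= C. Proof. by rewrite ler_nat leq_addl. Qed.
Let C_gt0 : 0 < C. Proof. by have := C_ge16; lra. Qed.

(* As [r > 2], two items have equal merits, so the factor [c_n ^+ 6] is harmless. *)
Lemma c_n_gt0_le4 n : (2 < n)%N -> 0 < c n <= 4.
Proof.
move=> n2; pose i1 : 'I_n := Ordinal (ltnW n2); pose i2 : 'I_n := Ordinal n2.
have i12 : i1 != i2 by [].
rewrite c_n_gt0; last by have := b_n_ge4 (@beta n) i12; lra.
rewrite /=; apply: le_trans (c_n_le_vfun _ i12) _.
by rewrite ((beta_null n).2 i1 i2)//= ?(ltnW r_gt2)// subrr vfun0.
Qed.

Lemma rate_near (e : R) : 0 < e -> \forall n \near \oo,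
  [/\ (2 * r <= n)%N, 1 <= b n, 1 <= L n & b n ^+ 11 * s n ^+ 5 <= e * N n].
Proof.
move=> e0; have /cvgrPdist_le/(_ (e / 4 ^+ 6)) := rate.
rewrite divr_gt0 ?exprn_gt0// => /(_ isT) small.
apply: filterS3 small (nbhs_infty_ge (2 * r)%N) (nbhs_infty_ger (expR 1 : R)) => n + rn en.
have n2 : (2 < n)%N by rewrite (leq_trans r_gt2)// (leq_trans _ rn)// leq_pmull.
have /andP[c0 c4] := c_n_gt0_le4 n2.
have b4 : 4 <= b n := b_n_ge4 (@beta n) (isT : Ordinal (ltnW n2) != Ordinal n2).
have n0 : 0 < n%:R :> R by exact: lt_le_trans (expR_gt0 1) en.
have L1 : 1 <= L n by rewrite -[leLHS]expRK ler_ln// ?posrE ?expR_gt0.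
rewrite sub0r normrN powR_half ?(le_trans ler01 L1)// ger0_norm; last first.
  by rewrite !divr_ge0 ?exprn_ge0 ?sqrtr_ge0 ?(ltW c0)//; lra.
have N0 : 0 < N n by rewrite sqrtr_gt0.
have s0 : 0 < s n by rewrite sqrtr_gt0; lra.
have c60 : 0 < c n ^+ 6 by rewrite exprn_gt0.
have -> : b n ^+ 11 / c n ^+ 6 / (N n / s n ^+ 5) = b n ^+ 11 * s n ^+ 5 / (c n ^+ 6 * N n).
  by field; rewrite !gt_eqF.
rewrite ler_pdivrMr ?mulr_gt0// => bound; split=> //; first lra.
apply: le_trans bound _; rewrite mulrA ler_wpM2r ?(ltW N0)//.
rewrite mulrAC ler_pdivrMr ?exprn_gt0// ler_wpM2l ?(ltW e0)//.
by rewrite lerXn2r ?nnegrE// ltW.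
Qed.

Lemma monomial_rate_near (e : R) : 0 < e -> \forall n \near \oo,
  [/\ (2 * r <= n)%N, 1 <= b n, 1 <= L n
    & forall p q, (p <= 11)%N -> (q <= 5)%N -> b n ^+ p * s n ^+ q <= e * N n].
Proof.
move=> e0; apply: filterS (rate_near e0) => n [rn b1 L1 bound]; split=> // p q p11 q5.
have s1 : 1 <= s n by rewrite -[leLHS]sqrtr1 ler_sqrt ?(le_trans ler01).
apply: le_trans bound.
by apply: ler_pM; rewrite ?exprn_ge0 ?(le_trans ler01)// ler_weXn2l.
Qed.

Definition lr_approx n (a : outcome n K) : R :=
  block_quad (weight (@k n)) (@beta n) (B n) (outer_score (@k n) (@beta n) (B n) a).

Let design n : (2 * r <= n)%N -> 1 <= b n -> block_design (weight (@k n)) (@beta n) (B n) C (b n).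
Proof.
move=> rn b1; apply: (eqblock_design r_gt2 (@k_sym n) (@k_bnd n)) => // i j ij.
exact: pair_info_ge_b_n (@k_bnd n) ij.
Qed.

Let eqblock_nonempty n : (2 * r <= n)%N -> exists i, B n i.
Proof.
move=> rn; have n1 : (1 < n)%N by rewrite (leq_trans _ rn)// (leq_trans (ltnW r_gt2))// leq_pmull.
by exists (Ordinal n1); rewrite /eqblock /= (ltnW r_gt2).
Qed.

Lemma lr_approx_ge0_near : \forall n \near \oo, forall a, 0 <= @lr_approx n a.
Proof.
apply: filterS (rate_near ltr01) => n [rn b1 _ _] a.
have [ib Bib] := eqblock_nonempty rn.
by rewrite /lr_approx (block_quad_ge0 (outer_info_gt0 (design rn b1)) Bib).
Qed.

Let card_eqblock_laplace n (l : R) : (2 * r <= n)%N -> 0 <= l ->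
  expR (- ((#|B n|%:R - 1) * ln (1 + 2 * l)) / 2) = (1 + 2 * l) `^ (- ((r - 2)%:R / 2)).
Proof.
move=> rn l0; rewrite card_eqblock ?(leq_trans _ rn) ?leq_pmull//.
rewrite /powR gt_eqF; last by lra.
have -> : r.-1 = (r - 2).+1 by rewrite -subSn ?subSS ?subn1// ltnW.
by rewrite -natr1 addrK; congr expR; field.
Qed.

Lemma lr_approx_laplace (j : nat) :
  prod_mean (pmf n) (fun a => expR (- (j%:R * lr_approx a))) @[n --> \oo]
  --> (1 + 2 * j%:R) `^ (- ((r - 2)%:R / 2)).
Proof.
apply/cvgrPdist_le => eps eps0.
pose A : R := 1 + j%:R; have A1 : 1 <= A by rewrite lerDl.
have lc0 := lindeberg_cst_ge0 A.
pose d := Num.min (4 * A)^-1 (eps / (C * (lindeberg_cst A + 1))).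
have Clc : 0 < C * (lindeberg_cst A + 1) by rewrite mulr_gt0//; lra.
have d0 : 0 < d by rewrite lt_min invr_gt0 divr_gt0// andbT; lra.
have d2C : 0 < d / (2 * C) by rewrite divr_gt0// mulr_gt0.
apply: filterS (monomial_rate_near d2C) => n [rn b1 L1 monomial_le].
have [ib Bib] := eqblock_nonempty rn.
have n0 : 0 < n%:R :> R := size_gt0 (design rn b1).
have Md : 2 * C * b n / N n <= d.
  rewrite ler_pdivrMr ?sqrtr_gt0// mulrC -ler_pdivlMr ?mulr_gt0// mulrAC.
  by have := monomial_le 1%N 0%N isT isT; rewrite expr1 expr0 mulr1.
have M_le : 2 * C * b n / N n <= (4 * A)^-1 by apply: le_trans Md _; rewrite ge_min lexx.
have jA : 0 <= (j%:R : R) <= A by rewrite ler0n /A; lra.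
rewrite -(card_eqblock_laplace rn (ler0n _ j)) distrC.
apply: le_trans (block_quad_laplace_rate (@k_sym n) (@k_bnd n) (design rn b1) K_le Bib A1 M_le
  jA) _.
have : d * (C * (lindeberg_cst A + 1)) <= eps by rewrite -ler_pdivlMr// ge_min lexx orbT.
apply: le_trans; rewrite mulrA mulrC ler_pM ?mulr_ge0 ?sqrtr_ge0 ?invr_ge0 ?(ltW C_gt0)//.
  exact: le_trans ler01 b1.
by rewrite ler_wpM2l ?(ltW C_gt0)// lerDl.
Qed.

Variable T : forall n, outcome n K -> R.
Hypothesis T_lr : forall n (a : outcome n K) (g g0 : 'I_n -> R),
  is_maximizer (@k n) a (@full_space R n) g -> is_maximizer (@k n) a (@null_space R n r) g0 ->
  T a = 2 * (ell_bt (@k n) a g - ell_bt (@k n) a g0).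

Lemma lr_approx_tail_le (e eta : R) n : (2 * r <= n)%N -> 1 <= b n -> 1 <= L n ->
  (forall p q, (p <= 11)%N -> (q <= 5)%N -> b n ^+ p * s n ^+ q <= e * N n) ->
  2 * C ^+ 4 * e <= 1 -> C ^+ 32 * e <= eta ->
  prod_prob (pmf n) (fun a => eta < `|T a - lr_approx a|) <= 4 / n%:R.
Proof.
move=> rn b1 L1 monomial_le e_small e_eta.
have n0 : 0 < n%:R :> R := size_gt0 (design rn b1).
have N0 : 0 < N n by rewrite sqrtr_gt0.
have s0 : 0 < s n by rewrite sqrtr_gt0; lra.
have bound p q : (p <= 11)%N -> (q <= 5)%N -> b n ^+ p * s n ^+ q / N n <= e.
  by move=> p11 q5; rewrite ler_pdivrMr// monomial_le.
pose y := C ^+ 2 * (s n / N n).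
have y0 : 0 < y by rewrite mulr_gt0 ?divr_gt0 ?exprn_gt0.
have ny2 : n%:R * y ^+ 2 = C ^+ 4 * L n.
  rewrite !exprMn exprVn !sqr_sqrtr ?(ltW n0)//; last lra.
  by field; rewrite gt_eqF.
have e0 : 0 <= e.
  by apply: le_trans (bound 0%N 0%N isT isT); rewrite !expr0 mulr1 divr_ge0 ?(ltW N0).
have C24 : C ^+ 2 <= C ^+ 4 by rewrite ler_weXn2l//; have := C_ge16; lra.
have b3y : b n ^+ 3 * y <= 1.
  have -> : b n ^+ 3 * y = C ^+ 2 * (b n ^+ 3 * s n ^+ 1 / N n) by rewrite /y; ring.
  have := ler_wpM2l (sqr_ge0 C) (bound 3%N 1%N isT isT); have := ler_wpM2r e0 C24.
  have := mulr_ge0 (exprn_ge0 4 (ltW C_gt0)) e0; lra.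
have eps_half : 2 * (C ^+ 2 * (b n * y)) <= 1.
  have -> : C ^+ 2 * (b n * y) = C ^+ 4 * (b n ^+ 1 * s n ^+ 1 / N n) by rewrite /y; ring.
  by have := ler_wpM2l (exprn_ge0 4 (ltW C_gt0)) (bound 1%N 1%N isT isT); lra.
have remainder_le : C ^+ 26 * (b n ^+ 6 * (n%:R * y ^+ 3)) <= eta.
  have -> : C ^+ 26 * (b n ^+ 6 * (n%:R * y ^+ 3)) = C ^+ 32 * (b n ^+ 6 * s n ^+ 3 / N n).
    by rewrite /y -{1}(sqr_sqrtr (ltW n0)); field; rewrite gt_eqF.
  by apply: le_trans e_eta; rewrite ler_wpM2l ?exprn_ge0 ?(ltW C_gt0)// bound.
have := lr_block_quad_tail r_gt2 (@k_sym n) (@k_bnd n) (beta_null n) rn C_ge16 K_le r_le b1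
  (fun i j ij => pair_info_ge_b_n (@beta n) (@k_bnd n) ij) L1 ny2 y0 b3y eps_half (@T_lr n).
have -> : n%:R * (4 * expR (- (2 * L n))) = 4 / n%:R.
  rewrite (_ : - (2 * L n) = - L n + - L n); last by ring.
  rewrite expRD expRN lnK ?posrE//.
  by field; rewrite gt_eqF.
apply: le_trans; apply: prod_prob_le => [|a _]; first exact: bt_pmf_ge0.
exact: le_lt_trans.
Qed.

Lemma lr_approx_tail (eta : R) : 0 < eta ->
  prod_prob (pmf n) (fun a => eta < `|T a - lr_approx a|) @[n --> \oo] --> (0 : R).
Proof.
move=> eta0; apply/cvgrPdist_le => eps eps0.
pose e := Num.min (2 * C ^+ 4)^-1 (eta / C ^+ 32).
have e0 : 0 < e by rewrite lt_min invr_gt0 divr_gt0 ?mulr_gt0 ?exprn_gt0.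
apply: filterS2 (monomial_rate_near e0) (nbhs_infty_ger (4 / eps)) => n [rn b1 L1 bound] n_eps.
have n0 : 0 < n%:R :> R := size_gt0 (design rn b1).
rewrite sub0r normrN ger0_norm; last by rewrite sumr_ge0// => a _; exact/prod_pmf_ge0/bt_pmf_ge0.
apply: le_trans (lr_approx_tail_le rn b1 L1 bound _ _) _.
- by rewrite mulrC -ler_pdivlMr ?mulr_gt0 ?exprn_gt0// div1r ge_min lexx.
- by rewrite mulrC -ler_pdivlMr ?exprn_gt0// ge_min lexx orbT.
- by move: n_eps; rewrite !ler_pdivrMr// mulrC.
Qed.

End Asymptotics.

Theorem theorem4 (R : realType) (K r : nat) (hr : (2 < r)%N)
  (k : forall n : nat, 'I_n -> 'I_n -> nat)
  (hk_sym : forall n (i j : 'I_n), k n i j = k n j i)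
  (hk_bnd : forall n (i j : 'I_n), i != j -> (1 <= k n i j <= K)%N)
  (beta : forall n : nat, 'I_n -> R)
  (hbeta1 : forall n (i : 'I_n), nat_of_ord i = 0%N -> beta n i = 0)
  (hH0 : forall n (i j : 'I_n), (1 <= i)%N -> (i < r)%N -> (1 <= j)%N -> (j < r)%N ->
           beta n i = beta n j)
  (hbc : (fun n : nat => (b_n (beta n) ^+ 11 / c_n (beta n) ^+ 6)
            / (Num.sqrt (n%:R : R) / powR (ln (n%:R : R)) (5 / 2)))
         @ \oo --> (0 : R))
  (T : forall n : nat, outcome n K -> R)
  (hT : forall n (a : outcome n K) (g g0 : 'I_n -> R),
          is_maximizer (k n) a (@full_space R n) g ->
          is_maximizer (k n) a (@null_space R n r) g0 ->
          T n a = 2 * (ell_bt (k n) a g - ell_bt (k n) a g0)) :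
  forall x : R,
    (fun n : nat => bt_cdf (k n) (beta n) (T n) x) @ \oo --> chisq_cdf (r - 2) x.
Proof.
move=> x; have beta_null n : null_space r (beta n) by split; [exact: hbeta1|exact: hH0].
pose P n := prod_pmf (bt_pmf (K := K) (k n) (beta n)).
have -> : (fun n => bt_cdf (k n) (beta n) (T n) x) = (fun n => \sum_(a | T n a <= x) P n a).
  by apply/funext => n; apply: eq_bigr => a _; rewrite bt_probE.
rewrite -(subnSK hr); apply: (@cdf_cvg_of_laplace R (chisq_kernel (r - 3).+1) _ P
  (fun n a => lr_approx r k beta a) T).
- exact: chisq_kernel_ge0.
- exact: integrable_chisq_kernel.
- exact: chisq_mass_gt0.
- by move=> n a; apply: prod_pmf_ge0 => p y; exact: bt_pmf_ge0.
- by move=> n; apply: prod_pmf_sum1 => p; apply: bt_pmf_sum1; exact: hk_bnd.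
- exact: lr_approx_ge0_near.
- by move=> j; rewrite density_laplace_chisq (subnSK hr); exact: lr_approx_laplace.
- exact: lr_approx_tail.
Qed.
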